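(* Let $B$ be a Hermitian contraction in $\mathfrak H$ with associated $\mathfrak H_0,\mathfrak N,B_0,K_0$, and let $\widetilde B$ be a $qsc$-extension of $B$ in $\mathfrak H\oplus\mathcal H$, written in the form $$\widetilde B=\begin{bmatrix}B_0&D_{B_0}K_0^*&0\\ K_0D_{B_0}&-K_0B_0K_0^*+D_{K_0^*}X_{11}D_{K_0^*}&D_{K_0^*}X_{12}\\ 0&X_{21}D_{K_0^*}&X_{22}\end{bmatrix}\quad\text{in }\mathfrak H_0\oplus\mathfrak N\oplus\mathcal H,$$ where $X=\begin{bmatrix}X_{11}&X_{12}\\ X_{21}&X_{22}\end{bmatrix}$ is a contraction in $\mathfrak D_{K_0^*}\oplus\mathcal H$. Let $\Phi_X(z)=X_{11}+zX_{12}(I-zX_{22})^{-1}X_{21}$. Then $$P_{\mathfrak H}(z\widetilde B-I)^{-1}\upharpoonright\mathfrak H=\left(z\widehat B_X(z)-I_{\mathfrak H}\right)^{-1},\qquad |z|<1,$$ where $$\widehat B_X(z)=\tfrac12(B_\mu+B_M)+\tfrac12(B_M-B_\mu)^{1/2}\Phi_X(z)(B_M-B_\mu)^{1/2}=\begin{bmatrix}B_0&D_{B_0}K_0^*\\ K_0D_{B_0}&-K_0B_0K_0^*+D_{K_0^*}\Phi_X(z)D_{K_0^*}\end{bmatrix}.$$ For each fixed $z$ the operator $\widehat B_X(z)$ is a $qsc$-extension of $B$ in $\mathfrak H$. Furthermore, if $\widetilde B\in C_{\mathfrak H\oplus\mathcal H}(\alpha)$ for some $\alpha\in[0,\pi/2)$,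 then $\Phi_X(z)$ and $\widehat B_X(z)$ can be defined (by the same formulas) for $z\in\Pi(\alpha)$ and: (1) for every $\beta\in[\alpha,\pi/2)$ and $z\neq\pm1$, $$z\in\Pi_+(\beta)\Longrightarrow\|\widehat B_X(z)\sin\beta+i\cos\beta\, I\|\le1,\qquad z\in\Pi_-(\beta)\Longrightarrow\|\widehat B_X(z)\sin\beta-i\cos\beta\, I\|\le1,$$ and therefore $z\in C(\beta)\Longrightarrow\widehat B_X(z)\in C_{\mathfrak H}(\beta)$; (2) there exist strong non-tangential limits $\Phi_X(\pm1)\in C_{\mathfrak D_{K_0^*}}(\alpha)$ and $\widehat B_X(\pm1)\in C_{\mathfrak H}(\alpha)$. In particular, for $\alpha=0$ the operator functions $\Phi_X(z)$ and $\widehat B_X(z)$ are defined for $z\in\mathbb C\setminus\{(-\infty,-1]\cup[1,+\infty)\}$, and $\Phi_X(\pm1)$ are selfadjoint contractions given by $$\Phi_X(-1)=\widehat Z_0,\qquad\Phi_X(1)=\widehat Z_1,$$ where $\widehat Z_0=\left((I+X)_{\mathfrak D_{K_0^*}}-I\right)\upharpoonright\mathfrak D_{K_0^*}$ and $\widehat Z_1=\left(I-(I-X)_{\mathfrak D_{K_0^*}}\right)\upharpoonright\mathfrak D_{K_0^*}$; moreover the selfadjoint contractive extensions $\widehat B_X(-1)$ and $\widehat B_X(+1)$ of $B$ in $\mathfrak H$ coincide with $\widehat B_0$ and $\widehat B_1$, respectively, where $$\widehat B_j=\begin{bmatrix}B_0&D_{B_0}K_0^*\\ K_0D_{B_0}&-K_0B_0K_0^*+D_{K_0^*}\widehat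 Z_jD_{K_0^*}\end{bmatrix},\qquad j=0,1.$$
   Context: All Hilbert spaces are complex and separable. For a contraction $T:H_1\to H_2$, $D_T=(I-T^*T)^{1/2}$ and $\mathfrak D_T$ is the closure of $\operatorname{ran}D_T$. A Hermitian contraction $B$ in $\mathfrak H$ is a linear operator defined on a closed subspace $\mathfrak H_0=\operatorname{dom}B$ of $\mathfrak H$, with $\|Bf\|\le\|f\|$ and $(Bf,g)=(f,Bg)$ for $f,g\in\mathfrak H_0$. Put $\mathfrak N=\mathfrak H\ominus\mathfrak H_0$, $B_0=P_{\mathfrak H_0}B$ (a selfadjoint contraction in $\mathfrak H_0$), and let $K_0:\mathfrak D_{B_0}\to\mathfrak N$ be the contraction determined by $K_0D_{B_0}f=P_{\mathfrak N}Bf$, $f\in\mathfrak H_0$. Thus $K_0^*:\mathfrak N\to\mathfrak D_{B_0}\subseteq\mathfrak H_0$ and $D_{K_0^*}$ acts in $\mathfrak N$. A $qsc$-extension (quasi-selfadjoint contractive extension) of $B$ in a Hilbert space $\mathfrak H'\supseteq\mathfrak H$ is an everywhere defined contraction $\widehat B$ in $\mathfrak H'$ such that both $\widehat B$ and $\widehat B^*$ extend $B$. It is known that the displayed block form of $\widetilde B$ gives a bijection between all $qsc$-extensions of $B$ in $\mathfrak H\oplus\mathcal H$ and all contractions $X$ in $\mathfrak D_{K_0^*}\oplus\mathcal H$. The selfadjoint contractive extensions of $B$ in $\mathfrak H$ form an operator interval $[B_\mu,B_M]$ with $$B_\mu=\begin{bmatrix}B_0&D_{B_0}K_0^*\\ K_0D_{B_0}&-K_0B_0K_0^*-D_{K_0^*}^2\end{bmatrix},\qquad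 B_M=\begin{bmatrix}B_0&D_{B_0}K_0^*\\ K_0D_{B_0}&-K_0B_0K_0^*+D_{K_0^*}^2\end{bmatrix}$$ in $\mathfrak H=\mathfrak H_0\oplus\mathfrak N$. Class $C_H(\alpha)$: for $\alpha\in(0,\pi/2)$, $A\in C_H(\alpha)$ means $A\in\mathbf L(H)$ and $\|A\sin\alpha\pm i\cos\alpha\,I_H\|\le1$; $C_H(0)$ is the set of selfadjoint contractions in $H$. Regions: $\Pi_\pm(\alpha)=\{z\in\mathbb C:|z\sin\alpha\pm i\cos\alpha|<1\}$, $\Pi(\alpha)=\Pi_+(\alpha)\cup\Pi_-(\alpha)$, $C(\alpha)=\Pi_+(\alpha)\cap\Pi_-(\alpha)$ for $\alpha\in(0,\pi/2)$; for $\alpha=0$ the conventions are $\Pi(0)=\mathbb C\setminus\left((-\infty,-1]\cup[1,+\infty)\right)$ and $C(0)=[-1,1]$ (with the values at $z=\pm1$ being the limits in (2)), and the two implications involving $\Pi_\pm(\beta)$ are trivial for $\beta=0$. Limits at $\pm1$ are non-tangential limits from within the unit disk. For a bounded nonnegative operator $S$ in a Hilbert space $L$ and a closed subspace $K\subseteq L$, the shorted operator is $S_K=\max\{Z\in\mathbf L(L):0\le Z\le S,\ \operatorname{ran}Z\subseteq K\}$. *)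

(* Defs.v *)
From HB Require Import structures.
From mathcomp Require Import all_boot all_order all_algebra.
From mathcomp Require Import all_classical all_reals all_analysis.
From mathcomp.real_closed Require Import complex.
From mathcomp Require Import ring lra.
Set Implicit Arguments.
Unset Strict Implicit.
Unset Printing Implicit Defensive.
Import Order.TTheory GRing.Theory Num.Theory.
Import numFieldNormedType.Exports.
Local Open Scope classical_set_scope.
Local Open Scope ring_scope.

(* A complex Hilbert space is a complete normed module over [R[i]] whose norm comes
   from an inner product; by the convention of [{dot _ for _}] the latter is linear
   in its first and conjugate-linear in its second argument *)
HB.mixin Record isHilbert (R : realType) V of CompleteNormedModule R[i] V := {
  inner : {dot V for (@Num.conj R[i])} ;
  sqr_normE : forall x : V, `|x| ^+ 2 = inner x x
}.

#[short(type="hilbertType")]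
HB.structure Definition Hilbert (R : realType) :=
  {V of isHilbert R V & CompleteNormedModule R[i] V}.

Arguments inner {R V} : rename.

Section DotNorm.
Context {C : numClosedFieldType} {U : lmodType C} (f : {dot U for @Num.conj C}).

Lemma ler_sqr_imp (a b : C) : 0 <= a -> 0 <= b -> a ^+ 2 <= b ^+ 2 -> a <= b.
Proof. by move=> a0 b0; rewrite ler_pXn2r ?nnegrE. Qed.

Lemma dot_ge0 u : 0 <= f u u.
Proof.
have [->|/neq0_dnorm_gt0/ltW//] := eqVneq u 0.
by rewrite linear0r.
Qed.

Lemma dotZl a u v : f (a *: u) v = a * f u v.
Proof. exact: linearZl_LR. Qed.

Lemma dotZr a u v : f u (a *: v) = a^* * f u v.
Proof. exact: linearZr_LR. Qed.

Lemma dotC u v : f u v = (f v u)^*.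
Proof. by rewrite (hermC f u v)/= expr0 mul1r. Qed.

Lemma dot_CS u v : `|f u v| ^+ 2 <= f u u * f v v.
Proof.
have [->|v0] := eqVneq v 0.
  by rewrite (linear0r f u) (linear0r f 0) normr0 expr0n mulr0.
have fv : 0 < f v v := neq0_dnorm_gt0 v v0.
have fv0 : f v v != 0 by rewrite gt_eqF.
have fvr : (f v v)^* = f v v by rewrite -dotC.
pose a := f u v / f v v; have := dot_ge0 (u - a *: v).
have -> : f (u - a *: v) (u - a *: v) = f u u - `|f u v| ^+ 2 / f v v.
  rewrite hnormB/= expr0 mul1r dotZl !dotZr.
  rewrite /a normCK !rmorphM/= !fmorphV/= conjCK !fvr.
  by field.
by rewrite subr_ge0 ler_pdivrMr.
Qed.

Lemma dot_triangle u v :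
  sqrtC (f (u + v) (u + v)) <= sqrtC (f u u) + sqrtC (f v v).
Proof.
apply: ler_sqr_imp.
- by rewrite sqrtC_ge0 dot_ge0.
- by rewrite addr_ge0// sqrtC_ge0 dot_ge0.
rewrite sqrrD !sqrtCK hnormD/= expr0 mul1r addrAC lerD2r lerD2l.
have re : f u v + (f u v)^* \is Num.real.
  by apply/CrealP; rewrite rmorphD/= conjCK addrC.
apply: le_trans (real_ler_norm re) _.
apply: le_trans (ler_normD _ _) _.
rewrite norm_conjC -mulr2n lerMn2r/=.
apply: ler_sqr_imp => //.
  by rewrite mulr_ge0// sqrtC_ge0 dot_ge0.
by rewrite exprMn !sqrtCK dot_CS.
Qed.

Lemma dot_normZ a u : sqrtC (f (a *: u) (a *: u)) = `|a| * sqrtC (f u u).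
Proof.
rewrite dotZl dotZr mulrA -normCK sqrtCM ?nnegrE ?dot_ge0 ?exprn_ge0//.
by rewrite sqrCK.
Qed.

Lemma dot_norm_eq0 u : sqrtC (f u u) = 0 -> u = 0.
Proof.
move=> /eqP; rewrite sqrtC_eq0 => /eqP fu; apply/eqP/contraT => /(neq0_dnorm_gt0 (s := f)).
by rewrite fu ltxx.
Qed.
End DotNorm.

Lemma nonexpansive_cauchy {K : numFieldType} {M N : normedModType K} (f : M -> N)
    (F : set_system M) : ProperFilter F -> (forall x y, `|f x - f y| <= `|x - y|) ->
  cauchy_ex F -> cauchy (f @ F).
Proof.
move=> FF fle Fc; apply/cauchyP => e e0; have [x Fx] := Fc e e0.
exists (f x); suff : F (f @^-1` ball (f x) e) by [].
apply: filterS Fx => y; rewrite /preimage/= -!ball_normE/=.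
by apply: le_lt_trans; exact: fle.
Qed.

Section InnerTheory.
Context {R : realType} {V : hilbertType R}.
Implicit Types x y : V.

Lemma normE x : `|x| = sqrtC (inner x x).
Proof. by rewrite -sqr_normE sqrCK. Qed.

Lemma inner_le x y : `|inner x y| <= `|x| * `|y|.
Proof.
apply: ler_sqr_imp; rewrite ?mulr_ge0//.
by rewrite exprMn !sqr_normE dot_CS.
Qed.
End InnerTheory.

(* Orthogonal direct sum; an alias of the product type is needed because the
   library norms products by the maximum *)
Definition dsum {R : realType} (U V : hilbertType R) : Type := (U * V)%type.

Section DirectSum.
Context {R : realType} (U V : hilbertType R).

HB.instance Definition _ := GRing.Lmodule.copy (dsum U V) (U * V)%type.

Definition dsum_dot (x y : dsum U V) : R[i] := inner x.1 y.1 + inner x.2 y.2.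

Fact dsum_dot_bilinear :
  (forall y, GRing.linear_for *%R (dsum_dot ^~ y)) *
  (forall x, GRing.linear_for (@Num.conj R[i] \; *%R) (dsum_dot x)).
Proof.
split=> [y a u v|x a u v]; rewrite /dsum_dot/=.
  by rewrite !linearPl mulrDr addrACA.
by rewrite !linearPr/= mulrDr addrACA.
Qed.

HB.instance Definition _ := bilinear_isBilinear.Build R[i] (dsum U V) (dsum U V)
  R[i] _ _ dsum_dot dsum_dot_bilinear.

Fact dsum_dot_herm (x y : dsum U V) :
  dsum_dot x y = (-1) ^+ false * (dsum_dot y x)^*.
Proof.
by rewrite expr0 mul1r /dsum_dot rmorphD/= -!dotC.
Qed.

HB.instance Definition _ := isHermitianSesquilinear.Build R[i] (dsum U V) false
  (@Num.conj R[i]) dsum_dot dsum_dot_herm.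

Fact dsum_dot_gt0 (x : dsum U V) : x != 0 -> 0 < dsum_dot x x.
Proof.
move=> x0; rewrite /dsum_dot -!sqr_normE lt_neqAle addr_ge0 ?exprn_ge0// andbT.
apply: contra_neq x0 => /esym/eqP; rewrite paddr_eq0 ?exprn_ge0//.
rewrite !expf_eq0/= !normr_eq0 => /andP[/eqP x1 /eqP x2].
by case: x x1 x2 => /= ? ? -> ->.
Qed.

HB.instance Definition _ := isDotProduct.Build R[i] (dsum U V) dsum_dot dsum_dot_gt0.

Definition dsum_norm (x : dsum U V) : R[i] := sqrtC (dsum_dot x x).

HB.instance Definition _ := Lmodule_isNormed.Build R[i] (dsum U V)
  (dot_triangle dsum_dot) (dot_normZ dsum_dot) (@dot_norm_eq0 _ _ dsum_dot).

Lemma dsum_normE (x : dsum U V) : `|x| = dsum_norm x.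
Proof. by []. Qed.

Lemma dsum_sqr_norm (x : dsum U V) : `|x| ^+ 2 = dsum_dot x x.
Proof. by rewrite dsum_normE sqrtCK. Qed.

Lemma dsum_norm1 (x : dsum U V) : `|x.1| <= `|x|.
Proof.
apply: ler_sqr_imp => //; rewrite dsum_sqr_norm /dsum_dot -!sqr_normE.
by rewrite lerDl exprn_ge0.
Qed.

Lemma dsum_norm2 (x : dsum U V) : `|x.2| <= `|x|.
Proof.
apply: ler_sqr_imp => //; rewrite dsum_sqr_norm /dsum_dot -!sqr_normE.
by rewrite lerDr exprn_ge0.
Qed.

Lemma dsum_norm_le (x : dsum U V) : `|x| <= `|x.1| + `|x.2|.
Proof.
apply: ler_sqr_imp; rewrite ?addr_ge0// dsum_sqr_norm /dsum_dot -!sqr_normE.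
by rewrite sqrrD -addrA lerD2l lerDr mulrn_wge0// mulr_ge0.
Qed.

Fact dsum_complete (F : set_system (dsum U V)) :
  ProperFilter F -> cauchy F -> cvg F.
Proof.
move=> FF /cauchyP Fc.
have c1 : cvg ((fun x : dsum U V => x.1) @ F : set_system U).
  apply: cauchy_cvg; apply: (@nonexpansive_cauchy _ (dsum U V) U (fun x => x.1) F _ _ Fc).
  by move=> x y; exact: (dsum_norm1 (x - y)).
have c2 : cvg ((fun x : dsum U V => x.2) @ F : set_system V).
  apply: cauchy_cvg; apply: (@nonexpansive_cauchy _ (dsum U V) V (fun x => x.2) F _ _ Fc).
  by move=> x y; exact: (dsum_norm2 (x - y)).
apply/cvg_ex; exists ((lim ((fun x : dsum U V => x.1) @ F : set_system U),
  lim ((fun x : dsum U V => x.2) @ F : set_system V)) : dsum U V).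
apply/cvgrPdist_lt => e e0; near=> x.
apply: le_lt_trans (dsum_norm_le _) _; rewrite [e]splitr ltrD//.
  near: x; move/cvgrPdist_lt : c1; apply; exact: divr_gt0.
near: x; move/cvgrPdist_lt : c2; apply; exact: divr_gt0.
Unshelve. all: by end_near. Qed.

HB.instance Definition _ := Uniform_isComplete.Build (dsum U V) dsum_complete.

HB.instance Definition _ := isHilbert.Build R (dsum U V) dsum_sqr_norm.
End DirectSum.
Lemma dsum_innerE (R : realType) (U V : hilbertType R) (x y : dsum U V) :
  inner x y = inner x.1 y.1 + inner x.2 y.2.
Proof. by []. Qed.

Record csubspace (R : realType) (V : hilbertType R) := CSubspace {
  carrier : set V ;
  carrier_closed : closed carrier ;
  carrier0 : carrier 0 ;
  carrierP : forall a x y, carrier x -> carrier y -> carrier (a *: x + y)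
}.

Section Subspace.
Context {R : realType} {V : hilbertType R} (S : csubspace V).

Definition cmem : {pred V} := mem (carrier S).

Fact cmem_submod_closed : submod_closed cmem.
Proof.
by split=> [|a x y]; rewrite !inE; [exact: carrier0|exact: carrierP].
Qed.

HB.instance Definition _ := GRing.isSubmodClosed.Build R[i] V cmem
  cmem_submod_closed.

Record csub := CSub { csub_val : V ; csub_valP : csub_val \in cmem }.

HB.instance Definition _ := [isSub for csub_val].
HB.instance Definition _ := [Choice of csub by <:].
HB.instance Definition _ := [SubChoice_isSubLmodule of csub by <:].

Definition csub_dot (x y : csub) : R[i] := inner (val x) (val y).

Fact csub_dot_bilinear :
  (forall y, GRing.linear_for *%R (csub_dot ^~ y)) *
  (forall x, GRing.linear_for (@Num.conj R[i] \; *%R) (csub_dot x)).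
Proof.
split=> [y a u v|x a u v]; rewrite /csub_dot [val (_ + _)]linearP.
  by rewrite linearPl.
by rewrite /= linearPr.
Qed.

HB.instance Definition _ := bilinear_isBilinear.Build R[i] csub csub
  R[i] _ _ csub_dot csub_dot_bilinear.

Fact csub_dot_herm (x y : csub) :
  csub_dot x y = (-1) ^+ false * (csub_dot y x)^*.
Proof. by rewrite expr0 mul1r /csub_dot -dotC. Qed.

HB.instance Definition _ := isHermitianSesquilinear.Build R[i] csub false
  (@Num.conj R[i]) csub_dot csub_dot_herm.

Fact csub_dot_gt0 (x : csub) : x != 0 -> 0 < csub_dot x x.
Proof.
move=> x0; apply: neq0_dnorm_gt0; apply: contra_neq x0 => x0.
exact: val_inj.
Qed.

HB.instance Definition _ := isDotProduct.Build R[i] csub csub_dot csub_dot_gt0.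

HB.instance Definition _ := Lmodule_isNormed.Build R[i] csub
  (dot_triangle csub_dot) (dot_normZ csub_dot) (@dot_norm_eq0 _ _ csub_dot).

Lemma csub_sqr_norm (x : csub) : `|x| ^+ 2 = csub_dot x x.
Proof. exact: sqrtCK. Qed.

Lemma csub_normE (x : csub) : `|x| = `|val x|.
Proof. by rewrite normE. Qed.

Fact csub_complete (F : set_system csub) :
  ProperFilter F -> cauchy F -> cvg F.
Proof.
move=> FF /cauchyP Fc.
have c : cvg ((fun x : csub => val x) @ F : set_system V).
  apply: cauchy_cvg.
  apply: (@nonexpansive_cauchy _ csub V (fun x => val x) F _ _ Fc).
  by move=> x y; rewrite csub_normE linearB.
set l := lim _ in c.
have Sl : l \in cmem.
  rewrite inE.
  apply: (closed_cvg (carrier S) _ _ l c).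
  exact: carrier_closed.
  by apply: nearW => x; have := csub_valP x; rewrite inE.
apply/cvg_ex; exists (CSub Sl); apply/cvgrPdist_lt => e e0; near=> x.
rewrite csub_normE linearB/=.
by near: x; move/cvgrPdist_lt : c; apply.
Unshelve. all: by end_near. Qed.

HB.instance Definition _ := Uniform_isComplete.Build csub csub_complete.

HB.instance Definition _ := isHilbert.Build R csub csub_sqr_norm.
End Subspace.

(* Closed subspaces are themselves Hilbert spaces *)
Definition csub_hilbert (R : realType) (V : hilbertType R) (S : csubspace V) :
  hilbertType R := csub S.
Coercion csub_hilbert : csubspace >-> Hilbert.type.

Section BoundedOperators.
Context {R : realType}.
Implicit Types U V W : hilbertType R.

Definition bopp U V : {pred U -> V} :=
  mem [set f : U -> V | linear f /\ continuous f].

Fact bopp_submod_closed U V : submod_closed (@bopp U V).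
Proof.
split=> [|a f g]; rewrite !inE /=.
  split=> [b x y|x]; first by rewrite -[0 x]/(0 : V) -[0 y]/(0 : V) scaler0 addr0.
  exact: cst_continuous.
move=> [lf cf] [lg cg]; split=> [b x y|x].
  have E z : (a *: f + g) z = a *: f z + g z by [].
  by rewrite !E lf lg !scalerDr !scalerA [a * b]mulrC addrACA.
apply: cvgD; last exact: cg.
apply: cvgZl_tmp; exact: cf.
Qed.

HB.instance Definition _ U V := GRing.isSubmodClosed.Build R[i] (U -> V)
  (@bopp U V) (@bopp_submod_closed U V).

Record bop U V := Bop { bop_fun :> U -> V ; bop_funP : bop_fun \in @bopp U V }.

HB.instance Definition _ U V := [isSub for @bop_fun U V].
HB.instance Definition _ U V := [Choice of bop U V by <:].
HB.instance Definition _ U V := [SubChoice_isSubLmodule of bop U V by <:].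

Fact bop_linear U V (T : bop U V) : linear T.
Proof. by have := bop_funP T; rewrite inE => -[]. Qed.

Lemma bop_continuous U V (T : bop U V) : continuous T.
Proof. by have := bop_funP T; rewrite inE => -[]. Qed.

HB.instance Definition _ U V (T : bop U V) :=
  GRing.isLinear.Build R[i] U V _ (bop_fun T) (bop_linear T).

Definition mkbop U V (f : U -> V) (lf : linear f) (cf : continuous f) : bop U V :=
  @Bop U V f (mem_set (conj lf cf)).

Lemma nonexpansive_continuous U V (f : U -> V) :
  linear f -> (forall x, `|f x| <= `|x|) -> continuous f.
Proof.
move=> lf fle x; apply/cvgrPdist_lt => e e0; near=> y.
have -> : f x - f y = f (x - y).
  by have := lf (- 1) y x; rewrite !scaleN1r ![- _ + _]addrC => ->.
apply: le_lt_trans (fle _) _.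
by near: y; apply: cvgr_dist_lt.
Unshelve. all: by end_near. Qed.
End BoundedOperators.

Declare Scope bop_scope.
Delimit Scope bop_scope with bop.
Notation "''L' ( U , V )" := (bop U V)
  (at level 8, format "''L' ( U ,  V )") : type_scope.
Notation "''L' ( U )" := (bop U U) (at level 8, format "''L' ( U )") : type_scope.

Section BasicOperators.
Context {R : realType}.
Implicit Types U V W : hilbertType R.

(* [incl S] is the inclusion of a subspace; [dfst], [dsnd], [dinl] and [dinr] are the
   coordinate projections and embeddings of a direct sum *)
Fact bid_linear U : linear (@id U). Proof. by []. Qed.
Fact bid_continuous U : continuous (@id U). Proof. by move=> x; exact: cvg_id. Qed.
Definition bid {U} : 'L(U) := mkbop (@bid_linear U) (@bid_continuous U).

Fact bcomp_linear U V W (S : 'L(V, W)) (T : 'L(U, V)) : linear (S \o T).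
Proof. by move=> a x y; rewrite /= !linearP. Qed.
Fact bcomp_continuous U V W (S : 'L(V, W)) (T : 'L(U, V)) : continuous (S \o T).
Proof. by move=> x; apply: (@continuous_comp U V W T S); apply: bop_continuous. Qed.
Definition bcomp U V W (S : 'L(V, W)) (T : 'L(U, V)) : 'L(U, W) :=
  mkbop (@bcomp_linear U V W S T) (@bcomp_continuous U V W S T).

Fact incl_linear V (S : csubspace V) : linear (fun x : S => val x : V).
Proof. by move=> a x y; exact: linearP. Qed.
Definition incl V (S : csubspace V) : 'L(S, V) :=
  mkbop (@incl_linear V S)
    (nonexpansive_continuous (@incl_linear V S)
      (fun x => eq_ind_r (fun t => _ <= t) (lexx _) (csub_normE x))).

Fact dfst_linear U V : linear (fun x : dsum U V => x.1).
Proof. by []. Qed.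
Definition dfst {U V} : 'L(dsum U V, U) :=
  mkbop (@dfst_linear U V)
    (nonexpansive_continuous (@dfst_linear U V) (@dsum_norm1 R U V)).

Fact dsnd_linear U V : linear (fun x : dsum U V => x.2).
Proof. by []. Qed.
Definition dsnd {U V} : 'L(dsum U V, V) :=
  mkbop (@dsnd_linear U V)
    (nonexpansive_continuous (@dsnd_linear U V) (@dsum_norm2 R U V)).

Fact dinl_linear U V : linear (fun x : U => (x, 0) : dsum U V).
Proof.
move=> a x y; rewrite -[RHS]/((a *: x + y, a *: 0 + 0) : dsum U V).
by rewrite scaler0 addr0.
Qed.
Fact dinl_norm U V (x : U) : `|((x, 0) : dsum U V)| <= `|x|.
Proof. by apply: le_trans (dsum_norm_le _) _; rewrite /= normr0 addr0. Qed.
Definition dinl {U V} : 'L(U, dsum U V) :=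
  mkbop (@dinl_linear U V)
    (nonexpansive_continuous (@dinl_linear U V) (@dinl_norm U V)).

Fact dinr_linear U V : linear (fun y : V => (0, y) : dsum U V).
Proof.
move=> a x y; rewrite -[RHS]/((a *: 0 + 0, a *: x + y) : dsum U V).
by rewrite scaler0 addr0.
Qed.
Fact dinr_norm U V (y : V) : `|((0, y) : dsum U V)| <= `|y|.
Proof. by apply: le_trans (dsum_norm_le _) _; rewrite /= normr0 add0r. Qed.
Definition dinr {U V} : 'L(V, dsum U V) :=
  mkbop (@dinr_linear U V)
    (nonexpansive_continuous (@dinr_linear U V) (@dinr_norm U V)).
End BasicOperators.
Arguments incl {R V} S.
Notation "S ∘ T" := (bcomp S T) (at level 40, left associativity) : bop_scope.
Local Open Scope bop_scope.

Section Subspaces.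
Context {R : realType}.
Implicit Types U V W : hilbertType R.

Section Orthc.
Context V (S : csubspace V).
Definition orthc_set : set V := [set x | forall y : S, inner x (val y) = 0].

Fact orthc_closed : closed orthc_set.
Proof.
move=> x clx y.
apply/eqP; rewrite -normr_eq0; apply/eqP/le_anti; rewrite normr_ge0 andbT.
apply/ler_addgt0Pr => e e0; rewrite add0r.
have k0 : 0 < `|val y| + 1 by rewrite ltr_wpDl.
have [z [Sz]] := clx _ (nbhsx_ballx x (e / (`|val y| + 1)) (divr_gt0 e0 k0)).
rewrite -ball_normE/= => xz.
have -> : inner x (val y) = inner (x - z) (val y).
  by rewrite linearBl [X in _ - X](Sz y) subr0.
apply: le_trans (inner_le _ _) _.
apply: (@le_trans _ _ (e / (`|val y| + 1) * (`|val y| + 1))).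
  by apply: ler_pM => //; [exact: ltW|rewrite lerDl].
by rewrite divfK// gt_eqF.
Qed.

Fact orthc0 : orthc_set 0. Proof. by move=> y; exact: linear0l. Qed.

Fact orthcP a x y : orthc_set x -> orthc_set y -> orthc_set (a *: x + y).
Proof.
move=> ox oy z; rewrite linearPl [X in _ + X](oy z) addr0 -[RHS](mulr0 a).
by congr (_ * _); exact: ox.
Qed.

Definition orthc : csubspace V := CSubspace orthc_closed orthc0 orthcP.
End Orthc.

Section ClosedRange.
Context U V (T : 'L(U, V)).

Fact clrange0 : closure (range T) 0.
Proof. by apply: subset_closure; exists 0 => //; rewrite linear0. Qed.

Fact clrangeP a x y : closure (range T) x -> closure (range T) y ->
  closure (range T) (a *: x + y).
Proof.
move=> clx cly A.
have c : continuous (fun p : V * V => a *: p.1 + p.2).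
  move=> p; apply: cvgD; last exact: cvg_snd.
  by apply: cvgZl_tmp; exact: cvg_fst.
move=> /(c (x, y)) [[P Q]/= [Px Qy] PQA].
have [_ [[u _ <-] Pu]] := clx _ Px.
have [_ [[v _ <-] Qv]] := cly _ Qy.
exists (a *: T u + T v); split; last exact: (PQA (T u, T v)).
by exists (a *: u + v) => //; rewrite linearP.
Qed.

Definition clrange : csubspace V :=
  CSubspace (@closed_closure _ _) clrange0 clrangeP.
End ClosedRange.
End Subspaces.

Section OperatorNotions.
Context {R : realType}.
Implicit Types U V W : hilbertType R.

Definition separable V := exists D : set V, countable D /\ dense D.

(* [adj], [oproj], [bsqrt] and [shorted] are the unique operators with the stated
   properties; the value [0] of [xget] when there is none does not occur for the
   operators to which they are applied *)
Definition adj U V (T : 'L(U, V)) : 'L(V, U) :=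
  xget 0 [set S : 'L(V, U) | forall x y, inner (T x) y = inner x (S y)].

(* The orthogonal projection onto [S], as an operator with values in [S] *)
Definition oproj V (S : csubspace V) : 'L(V, S) :=
  xget 0 [set P : 'L(V, S) | forall x (y : S), inner (x - incl S (P x)) (incl S y) = 0].

Definition selfadjoint V (T : 'L(V)) := adj T = T.

Definition contractive U V (T : 'L(U, V)) := forall x, `|T x| <= `|x|.

Definition bpos V (T : 'L(V)) := forall x, 0 <= inner (T x) x.

Definition ble V (S T : 'L(V)) := bpos (T - S).

Definition bsqrt V (T : 'L(V)) : 'L(V) :=
  xget 0 [set Q : 'L(V) | bpos Q /\ Q ∘ Q = T].

Definition inverse_of U V (T : 'L(U, V)) : set 'L(V, U) :=
  [set S | S ∘ T = bid /\ T ∘ S = bid].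

Definition invertible U V (T : 'L(U, V)) := exists S, inverse_of T S.

(* The bounded inverse; it is [0] when [T] is not invertible, so its use is
   always accompanied by a claim of [invertible T] *)
Definition binv U V (T : 'L(U, V)) : 'L(V, U) := xget 0 (inverse_of T).

Definition defect U V (T : 'L(U, V)) : 'L(U) := bsqrt (bid - adj T ∘ T).

Definition defspace U V (T : 'L(U, V)) : csubspace U := clrange (defect T).

(* [D_T] with its codomain restricted to the defect space of [T] *)
Definition cdefect U V (T : 'L(U, V)) : 'L(U, defspace T) :=
  oproj (defspace T) ∘ defect T.

Definition shorted V (S : 'L(V)) (K : set V) : 'L(V) :=
  let dom := [set Z : 'L(V) | [/\ bpos Z, ble Z S & range Z `<=` K]] in
  xget 0 [set Z | dom Z /\ forall Z', dom Z' -> ble Z' Z].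

(* Block operators in [V = S (+) S^perp] and in [S (+) S^perp (+) W] *)
Definition block2 V (S : csubspace V)
    (A11 : 'L(S, S)) (A12 : 'L(orthc S, S))
    (A21 : 'L(S, orthc S)) (A22 : 'L(orthc S, orthc S)) : 'L(V) :=
  let p1 := oproj S in let p2 := oproj (orthc S) in
  incl S ∘ (A11 ∘ p1 + A12 ∘ p2) + incl (orthc S) ∘ (A21 ∘ p1 + A22 ∘ p2).

Definition block3 V W (S : csubspace V)
    (A11 : 'L(S, S)) (A12 : 'L(orthc S, S)) (A13 : 'L(W, S))
    (A21 : 'L(S, orthc S)) (A22 : 'L(orthc S, orthc S)) (A23 : 'L(W, orthc S))
    (A31 : 'L(S, W)) (A32 : 'L(orthc S, W)) (A33 : 'L(W, W)) : 'L(dsum V W) :=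
  let p1 := oproj S ∘ dfst in let p2 := oproj (orthc S) ∘ dfst in
  let p3 := dsnd in
  dinl ∘ incl S ∘ (A11 ∘ p1 + A12 ∘ p2 + A13 ∘ p3)
  + dinl ∘ incl (orthc S) ∘ (A21 ∘ p1 + A22 ∘ p2 + A23 ∘ p3)
  + dinr ∘ (A31 ∘ p1 + A32 ∘ p2 + A33 ∘ p3).

Definition entry11 U V (X : 'L(dsum U V)) : 'L(U) := dfst ∘ X ∘ dinl.
Definition entry12 U V (X : 'L(dsum U V)) : 'L(V, U) := dfst ∘ X ∘ dinr.
Definition entry21 U V (X : 'L(dsum U V)) : 'L(U, V) := dsnd ∘ X ∘ dinl.
Definition entry22 U V (X : 'L(dsum U V)) : 'L(V) := dsnd ∘ X ∘ dinr.
End OperatorNotions.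

Section Regions.
Context {R : realType}.
Implicit Types (a : R) (z : R[i]).

Definition sinC a : R[i] := (sin a)%:C%C.
Definition cosC a : R[i] := (cos a)%:C%C.
Definition icos a : R[i] := 'i%C * cosC a.

Definition Pi_plus a : set R[i] := [set z | `|z * sinC a + icos a| < 1].
Definition Pi_minus a : set R[i] := [set z | `|z * sinC a - icos a| < 1].

(* On [R[i]], [x <= y] means that [y - x] is a nonnegative real number, so the
   conditions below describe real half-lines and a real segment *)
Definition Pi_region a : set R[i] :=
  if a == 0 then [set z | ~ (z <= -1) /\ ~ (1 <= z)]
  else Pi_plus a `|` Pi_minus a.

Definition C_region a : set R[i] :=
  if a == 0 then [set z | -1 <= z <= 1] else Pi_plus a `&` Pi_minus a.

Definition C_class (V : hilbertType R) a (A : 'L(V)) : Prop :=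
  if a == 0 then selfadjoint A /\ contractive A
  else contractive (sinC a *: A + icos a *: bid) /\
       contractive (sinC a *: A - icos a *: bid).

Definition stolz (w : R[i]) (M : R) : set R[i] :=
  [set z | `|z| < 1 /\ `|w - z| < M%:C%C * (1 - `|z|)].

(* Strong non-tangential limit at the boundary point [w] of the unit disk *)
Definition strong_nt_limit (U V : hilbertType R) (F : R[i] -> 'L(U, V)) (w : R[i])
    (L : 'L(U, V)) :=
  forall (x : U) (M : R), 1 < M ->
    F z x @[z --> within (stolz w M) (nbhs (w : R[i]^o))] --> L x.
End Regions.

Section Extensions.
Context {R : realType} {H : hilbertType R} {H0 : csubspace H}.
Implicit Types B : 'L(H0, H).

Definition hermitian_contraction B :=
  contractive B /\ forall f g : H0, inner (B f) (incl H0 g) = inner (incl H0 f) (B g).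

Definition extends B (H' : hilbertType R) (J : 'L(H, H')) (T : 'L(H')) :=
  T ∘ J ∘ incl H0 = J ∘ B.

(* [J] is the inclusion of [H] in [H'] *)
Definition qsc_extension B (H' : hilbertType R) (J : 'L(H, H')) (T : 'L(H')) :=
  [/\ contractive T, extends B J T & extends B J (adj T)].

Definition sc_extension B (T : 'L(H)) :=
  [/\ selfadjoint T, contractive T & extends B bid T].

Definition B0 B : 'L(H0) := oproj H0 ∘ B.

Definition is_K0 B (K0 : 'L(defspace (B0 B), orthc H0)) :=
  contractive K0 /\ K0 ∘ cdefect (B0 B) = oproj (orthc H0) ∘ B.

Section Blocks.
Context {B : 'L(H0, H)} (K0 : 'L(defspace (B0 B), orthc H0)).

Local Notation DB0 := (defspace (B0 B)).
Local Notation N := (orthc H0).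
Local Notation DK := (defspace (adj K0)).

(* [D_{B0} K0^*], [K0 D_{B0}] and [K0 B0 K0^*]. The defect space of [B0] is invariant
   under [B0], so [oproj DB0] only restricts the codomain there *)
Definition DBK : 'L(N, H0) := defect (B0 B) ∘ incl DB0 ∘ adj K0.
Definition KDB : 'L(H0, N) := K0 ∘ cdefect (B0 B).
Definition KBK : 'L(N) := K0 ∘ oproj DB0 ∘ B0 B ∘ incl DB0 ∘ adj K0.

(* [D_{K0^*} Y] and [Y D_{K0^*}] for [Y] with values in, respectively defined
   on, the defect space of [K0^*] *)
Definition DKl (W : hilbertType R) (Y : 'L(W, DK)) : 'L(W, N) :=
  defect (adj K0) ∘ incl DK ∘ Y.
Definition DKr (W : hilbertType R) (Y : 'L(DK, W)) : 'L(N, W) :=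
  Y ∘ cdefect (adj K0).

Definition B_mu : 'L(H) :=
  block2 (B0 B) DBK KDB (- KBK - defect (adj K0) ∘ defect (adj K0)).
Definition B_M : 'L(H) :=
  block2 (B0 B) DBK KDB (- KBK + defect (adj K0) ∘ defect (adj K0)).

Definition ext_block (Y : 'L(DK)) : 'L(H) :=
  block2 (B0 B) DBK KDB (- KBK + DKl (DKr Y)).

Section Lift.
Context {E : hilbertType R} (X : 'L(dsum DK E)).

Definition B_tilde : 'L(dsum H E) :=
  block3 (B0 B) DBK                              0
         KDB    (- KBK + DKl (DKr (entry11 X))) (DKl (entry12 X))
         0      (DKr (entry21 X))               (entry22 X).

Definition Phi (z : R[i]) : 'L(DK) :=
  entry11 X +
  z *: (entry12 X ∘ binv (bid - z *: entry22 X) ∘ entry21 X).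

(* The range of [bsqrt (B_M - B_mu)] lies in the defect space of [K0^*]; [P] and [J]
   change the codomain of the right factor and the domain of the left one *)
Definition B_hat (z : R[i]) : 'L(H) :=
  let Q := bsqrt (B_M - B_mu) in
  let J := incl N ∘ incl DK in
  let P := oproj DK ∘ oproj N in
  2^-1 *: (B_mu + B_M) + 2^-1 *: (Q ∘ J ∘ Phi z ∘ P ∘ Q).

(* [range dinl] is the defect space of [K0^*], as a subspace of the direct sum *)
Definition Z0 : 'L(DK) := entry11 (shorted (bid + X) (range dinl) - bid).
Definition Z1 : 'L(DK) := entry11 (bid - shorted (bid - X) (range dinl)).
End Lift.
End Blocks.
End Extensions.

(* Main.v *)
(* If [A (u, z h) = (F u, h)] for all [u] and suitable [h], then [F] is the value at [z] of
   the transfer function [A11 + z A12 (I - z A22)^-1 A21], and every quadratic inequality for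
   [A] at [(u, z h)] yields one for [F]. Both [Phi_X] (from [X]) and [B_hat X] (from the
   extension [Bt]) arise in this way, which gives contractivity, the resolvent formula and
   the class estimates. The class [C(alpha)] amounts to
   [2 cos alpha |Im <A x, x>| <= sin alpha (|x|^2 - |A x|^2)]; it passes from [Bt] to [X]
   because [Bt] is the compression of the orthogonal sum of a selfadjoint unitary and [X].
   The operator [I - X] is then sectorial, [I - X = Q L Q] with [L] coercive on the closed
   range of [Q], and the boundary values at [z = 1] are obtained by solving a Lax-Milgram
   problem in the energy space; [z = -1] follows from [Phi_(-X)(z) = -Phi_X(-z)]. For
   [alpha = 0] the same quadratic form, minimised over the second component, is Krein's
   formula for the shorted operator. *)
From HB Require Import structures.
Require Import Defs.
From mathcomp Require Import all_boot all_order all_algebra.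
From mathcomp Require Import all_classical all_reals all_analysis.
From mathcomp.real_closed Require Import complex.
From mathcomp Require Import ring lra.
Import Order.TTheory GRing.Theory Num.Theory.
Import numFieldNormedType.Exports.
Local Open Scope classical_set_scope.
Local Open Scope ring_scope.
Local Open Scope bop_scope.
Set Implicit Arguments.
Unset Strict Implicit.
Unset Printing Implicit Defensive.
Local Notation incl := Defs.incl.

(** * Real inner products and norms *)

(** The obstacle at [z = 1] is that [I - X22] need not be invertible there: [h] may be unbounded as
    [z] tends to 1, and what can be controlled is only [Q (0, z h)]. Hence the limit problem is
    posed in the closure of [Q (0 (+) E)] and not in [E]. The quadratic form of [C(alpha)] is used
    because the two norm conditions become vacuous at [alpha = 0], while the form then says
    selfadjoint contraction. It passes directly from [A] to [F] only for real [z], where [<h, z h>]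
    is real; for complex [z] the two discs are treated separately. The passage from [Bt] to [X]
    holds only up to an error at each vector, because ranges of defect operators are dense in the
    defect spaces but need not be closed; closedness of quadratic inequalities removes the error. No
    spectral calculus enters. Square roots come from an iteration whose limit commutes with every
    operator commuting with the given one; this yields both their uniqueness and the commutation of
    [B0] with its defect operator. *)

Section RealDot.
Context {R : realType} {V : hilbertType R}.
Implicit Types (x y z : V) (r : R).

(* All estimates are carried out over the reals: [Re <x, y>] and [|x|^2] as elements of
   [R]. The imaginary part is recovered as [Im <x, y> = Re <x, 'i y>]. *)
Definition rdot x y : R := complex.Re (inner x y).
Definition nsq x : R := rdot x x.

Lemma inner_self x : inner x x = (nsq x)%:C%C.
Proof.
have := dot_ge0 (@inner R V) x; rewrite lecE /nsq /rdot => /andP[/eqP/= i0 _].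
by move: i0; case: (inner x x) => a b /= ->.
Qed.

Lemma sqr_normC x : `|x| ^+ 2 = (nsq x)%:C%C.
Proof. by rewrite sqr_normE inner_self. Qed.

Lemma nsq_ge0 x : 0 <= nsq x.
Proof. by rewrite -ler0c -sqr_normC exprn_ge0. Qed.

Lemma nsq_eq0 x : nsq x = 0 -> x = 0.
Proof.
move=> x0; apply/eqP; rewrite -normr_eq0 -sqrf_eq0 sqr_normC x0.
exact/eqP.
Qed.

Lemma ler_norm_nsq (W : hilbertType R) x (y : W) :
  (`|x| <= `|y|) = (complex.Re (`|x| ^+ 2) <= complex.Re (`|y| ^+ 2)).
Proof.
rewrite -(@ler_pXn2r _ 2)// ?nnegrE//.
by rewrite !sqr_normE lecE/= !(ger0_Im (dot_ge0 _ _)) eqxx.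
Qed.

Lemma innerE x y : inner x y = (rdot x y +i* rdot x ('i%C *: y))%C.
Proof.
rewrite /rdot linearZr_LR/=; case: (inner x y) => a b /=.
congr (_ +i* _)%C; simpc; rewrite /=; ring.
Qed.

Lemma rdotC x y : rdot x y = rdot y x.
Proof. by rewrite /rdot dotC; case: (inner y x). Qed.

Lemma rdotDl x y z : rdot (x + y) z = rdot x z + rdot y z.
Proof. by rewrite /rdot linearDl/= raddfD. Qed.
Lemma rdotDr x y z : rdot x (y + z) = rdot x y + rdot x z.
Proof. by rewrite /rdot linearDr/= raddfD. Qed.
Lemma rdotNl x y : rdot (- x) y = - rdot x y.
Proof. by rewrite /rdot linearNl/= raddfN. Qed.
Lemma rdotNr x y : rdot x (- y) = - rdot x y.
Proof. by rewrite /rdot linearNr/= raddfN. Qed.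
Lemma rdot0l x : rdot 0 x = 0.
Proof. by rewrite /rdot linear0l. Qed.
Lemma rdot0r x : rdot x 0 = 0.
Proof. by rewrite /rdot linear0r. Qed.
Lemma rdotZl (a : R[i]) x y :
  rdot (a *: x) y = complex.Re a * rdot x y - complex.Im a * rdot x ('i%C *: y).
Proof. by rewrite /rdot dotZl innerE; case: a => a b /=. Qed.
Lemma rdotZr (a : R[i]) x y :
  rdot x (a *: y) = complex.Re a * rdot x y + complex.Im a * rdot x ('i%C *: y).
Proof.
rewrite {1}/rdot dotZr innerE; case: a => a b /=.
by rewrite mulNr opprK.
Qed.
Lemma rdotii x y : rdot ('i%C *: x) ('i%C *: y) = rdot x y.
Proof. by rewrite rdotZl/= scalerA -expr2 sqr_i scaleN1r rdotNr; ring. Qed.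
Lemma rdoti x y : rdot ('i%C *: x) y = - rdot x ('i%C *: y).
Proof. by rewrite rdotZl/=; ring. Qed.
Lemma rdotxi x : rdot x ('i%C *: x) = 0.
Proof. by have := rdoti x x; rewrite rdotC; lra. Qed.

Lemma nsqN x : nsq (- x) = nsq x.
Proof. by rewrite /nsq rdotNl rdotNr opprK. Qed.
Lemma nsq0 : nsq 0 = 0. Proof. exact: rdot0l. Qed.
Lemma nsqD x y : nsq (x + y) = nsq x + 2 * rdot x y + nsq y.
Proof. by rewrite /nsq !(rdotDl, rdotDr) (rdotC y x); ring. Qed.
Lemma nsqB x y : nsq (x - y) = nsq x - 2 * rdot x y + nsq y.
Proof. by rewrite nsqD rdotNr nsqN; ring. Qed.
Lemma nsqBC x y : nsq (x - y) = nsq (y - x).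
Proof. by rewrite -nsqN opprB. Qed.

Definition csq (a : R[i]) : R := complex.Re a ^+ 2 + complex.Im a ^+ 2.

Lemma csq_ge0 a : 0 <= csq a.
Proof. by rewrite addr_ge0 ?sqr_ge0. Qed.

Lemma csqE a : `|a| ^+ 2 = (csq a)%:C%C.
Proof. by rewrite -add_Re2_Im2. Qed.

Lemma nsqZ (a : R[i]) x : nsq (a *: x) = csq a * nsq x.
Proof.
rewrite /nsq rdotZl (rdotZr a).
have -> : rdot x ('i%C *: (a *: x)) = - (complex.Im a * nsq x).
  by rewrite -[LHS]opprK -rdoti (rdotZr a) rdoti rdotii rdotxi /nsq; ring.
by rewrite rdotxi /csq /nsq; ring.
Qed.

Lemma nsqi x : nsq ('i%C *: x) = nsq x.
Proof. by rewrite nsqZ /csq/=; ring. Qed.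

(* [2 Re <x, y> <= r |x|^2 + |y|^2 / r], in the form free of division *)
Lemma rdot_young r x y : 0 < r -> 2 * r * rdot x y <= r ^+ 2 * nsq x + nsq y.
Proof.
move=> r0; have := nsq_ge0 (r%:C%C *: x - y).
by rewrite nsqB nsqZ rdotZl /csq/=; nra.
Qed.

Lemma rdot_amgm x y : 2 * rdot x y <= nsq x + nsq y.
Proof. by have := nsq_ge0 (x - y); rewrite nsqB; lra. Qed.

Lemma rdot_CS x y : rdot x y ^+ 2 <= nsq x * nsq y.
Proof.
have [->|y0] := eqVneq y 0; first by rewrite rdot0r nsq0 expr0n mulr0.
have ny : 0 < nsq y.
  by rewrite lt_def nsq_ge0 andbT; apply: contra_neq y0; exact: nsq_eq0.
have := nsq_ge0 ((nsq y)%:C%C *: x - (rdot x y)%:C%C *: y).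
rewrite nsqB !nsqZ rdotZl (rdotZr (rdot x y)%:C%C)/= /csq/= => h.
have : 0 <= nsq y * (nsq x * nsq y - rdot x y ^+ 2).
  by apply: le_trans h _; rewrite le_eqVlt; apply/orP; left; apply/eqP; ring.
by rewrite pmulr_rge0// subr_ge0.
Qed.

Lemma rdot_ext x y : (forall z, rdot x z = rdot y z) -> x = y.
Proof.
move=> h; apply/eqP; rewrite -subr_eq0; apply/eqP/nsq_eq0.
by rewrite /nsq rdotDl rdotNl h subrr.
Qed.

Lemma nsqD_le x y : nsq (x + y) <= 2 * nsq x + 2 * nsq y.
Proof. by rewrite nsqD; have := rdot_amgm x y; lra. Qed.
Lemma nsqB_le x y z : nsq (x - z) <= 2 * nsq (x - y) + 2 * nsq (y - z).
Proof. by have := nsqD_le (x - y) (y - z); rewrite addrA subrK. Qed.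

Lemma small_nsq x : (forall e, 0 < e -> nsq x <= e) -> x = 0.
Proof.
move=> h; apply: nsq_eq0; apply/le_anti; rewrite nsq_ge0 andbT.
by apply/ler_addgt0Pr => e e0; rewrite add0r h.
Qed.
End RealDot.

Section ContractionNsq.
Context {R : realType}.
Implicit Types U V W : hilbertType R.

Lemma ler_nsq U V (x : U) (y : V) : (`|x| <= `|y|) = (nsq x <= nsq y).
Proof. by rewrite ler_norm_nsq !sqr_normC. Qed.

Lemma contractiveE U V (T : 'L(U, V)) :
  contractive T <-> forall x, nsq (T x) <= nsq x.
Proof. by split=> h x; have := h x; rewrite ler_nsq. Qed.
End ContractionNsq.

Section RealScalars.
Context {R : realType} {V : hilbertType R}.
Implicit Types (x y : V) (r : R).

Lemma rdotZlR r x y : rdot (r%:C%C *: x) y = r * rdot x y.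
Proof. by rewrite rdotZl/= mul0r subr0. Qed.
Lemma rdotZrR r x y : rdot x (r%:C%C *: y) = r * rdot x y.
Proof. by rewrite rdotC rdotZlR rdotC. Qed.
Lemma nsqZR r x : nsq (r%:C%C *: x) = r ^+ 2 * nsq x.
Proof. by rewrite nsqZ /csq/= expr0n/= addr0. Qed.

Lemma posC_ex (e : R[i]) : 0 < e -> exists2 r : R, 0 < r & e = r%:C%C.
Proof. by case: e => a b; rewrite ltcE/= => /andP[/eqP -> a0]; exists a. Qed.

Lemma norm_ltC x r : 0 < r -> (`|x| < r%:C%C) = (nsq x < r ^+ 2).
Proof.
move=> r0; rewrite -(@ltr_pXn2r _ 2)// ?nnegrE// ?ler0c ?ltW//.
by rewrite sqr_normC -rmorphXn ltcR.
Qed.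
End RealScalars.

(** * Boundedness, completeness and limits in terms of squared norms *)

Section Topology.
Context {R : realType}.
Implicit Types U V W : hilbertType R.

Lemma bop_bounded U V (T : 'L(U, V)) :
  exists2 c : R, 0 < c & forall x, nsq (T x) <= c * nsq x.
Proof.
have /linear_boundedP/pinfty_ex_gt0[M /posC_ex[c c0 ->] h] :
  bounded_near T (nbhs 0) by apply/linear_bounded_continuous/bop_continuous.
exists (c ^+ 2); first by rewrite exprn_gt0.
move=> x; rewrite -lecR rmorphM rmorphXn/= -!sqr_normC -exprMn.
by rewrite ler_pXn2r ?nnegrE ?mulr_ge0 ?ler0c ?(ltW c0)//; exact: h.
Qed.

Lemma bop_of_bounded U V (f : U -> V) (c : R) : linear f ->
  (forall x, nsq (f x) <= c * nsq x) -> exists T : 'L(U, V), forall x, T x = f x.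
Proof.
move=> lf fc.
pose lF := GRing.isLinear.Build R[i] U V _ f lf.
pose g : {linear U -> V} := HB.pack f lF.
have cf : continuous g.
  apply/linear_bounded_continuous/linear_boundedP.
  (* [|c| + 1] dominates the square root of [c] without extracting it, and is positive whatever the
     sign of [c]. *)
  have k0 : 0 < (`|c| + 1)%:C%C :> R[i] by rewrite ltcR ltr_wpDl.
  exists (`|c| + 1)%:C%C; split; first exact: gtr0_real.
  move=> r kr x; apply: (@le_trans _ _ ((`|c| + 1)%:C%C * `|x|)); last first.
    by rewrite ler_wpM2r// ltW.
  rewrite -(@ler_pXn2r _ 2)// ?nnegrE ?mulr_ge0 ?(ltW k0)//.
  rewrite exprMn !sqr_normC -rmorphXn -rmorphM lecR.
  apply: le_trans (fc x) _; rewrite ler_wpM2r ?nsq_ge0//.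
  have := ler_norm c; have := normr_ge0 c; nra.
by exists (mkbop lf cf).
Qed.

Lemma hilbert_complete V (u : nat -> V) :
  (forall e : R, 0 < e ->
     exists N, forall n, (N <= n)%N -> nsq (u n - u N) <= e) ->
  exists l, forall e : R, 0 < e ->
    exists N, forall n, (N <= n)%N -> nsq (u n - l) <= e.
Proof.
move=> uc.
have c : cvg (u @ \oo).
  apply: cauchy_cvg; apply/cauchyP => e /posC_ex[r r0 ->].
  have [|N hN] := uc (r ^+ 2 / 2); first by rewrite divr_gt0// exprn_gt0.
  exists (u N); exists N => // n /= Nn; rewrite -ball_normE/= norm_ltC//.
  rewrite nsqBC; apply: le_lt_trans (hN n Nn) _.
  have : 0 < r ^+ 2 by rewrite exprn_gt0.
  lra.
exists (lim (u @ \oo)) => e e0.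
move/cvgrPdist_lt: (c) => /(_ (Num.sqrt e)%:C%C).
rewrite ltcR sqrtr_gt0 => /(_ e0) [N _ hN]; exists N => n Nn.
have := hN n Nn; rewrite /= norm_ltC ?sqrtr_gt0// sqr_sqrtr ?(ltW e0)// => /ltW.
by rewrite nsqBC.
Qed.

Lemma closure_nsqP V (A : set V) (x : V) :
  closure A x <-> forall e : R, 0 < e -> exists2 y, A y & nsq (x - y) <= e.
Proof.
split=> [clx e e0|h B /nbhs_ballP[_ /posC_ex[r r0 ->] rB]].
  have s0 : 0 < (Num.sqrt e)%:C%C :> R[i] by rewrite ltcR sqrtr_gt0.
  have [y [Ay]] := clx _ (nbhsx_ballx x _ s0).
  rewrite -ball_normE/= norm_ltC ?sqrtr_gt0// sqr_sqrtr ?(ltW e0)// => /ltW ?.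
  by exists y.
have [|y Ay xy] := h (r ^+ 2 / 2); first by rewrite divr_gt0// exprn_gt0.
exists y; split=> //; apply: rB; rewrite -ball_normE/= norm_ltC//.
apply: le_lt_trans xy _; have : 0 < r ^+ 2 by rewrite exprn_gt0.
lra.
Qed.

Lemma clrange_approx U V (T : 'L(U, V)) (y : clrange T) (e : R) : 0 < e ->
  exists u, nsq (incl (clrange T) y - T u) <= e.
Proof.
move=> e0; have := csub_valP y; rewrite inE => /closure_nsqP/(_ e e0)[_ [u _ <-]] h.
by exists u.
Qed.

Lemma clrange_in U V (T : 'L(U, V)) (x : V) :
  (forall e : R, 0 < e -> exists u, nsq (x - T u) <= e) ->
  exists y : clrange T, incl (clrange T) y = x.
Proof.
move=> h; have xT : x \in cmem (clrange T).
  by rewrite inE; apply/closure_nsqP => e /h[u xu]; exists (T u) => //; exists u.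
by exists (CSub xT).
Qed.

(** Epsilon-delta form of [strong_nt_limit] with squared distances, the form in which the estimates
    arrive. *)
Definition nt_limit U V (F : R[i] -> 'L(U, V)) (w : R[i]) (L : 'L(U, V)) :=
  forall u (M e : R), 1 < M -> 0 < e -> exists2 d : R, 0 < d &
    forall z, stolz w M z -> csq (w - z) < d -> nsq (F z u - L u) <= e.

Lemma nt_limit_strong U V (F : R[i] -> 'L(U, V)) w L :
  nt_limit F w L -> strong_nt_limit F w L.
Proof.
move=> h u M M1; apply/cvgrPdist_lt => e /posC_ex[r r0 ->].
have [|d d0 hd] := h u M (r ^+ 2 / 2) M1; first by rewrite divr_gt0// exprn_gt0.
have s0 : 0 < (Num.sqrt d)%:C%C :> R[i] by rewrite ltcR sqrtr_gt0.
have dw : nbhs (w : R[i]^o) [set z | csq (w - z) < d].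
  apply/nbhs_ballP; exists ((Num.sqrt d)%:C%C : R[i]) => //= z.
  rewrite -ball_normE/= => wz.
  rewrite -ltcR -csqE -[d]sqr_sqrtr ?(ltW d0)// rmorphXn.
  by rewrite ltr_pXn2r ?nnegrE// ?(ltW s0).
suff : nbhs (w : R[i]^o) [set z | stolz w M z -> `|L u - F z u| < r%:C%C] by [].
apply: filterS dw => z wz Sz.
rewrite norm_ltC// nsqBC; apply: le_lt_trans (hd z Sz wz) _.
have : 0 < r ^+ 2 by rewrite exprn_gt0.
lra.
Qed.
End Topology.

(** * Riesz representation, adjoints and factorizations *)

Section Riesz.
Context {R : realType} {V : hilbertType R}.
Implicit Types (x y : V) (r : R).

Lemma rdot_small y (d : R) : 0 < d ->
  exists2 e : R, 0 < e & forall x, nsq x <= e -> `|rdot x y| <= d.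
Proof.
move=> d0; have n0 : 0 < nsq y + 1 by rewrite ltr_wpDl ?nsq_ge0.
exists (d ^+ 2 / (nsq y + 1)); first by rewrite divr_gt0// exprn_gt0.
move=> x; rewrite ler_pdivlMr// => xe.
rewrite -(@ler_pXn2r _ 2)// ?nnegrE ?(ltW d0)// real_normK ?num_real//.
apply: le_trans (rdot_CS x y) _; apply: le_trans xe.
by rewrite ler_wpM2l ?nsq_ge0// lerDl.
Qed.

Lemma quad_ge0_eq0 (a n : R) : 0 <= n ->
  (forall t, 0 <= 2 * t * a + t ^+ 2 * n) -> a = 0.
Proof.
(* Nearly the minimiser [- a / n]; adding 1 covers [n = 0] and still leaves a strictly negative
   value unless [a = 0]. *)
move=> n0 /(_ (- a / (n + 1))); set s := (n + 1)^-1.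
have sn : s * n = 1 - s.
  by rewrite -(@mulVf _ (n + 1)) ?gt_eqF ?ltr_wpDl// -/s; ring.
have s0 : 0 < s by rewrite invr_gt0 ltr_wpDl.
have -> : 2 * (- a / (n + 1)) * a + (- a / (n + 1)) ^+ 2 * n
    = - (a ^+ 2 * (s + s ^+ 2)).
  by rewrite -/s exprMn; ring: sn.
rewrite oppr_ge0 => h; apply/eqP; rewrite -sqrf_eq0 eq_le sqr_ge0 andbT.
by move: h; rewrite pmulr_lle0// addr_gt0// exprn_gt0.
Qed.

Lemma invS_small (e : R) : 0 < e ->
  exists N, forall n, (N <= n)%N -> n.+1%:R^-1 <= e.
Proof.
move=> e0; exists (Num.trunc e^-1) => n Nn.
rewrite -[e]invrK lef_pV2 ?posrE ?invr_gt0//.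
by apply: le_trans (ltW (truncnS_gt _)) _; rewrite ler_nat.
Qed.

(** The representing vector minimises [J x = |x|^2 - 2 f x]. Only real linearity enters; complex
    linearity is recovered when adjoints are built. *)
Lemma riesz (f : V -> R) (c : R) : 0 <= c ->
  (forall x y, f (x + y) = f x + f y) -> (forall r x, f (r%:C%C *: x) = r * f x) ->
  (forall x, f x ^+ 2 <= c * nsq x) -> exists z, forall x, f x = rdot x z.
Proof.
move=> c0 fD fZ fc.
pose J x := nsq x - 2 * f x.
have Jlb x : - c <= J x.
  have := fc x; have := nsq_ge0 x; rewrite /J => n0 fcx.
  have [|h] := lerP (2 * f x) (nsq x + c); first lra.
  have := ltr_pM (addr_ge0 n0 c0) (addr_ge0 n0 c0) h h.
  have := sqr_ge0 (nsq x - c); lra.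
have hl : has_lbound (range J) by exists (- c) => _ [x _ <-].
have hi : has_inf (range J) by split=> //; exists (J 0), 0.
pose m := inf (range J).
have mJ x : m <= J x by apply: ge_inf => //; exists x.
have uex n : exists x, J x < m + n.+1%:R^-1.
  have [|_ [x _ <-] h] := @inf_adherent _ (range J) (n.+1%:R^-1) _ hi.
    by rewrite invr_gt0.
  by exists x.
have [u uJ] := choice uex.
(* Parallelogram law at the midpoint, where [J] is at least [m]: minimising sequences are Cauchy. *)
have par x y : nsq (x - y) <= 2 * (J x - m) + 2 * (J y - m).
  have := mJ ((2^-1)%:C%C *: (x + y)).
  by rewrite /J nsqZR fZ fD nsqD nsqB; lra.
have [|z zu] := @hilbert_complete _ _ u.
  move=> e e0; have [|N hN] := @invS_small (e / 4); first by rewrite divr_gt0.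
  exists N => n Nn; apply: le_trans (par _ _) _.
  by have := lt_le_trans (uJ n) (lerD (lexx m) (hN n Nn));
     have := lt_le_trans (uJ N) (lerD (lexx m) (hN N (leqnn _))); lra.
(* Euler equation: [rdot z v - f v] is half the linear coefficient in [t] of [J (z + t v) - J z],
   which is nonnegative for all real [t]. *)
exists z => v; suff : rdot z v - f v = 0 by move/eqP; rewrite subr_eq0 rdotC => /eqP.
apply: (@quad_ge0_eq0 _ (nsq v)) => [|t]; first exact: nsq_ge0.
apply/ler_addgt0Pr => d d0.
have d4 : 0 < d / 4 by rewrite divr_gt0.
have [e e0 he] := rdot_small (t%:C%C *: v) d4.
have [N hN] := zu e e0.
have [N' hN'] := invS_small d4.
pose n := (N + N')%N; have nd := hN' n (leq_addl _ _).
have := he _ (hN n (leq_addr _ _)); rewrite ler_norml => /andP[_].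
rewrite rdotDl rdotNl !rdotZrR => h1.
have := lt_le_trans (uJ n) (lerD (lexx m) nd); have := mJ (u n + t%:C%C *: v).
rewrite /J nsqD nsqZR fD fZ rdotZrR => h2 h3.
by lra.
Qed.
End Riesz.

Section Bops.
Context {R : realType}.
Implicit Types U V W : hilbertType R.

Lemma bopP U V (S T : 'L(U, V)) : (forall x, S x = T x) -> S = T.
Proof. by move=> h; apply: val_inj; apply/funext. Qed.

Lemma bop0E U V x : (0 : 'L(U, V)) x = 0. Proof. by []. Qed.
Lemma bopDE U V (S T : 'L(U, V)) x : (S + T) x = S x + T x. Proof. by []. Qed.
Lemma bopNE U V (S : 'L(U, V)) x : (- S) x = - S x. Proof. by []. Qed.
Lemma bopZE U V a (S : 'L(U, V)) x : (a *: S) x = a *: S x. Proof. by []. Qed.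
Lemma bcompE U V W (S : 'L(V, W)) (T : 'L(U, V)) x : (S ∘ T) x = S (T x).
Proof. by []. Qed.
Lemma bidE U x : (bid : 'L(U)) x = x. Proof. by []. Qed.
Definition bopE := (bop0E, bopDE, bopNE, bopZE, bcompE, bidE).

Lemma rdotZrJ V (a : R[i]) (x y : V) : rdot x (a *: y) = rdot (a^* *: x) y.
Proof. by rewrite rdotZl rdotZr; case: a => a b /=; ring. Qed.

Lemma adj_ex U V (T : 'L(U, V)) :
  exists S : 'L(V, U), forall x y, rdot (T x) y = rdot x (S y).
Proof.
have [c c0 Tc] := bop_bounded T.
have [g gP] : {g : V -> U & forall y x, rdot (T x) y = rdot x (g y)}.
  apply: (@choice _ _ (fun y z => forall x, rdot (T x) y = rdot x z)) => y.
  apply: (@riesz _ _ (fun x => rdot (T x) y) (c * nsq y)).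
  - by rewrite mulr_ge0 ?nsq_ge0 ?ltW.
  - by move=> x x'; rewrite linearD rdotDl.
  - by move=> r x; rewrite linearZ rdotZlR.
  - move=> x; apply: le_trans (rdot_CS _ _) _.
    by rewrite mulrAC ler_wpM2r ?nsq_ge0.
have lg : linear g.
  move=> a y y'; apply: rdot_ext => x; rewrite rdotC -gP rdotDr rdotZrJ -linearZ.
  by rewrite !gP rdotDl (rdotC (a *: _)) rdotZrJ (rdotC _ x).
have [|S SE] := @bop_of_bounded _ _ _ g c lg.
  move=> y; have [->|gy] := eqVneq (g y) 0; first by rewrite nsq0 mulr_ge0 ?nsq_ge0 ?ltW.
  have ny : 0 < nsq (g y).
    by rewrite lt_def nsq_ge0 andbT; apply: contra_neq gy; exact: nsq_eq0.
  rewrite -(ler_pM2l ny) -expr2 {1}/nsq -gP; apply: le_trans (rdot_CS _ _) _.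
  by rewrite mulrCA [leRHS]mulrA ler_wpM2r ?nsq_ge0.
by exists S => x y; rewrite SE gP.
Qed.

Lemma inner_rdot U V (S : 'L(U, V)) (T : 'L(V, U)) :
  (forall x y, inner (S x) y = inner x (T y)) <->
  (forall x y, rdot (S x) y = rdot x (T y)).
Proof.
split=> h x y; first by rewrite /rdot h.
by rewrite !innerE -linearZ !h.
Qed.

Lemma adjP U V (T : 'L(U, V)) x y : rdot (T x) y = rdot x (adj T y).
Proof.
move: x y; apply/inner_rdot; rewrite /adj; case: xgetP => // noS.
by have [S /inner_rdot hS] := adj_ex T; case: (noS S).
Qed.

Lemma adjPr U V (T : 'L(U, V)) x y : rdot (adj T x) y = rdot x (T y).
Proof. by rewrite rdotC -adjP rdotC. Qed.

Lemma adj_uniq U V (T : 'L(U, V)) (S : 'L(V, U)) :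
  (forall x y, rdot (T x) y = rdot x (S y)) -> adj T = S.
Proof.
move=> h; apply: bopP => y; apply: rdot_ext => x.
by rewrite adjPr rdotC h rdotC.
Qed.

Lemma adjK U V (T : 'L(U, V)) : adj (adj T) = T.
Proof. by apply: adj_uniq => x y; exact: adjPr. Qed.

Lemma selfadjointE V (T : 'L(V)) :
  selfadjoint T <-> forall x y, rdot (T x) y = rdot x (T y).
Proof.
split=> [h x y|h]; last exact: adj_uniq.
by rewrite adjP h.
Qed.

(** From [2 |T^* x|^2 = 2 Re <T T^* x, x> <= |T T^* x|^2 + |x|^2], whose first term is at most
    [|T^* x|^2]. *)
Lemma adj_contractive U V (T : 'L(U, V)) : contractive T -> contractive (adj T).
Proof.
move=> /contractiveE h; apply/contractiveE => x.
have := rdot_amgm (T (adj T x)) x; rewrite adjP -/(nsq (adj T x)).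
by have := h (adj T x); lra.
Qed.

Lemma rdot_incl V (S : csubspace V) (s t : S) : rdot (incl S s) (incl S t) = rdot s t.
Proof. by []. Qed.

(** Existence of the projection comes from the adjoint of the inclusion, and its properties then
    reduce to those of [adj]. *)
Lemma oprojE V (S : csubspace V) : oproj S = adj (incl S).
Proof.
apply/esym/adj_uniq => s x.
suff h (z : V) (y : S) : rdot (z - incl S (oproj S z)) (incl S y) = 0.
  rewrite rdotC (rdotC s); apply/eqP; rewrite -subr_eq0; apply/eqP.
  by have := h x s; rewrite rdotDl rdotNl.
rewrite /rdot; suff -> : inner (z - incl S (oproj S z)) (incl S y) = 0 by [].
rewrite /oproj; case: xgetP => [P _ hP|/(_ (adj (incl S)))]; first exact: hP.
case=> x' y'.
have h w : rdot (x' - incl S (adj (incl S) x')) (incl S w) = 0.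
  by rewrite rdotDl rdotNl rdot_incl adjPr subrr.
by rewrite innerE -linearZ !h.
Qed.

Lemma oprojP V (S : csubspace V) x (s : S) :
  rdot (oproj S x) s = rdot x (incl S s).
Proof. by rewrite oprojE adjPr. Qed.

Lemma nsq_incl V (S : csubspace V) (s : S) : nsq (incl S s) = nsq s.
Proof. by []. Qed.

Lemma oproj_incl V (S : csubspace V) (s : S) : oproj S (incl S s) = s.
Proof. by apply: rdot_ext => t; rewrite oprojP. Qed.

End Bops.

(** * Bounded inverses and factorizations through an operator *)

Section Inverses.
Context {R : realType}.
Implicit Types U V W : hilbertType R.

Lemma rdot_dsum U V (x y : dsum U V) : rdot x y = rdot x.1 y.1 + rdot x.2 y.2.
Proof. by rewrite /rdot dsum_innerE raddfD. Qed.
Lemma nsq_dsum U V (x : dsum U V) : nsq x = nsq x.1 + nsq x.2.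
Proof. exact: rdot_dsum. Qed.

Lemma binvP U V (T : 'L(U, V)) : invertible T -> inverse_of T (binv T).
Proof. exact: xgetPex. Qed.

Lemma binvK U V (T : 'L(U, V)) x : invertible T -> binv T (T x) = x.
Proof.
by move=> /binvP[/(congr1 (fun A : 'L(U) => A x))]; rewrite !bopE.
Qed.

Lemma binvKr U V (T : 'L(U, V)) y : invertible T -> T (binv T y) = y.
Proof.
by move=> /binvP[_ /(congr1 (fun A : 'L(V) => A y))]; rewrite !bopE.
Qed.

Lemma nsq_small U V (T : 'L(U, V)) (e : R) : 0 < e ->
  exists2 d : R, 0 < d & forall x, nsq x <= d -> nsq (T x) <= e.
Proof.
move=> e0; have [c c0 Tc] := bop_bounded T.
exists (e / c); first by rewrite divr_gt0.
move=> x; rewrite ler_pdivlMr// mulrC => xe; exact: le_trans (Tc x) xe.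
Qed.

Lemma oproj_orth V (S : csubspace V) y (t : S) :
  rdot (y - incl S (oproj S y)) (incl S t) = 0.
Proof. by rewrite rdotDl rdotNl rdot_incl oprojP subrr. Qed.

Lemma clrange_lift U V (T : 'L(U, V)) u : exists t : clrange T, incl _ t = T u.
Proof. by apply: clrange_in => e e0; exists u; rewrite subrr nsq0 ltW. Qed.

Lemma bounded_below_range U V (T : 'L(U, V)) (k : R) (y : clrange T) : 0 < k ->
  (forall x, k * nsq x <= nsq (T x)) -> exists x, T x = incl _ y.
Proof.
move=> k0 Tk.
have [u uP] : {u : nat -> U & forall n, nsq (incl _ y - T (u n)) <= n.+1%:R^-1}.
  apply: (@choice _ _ (fun n x => nsq (incl _ y - T x) <= n.+1%:R^-1)) => n.
  by apply: clrange_approx; rewrite invr_gt0.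
have [|x xP] := @hilbert_complete _ _ u.
  move=> e e0; have [|N hN] := @invS_small _ (e * k / 4).
    by rewrite divr_gt0// mulr_gt0.
  exists N => n Nn; rewrite -(ler_pM2l k0); apply: le_trans (Tk _) _.
  rewrite linearB; apply: le_trans (nsqB_le _ (incl _ y) _) _; rewrite nsqBC.
  have h1 := le_trans (uP n) (hN n Nn); have h2 := le_trans (uP N) (hN N (leqnn _)).
  lra.
exists x; apply/eqP; rewrite -subr_eq0; apply/eqP/small_nsq => e e0.
have e4 : 0 < e / 4 by rewrite divr_gt0.
have [d d0 dP] := nsq_small T e4.
have [N hN] := invS_small e4; have [N' hN'] := xP d d0; pose n := (N + N')%N.
have h1 := le_trans (uP n) (hN n (leq_addr _ _)).
have := dP _ (hN' n (leq_addl _ _)); rewrite linearB => h2.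
apply: le_trans (nsqB_le _ (T (u n)) _) _.
by rewrite nsqBC (nsqBC (T (u n)) (incl _ y)); lra.
Qed.

(** The lower bound makes the range closed, and the component of [y] orthogonal to the range is
    killed by [adj T], hence zero. *)
Lemma bounded_below_invertible U V (T : 'L(U, V)) (k : R) : 0 < k ->
  (forall x, k * nsq x <= nsq (T x)) -> (forall y, adj T y = 0 -> y = 0) ->
  invertible T.
Proof.
move=> k0 Tk Ti.
have [g gP] : {g : V -> U & forall y, T (g y) = y}.
  apply: (@choice _ _ (fun y x => T x = y)) => y.
  have [x xP] := bounded_below_range (oproj (clrange T) y) k0 Tk.
  exists x; rewrite xP; apply/esym/eqP; rewrite -subr_eq0; apply/eqP/Ti.
  apply: rdot_ext => u; rewrite adjPr rdot0l.
  by have [t <-] := clrange_lift T u; rewrite oproj_orth.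
have Tinj x x' : T x = T x' -> x = x'.
  move=> xx'; apply/eqP; rewrite -subr_eq0; apply/eqP/nsq_eq0.
  have := Tk (x - x'); rewrite linearB/= xx' subrr nsq0 pmulr_rle0// => h.
  by apply/le_anti; rewrite h nsq_ge0.
have lg : linear g by move=> a y y'; apply: Tinj; rewrite linearP/= !gP.
have [|S SE] := @bop_of_bounded _ _ _ g k^-1 lg.
  by move=> y; rewrite -{2}(gP y) ler_pdivlMl.
exists S; split; apply: bopP => x; rewrite !bopE SE//.
by apply: Tinj; rewrite gP.
Qed.

Lemma coercive_invertible V (T : 'L(V)) (k : R) : 0 < k ->
  (forall x, k * nsq x <= rdot (T x) x) -> invertible T.
Proof.
move=> k0 Tk; have k20 : 0 < k ^+ 2 by rewrite exprn_gt0.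
apply: (bounded_below_invertible k20) => [x|y Ty].
  have := Tk x; have := rdot_young (T x) x k0.
  rewrite -(rdotC x) (rdotC x) => h1 h2.
  have := nsq_ge0 (T x - k%:C%C *: x); rewrite nsqB rdotZrR nsqZR => h3.
  nra.
have := Tk y; rewrite adjP Ty rdot0r pmulr_rle0// => h; apply: nsq_eq0.
by apply/le_anti; rewrite h nsq_ge0.
Qed.

(* The closure of the graph [{(j x, T x)}] projects injectively, with closed range, to
   the first coordinate. *)
Lemma douglas V W W' (T : 'L(V, W)) (j : 'L(V, W')) (c : R) :
  (forall x, nsq (T x) <= c * nsq (j x)) ->
  exists Y : 'L(W', W), (forall x, Y (j x) = T x) /\
    forall y, (forall x, rdot y (j x) = 0) -> Y y = 0.
Proof.
move=> Tj; pose g : 'L(V, dsum W' W) := dinl ∘ j + dinr ∘ T.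
have gE x : g x = (j x, T x).
  rewrite /g !bopE/=; rewrite -[LHS]/((j x + 0, 0 + T x) : dsum W' W).
  by rewrite addr0 add0r.
pose J := dfst ∘ incl (clrange g).
have dE (p q : dsum W' W) : nsq (p - q) = nsq (p.1 - q.1) + nsq (p.2 - q.2).
  exact: nsq_dsum.
(* The hypothesis survives passage from the graph to its closure; the factor 4 is the price of two
   uses of [|x + y|^2 <= 2 |x|^2 + 2 |y|^2]. *)
have J2 (p : clrange g) : nsq (incl _ p).2 <= 4 * `|c| * nsq (J p).
  apply/ler_addgt0Pr => d d0.
  have c0 := normr_ge0 c.
  have k0 : 0 < 4 * (`|c| + 1) by lra.
  have [x] := clrange_approx p (divr_gt0 d0 k0).
  rewrite gE dE/= ler_pdivlMr// => hx.
  have h1 := nsqD_le ((incl (clrange g) p).2 - T x) (T x).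
  have h2 := nsqD_le (j x - (incl (clrange g) p).1) (incl (clrange g) p).1.
  rewrite !subrK in h1 h2.
  have h3 : nsq (T x) <= `|c| * nsq (j x).
    by apply: le_trans (Tj x) _; rewrite ler_wpM2r ?nsq_ge0// ler_norm.
  rewrite nsqBC in h2.
  have h4 := nsq_ge0 ((incl (clrange g) p).1 - j x).
  have h5 := nsq_ge0 ((incl (clrange g) p).2 - T x).
  have h6 : `|c| * nsq (j x) <= `|c| * (2 * nsq ((incl (clrange g) p).1 - j x)
     + 2 * nsq (J p)) by rewrite ler_wpM2l.
  nra.
pose k := (1 + 4 * `|c|)^-1; have k0 : 0 < k by rewrite invr_gt0 ltr_wpDr// mulr_ge0.
have Mk p : k * nsq p <= rdot ((adj J ∘ J) p) p.
  rewrite bcompE adjPr -/(nsq _) /k ler_pdivrMl; last by rewrite ltr_wpDr// mulr_ge0.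
  have -> : nsq p = nsq (J p) + nsq (incl _ p).2 by rewrite -nsq_incl nsq_dsum.
  by have := J2 p; lra.
have Mi := coercive_invertible k0 Mk.
(* [(J^* J)^-1 J^*] inverts [J] on its range and vanishes on the orthogonal complement of
   [ran j]. *)
exists (dsnd ∘ incl _ ∘ binv (adj J ∘ J) ∘ adj J); split=> [x|y yj].
  have [t tE] := clrange_lift g x.
  have -> : j x = J t by rewrite /J bcompE tE gE.
  by rewrite !bcompE -(bcompE (adj J)) binvK// tE gE.
suff Jy : adj J y = 0 by rewrite !bcompE Jy !linear0.
apply: rdot_ext => p; rewrite adjPr rdot0l; apply/eqP; rewrite -normr_le0.
apply/ler_addgt0Pr => d d0; rewrite add0r.
have [e e0 he] := rdot_small y d0.
have [x] := clrange_approx p e0; rewrite gE dE/= => px.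
have -> : rdot y (J p) = rdot (J p - j x) y.
  by rewrite rdotDl rdotNl (rdotC (j x)) yj subr0 rdotC.
by apply: he; apply: le_trans px; rewrite lerDl nsq_ge0.
Qed.

Lemma discr_le (A B p : R) : 0 <= A -> 0 <= B ->
  (forall t, t * p <= t ^+ 2 * A + B) -> p ^+ 2 <= 4 * A * B.
Proof.
move=> A0 B0 h; have [->|p0] := eqVneq p 0; first by rewrite expr0n !mulr_ge0.
have [A1|A1] := eqVneq A 0.
  (* Degenerate case: a nonconstant linear function of [t] would be bounded above by [B]. *)
  by have := h ((B + 1) / p); rewrite A1 divfK// mulr0 add0r; lra.
have A2 : 0 < A by rewrite lt_def A1.
have := h (p / (2 * A)); set s := (2 * A)^-1.
have sE : s * A = 2^-1 by rewrite /s invfM mulfVK.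
have -> : p / (2 * A) * p = p ^+ 2 * s by rewrite -/s; ring.
have -> : (p / (2 * A)) ^+ 2 * A = p ^+ 2 * s * (s * A) by rewrite -/s; ring.
rewrite sE => h1; have : p ^+ 2 * s / 2 <= B by lra.
have s0 : 0 < s by rewrite invr_gt0 mulr_gt0.
by rewrite -(ler_pM2l A2); nra.
Qed.

(** Two Douglas factorizations, one for each argument of the form: first [T = Y j], then [adj Y] is
    itself factored through [j]. *)
Lemma form_factor V W (T : 'L(V)) (j : 'L(V, W)) (C : R) : 0 <= C ->
  (forall x y, rdot (T x) y <= C * (nsq (j x) + nsq (j y))) ->
  exists L : 'L(W), forall x y, rdot (T x) y = rdot (L (j x)) (j y).
Proof.
move=> C0 Tj.
have T2 x y : rdot (T x) y ^+ 2 <= 4 * (C * nsq (j x)) * (C * nsq (j y)).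
  apply: discr_le; rewrite ?mulr_ge0 ?nsq_ge0// => t.
  by have := Tj (t%:C%C *: x) y; rewrite !linearZ/= rdotZlR nsqZR; lra.
have [cj cj0 jc] := bop_bounded j.
have [|Y [YE Y0]] := @douglas _ _ _ T j (4 * C ^+ 2 * cj).
  move=> x; have [->|Tx] := eqVneq (T x) 0.
    by rewrite nsq0 !mulr_ge0 ?nsq_ge0 ?exprn_ge0 ?(ltW cj0).
  have nT : 0 < nsq (T x).
    by rewrite lt_def nsq_ge0 andbT; apply: contra_neq Tx; exact: nsq_eq0.
  rewrite -(ler_pM2r nT) -expr2; apply: le_trans (T2 _ _) _.
  have := jc (T x); have h := nsq_ge0 (j x).
  have : 0 <= 4 * C ^+ 2 * nsq (j x) by rewrite !mulr_ge0 ?exprn_ge0.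
  by nra.
(* [k = adj Y y] lies in the closure of [ran j] because [Y] kills its complement. So [k] is tested
   against some [j x] near it, and [<k, j x> = <y, T x>] is controlled by [T2]. *)
have Yk y : nsq (adj Y y) <= 4 * C ^+ 2 * nsq (j y).
  set k := adj Y y; have kE : incl _ (oproj (clrange j) k) = k.
    apply/esym/eqP; rewrite -subr_eq0; apply/eqP/nsq_eq0.
    rewrite {1}/nsq rdotDr rdotNr oproj_orth subr0 rdotC /k adjPr.
    rewrite rdotC Y0 ?rdot0l// => x.
    by have [t <-] := clrange_lift j x; rewrite oproj_orth.
  apply/ler_addgt0Pr => d d0.
  have [x] := clrange_approx (oproj (clrange j) k) d0; rewrite kE nsqB.
  rewrite /k adjPr YE (rdotC y) => h1; have := T2 x y.
  have := nsq_ge0 (j x); have := nsq_ge0 (j y).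
  set a := nsq (j x); set b := nsq (j y); set p := rdot _ _ => b0 a0 p2.
  suff : 2 * p <= a + 4 * C ^+ 2 * b by lra.
  have D0 : 0 <= 4 * C ^+ 2 * b by rewrite !mulr_ge0 ?exprn_ge0.
  have [//|h] := lerP (2 * p) (a + 4 * C ^+ 2 * b).
  have := ltr_pM (addr_ge0 a0 D0) (addr_ge0 a0 D0) h h.
  by have := sqr_ge0 (a - 4 * C ^+ 2 * b); nra.
have [L [LE _]] := douglas Yk.
by exists (adj L) => x y; rewrite adjPr LE -adjPr adjK YE.
Qed.

(** Used to extend quadratic inequalities from a dense set. The error in the form is expanded around
    the fixed vector [y], so that no bound on [y'] is called for. *)
Lemma nonneg_closed V (M : 'L(V)) (y : V) :
  (forall e : R, 0 < e -> exists2 y', nsq (y - y') <= e & 0 <= rdot (M y') y') ->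
  0 <= rdot (M y) y.
Proof.
move=> h; apply/ler_addgt0Pr => d d0.
have d2 : 0 < d / 2 by rewrite divr_gt0.
have [c c0 Mc] := bop_bounded M.
have [e e0 he] := rdot_small (M y + adj M y) d2.
have [|y' yy' My'] := h (Num.min e (d / (c + 1))).
  by rewrite lt_min e0 divr_gt0// addr_gt0.
move: yy'; rewrite le_min => /andP[/he h1].
rewrite ler_pdivlMr ?addr_gt0// => h2.
pose z := y - y'; have h3 := rdot_amgm (M z) z; have h4 := Mc z.
move: h1; rewrite ler_norml => /andP[h1 _].
have E : rdot (M y) y = rdot (M y') y' + rdot z (M y + adj M y) - rdot (M z) z.
  rewrite /z linearB !(rdotDl, rdotDr, rdotNl, rdotNr) -!adjP.
  by rewrite (rdotC y (M y)) (rdotC y' (M y)); ring.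
by move: h1 h2; rewrite -/z => h1 h2; lra.
Qed.
End Inverses.

(** * Positive operators and square roots *)

Section StrongLimits.
Context {R : realType}.
Implicit Types U V W : hilbertType R.

Definition cvgs V (u : nat -> V) (l : V) := forall e : R, 0 < e ->
  exists N, forall n, (N <= n)%N -> nsq (u n - l) <= e.

Lemma cvgs_cst V (l : V) : cvgs (fun=> l) l.
Proof. by move=> e e0; exists 0%N => n _; rewrite subrr nsq0 ltW. Qed.

Lemma cvgsD V (u v : nat -> V) l m : cvgs u l -> cvgs v m -> cvgs (fun n => u n + v n) (l + m).
Proof.
move=> ul vm e e0; have e4 : 0 < e / 4 by rewrite divr_gt0.
have [N hN] := ul _ e4; have [N' hN'] := vm _ e4.
exists (N + N')%N => n Nn; have := nsqD_le (u n - l) (v n - m).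
have := hN n (leq_trans (leq_addr _ _) Nn); have := hN' n (leq_trans (leq_addl _ _) Nn).
by rewrite opprD addrACA; lra.
Qed.

Lemma cvgs_bop V W (T : 'L(V, W)) u l : cvgs u l -> cvgs (fun n => T (u n)) (T l).
Proof.
move=> ul e e0; have [d d0 hd] := nsq_small T e0.
by have [N hN] := ul d d0; exists N => n /hN/hd; rewrite linearB.
Qed.

Lemma cvgs_uniq V (u : nat -> V) l m : cvgs u l -> cvgs u m -> l = m.
Proof.
move=> ul um; apply/eqP; rewrite -subr_eq0; apply/eqP/small_nsq => e e0.
have e4 : 0 < e / 4 by rewrite divr_gt0.
have [N hN] := ul _ e4; have [N' hN'] := um _ e4.
have := hN _ (leq_addr N' N); have := hN' _ (leq_addl N N').
by have := nsqB_le l (u (N + N')%N) m; rewrite (nsqBC l (u _)); lra.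
Qed.

Lemma cvgs_ext V (u v : nat -> V) l : (forall n, u n = v n) -> cvgs u l -> cvgs v l.
Proof. by move=> /funext ->. Qed.

Lemma cvgs_rdot_le V W (u : nat -> V) (v : nat -> W) l m y z :
  cvgs u l -> cvgs v m -> (forall n, rdot (u n) y <= rdot (v n) z) ->
  rdot l y <= rdot m z.
Proof.
move=> ul vm h; apply/ler_addgt0Pr => d d0; have d2 : 0 < d / 2 by rewrite divr_gt0.
have [e e0 he] := rdot_small y d2; have [e' e'0 he'] := rdot_small z d2.
have [N hN] := ul _ e0; have [N' hN'] := vm _ e'0.
have := he _ (hN _ (leq_addr N' N)); have := he' _ (hN' _ (leq_addl N N')).
rewrite !ler_norml !rdotDl !rdotNl => /andP[_ h1] /andP[h2 _].
by have := h (N + N')%N; lra.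
Qed.

Lemma cvgs_nsq_le V (u : nat -> V) l (c : R) :
  cvgs u l -> (forall n, nsq (u n) <= c) -> nsq l <= c.
Proof.
move=> ul h; apply/ler_addgt0Pr => d d0; have d2 : 0 < d / 2 by rewrite divr_gt0.
have [e e0 he] := rdot_small l d2; have [N hN] := ul _ e0.
have := he _ (hN N (leqnn _)); rewrite ler_norml rdotDl rdotNl => /andP[h1 _].
rewrite -/(nsq l) in h1; have := nsq_ge0 (u N - l); rewrite nsqB.
by have := h N; lra.
Qed.

Lemma strong_limit U V (T : nat -> 'L(U, V)) (c : R) :
  (forall n x, nsq (T n x) <= c * nsq x) ->
  (forall x (e : R), 0 < e -> exists N, forall n, (N <= n)%N ->
     nsq (T n x - T N x) <= e) ->
  exists L : 'L(U, V), (forall x, cvgs (fun n => T n x) (L x)) /\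
    forall x, nsq (L x) <= c * nsq x.
Proof.
move=> Tc TC.
have [f fP] : {f : U -> V & forall x, cvgs (fun n => T n x) (f x)}.
  apply: (@choice _ _ (fun x l => cvgs (fun n => T n x) l)) => x.
  exact: hilbert_complete (TC x).
have fc x : nsq (f x) <= c * nsq x by apply: cvgs_nsq_le (fP x) _ => n.
have lf : linear f.
  move=> a x y; apply: (cvgs_uniq (fP _)).
  apply: (@cvgs_ext _ (fun n => a *: T n x + T n y)) => [n|]; first by rewrite linearP.
  apply: cvgsD (fP y); exact: (cvgs_bop (a *: bid) (fP x)).
have [L LE] := bop_of_bounded lf fc.
by exists L; split=> x; rewrite LE.
Qed.
End StrongLimits.

Section Positive.
Context {R : realType}.
Implicit Types U V W : hilbertType R.

(** Complex polarization: the form is real-valued exactly for selfadjoint operators. The vectors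
    [x + y] give the symmetry [h'], and then [y] is replaced by [- i y]. *)
Lemma sa_rdot_i V (T : 'L(V)) :
  selfadjoint T <-> forall x, rdot (T x) ('i%C *: x) = 0.
Proof.
rewrite selfadjointE; split=> h.
  by move=> x; have := h x ('i%C *: x); rewrite linearZ/= -[rdot x _]opprK -rdoti
    (rdotC _ (T x)); lra.
have h' x y : rdot (T x) ('i%C *: y) = - rdot (T y) ('i%C *: x).
  have := h (x + y); rewrite scalerDr linearD rdotDl !rdotDr !h; lra.
move=> x y; have := h' x (- 'i%C *: y).
rewrite scalerA mulrN -expr2 sqr_i opprK scale1r => ->.
by rewrite linearZ/= scaleNr rdotNl rdotii opprK rdotC.
Qed.

Lemma bposE V (T : 'L(V)) :
  bpos T <-> selfadjoint T /\ forall x, 0 <= rdot (T x) x.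
Proof.
rewrite sa_rdot_i; split=> [h|[h1 h2] x]; last by rewrite innerE lecE/= h1 eqxx h2.
by split=> x; have := h x; rewrite innerE lecE/= => /andP[/eqP].
Qed.

Lemma bpos_ext V (T : 'L(V)) : bpos T -> bpos (- T) -> T = 0.
Proof.
move=> /bposE[Ts Tp] /bposE[_ Tn]; apply: bopP => x; apply: nsq_eq0; apply/eqP.
have T0 y : rdot (T y) y = 0.
  by have := Tn y; rewrite bopNE rdotNl; have := Tp y; lra.
move/selfadjointE: Ts => Ts.
have := T0 (x + T x); rewrite linearD !(rdotDl, rdotDr) !T0 (Ts (T x) x) -/(nsq (T x)).
by move=> h; apply/eqP; lra.
Qed.

Lemma ble_anti V (S T : 'L(V)) : ble S T -> ble T S -> S = T.
Proof.
move=> h1 h2; apply/eqP; rewrite eq_sym -subr_eq0; apply/eqP/bpos_ext => //.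
by rewrite opprB.
Qed.

(** Cauchy-Schwarz for the semi-inner product [<T x, y>] at [y = T x], read off from positivity at
    [t x - T x]. *)
Lemma bpos_nsq_le V (T : 'L(V)) (m : R) : bpos T ->
  (forall y, rdot (T y) y <= m * nsq y) -> forall x, nsq (T x) <= m * rdot (T x) x.
Proof.
move=> /bposE[/selfadjointE Ts Tp] Tm x.
have [->|Tx] := eqVneq (T x) 0.
  by rewrite nsq0 rdot0l mulr0.
have nT : 0 < nsq (T x).
  by rewrite lt_def nsq_ge0 andbT; apply: contra_neq Tx; exact: nsq_eq0.
have := @discr_le _ (rdot (T x) x) (rdot (T (T x)) (T x)) (2 * nsq (T x)).
move=> /(_ (Tp _) (Tp _)) h.
have {h} : (2 * nsq (T x)) ^+ 2 <= 4 * rdot (T x) x * rdot (T (T x)) (T x).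
  apply: h => t; have := Tp (t%:C%C *: x - T x).
  rewrite linearB linearZ/= !(rdotDl, rdotDr, rdotNl, rdotNr) !rdotZlR !rdotZrR.
  by rewrite (Ts (T x) x) -/(nsq (T x)); lra.
have := Tm (T x); have := Tp x; move: nT; set a := nsq _; set b := rdot (T x) x.
move=> a0 b0 h1 h2; rewrite -(ler_pM2l a0).
have : b * rdot (T (T x)) (T x) <= b * (m * a) by rewrite ler_wpM2l.
by nra.
Qed.
End Positive.

(** * Square roots of positive operators by iteration *)

Section SquareRoot.
Context {R : realType} {V : hilbertType R}.
Implicit Types (T Z Q : 'L(V)).

(* Newton-type iteration for [Y = (Z + Y^2) / 2], whose solution gives
   [(I - Y)^2 = I - Z]; the scalar iteration for [Z = 1] bounds the increments. *)
Fixpoint sqrt_iter Z n : 'L(V) :=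
  if n is m.+1 then 2^-1 *: (Z + sqrt_iter Z m ∘ sqrt_iter Z m) else 0.

Fixpoint scal_iter n : R :=
  if n is m.+1 then (1 + scal_iter m ^+ 2) / 2 else 0.

Lemma sqrt_iter0 Z : sqrt_iter Z 0 = 0.
Proof. by []. Qed.
Lemma sqrt_iterS Z n :
  sqrt_iter Z n.+1 = 2^-1 *: (Z + sqrt_iter Z n ∘ sqrt_iter Z n).
Proof. by []. Qed.
Lemma scal_iterS n : scal_iter n.+1 = (1 + scal_iter n ^+ 2) / 2.
Proof. by []. Qed.

(** The scalars increase to the fixed point 1. This explicit rate, proved inductively in the sharper
    form [2 / (n + 2)], makes the operator iteration Cauchy. *)
Lemma scal_iter_bound n : 0 <= scal_iter n /\ 1 - 2 / n.+1%:R <= scal_iter n <= 1.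
Proof.
have [] : 0 <= scal_iter n /\ 1 - 2 / (n%:R + 2) <= scal_iter n <= 1; last first.
  move=> h0 /andP[h1 h2]; split=> //; rewrite h2 andbT; apply: le_trans h1.
  rewrite lerB// ler_pM2l// lef_pV2 ?posrE// ?ltr_wpDl//.
  by rewrite -[n.+1%:R]natr1 lerD2l; lra.
elim: n => [|n [y0 /andP[y1 y2]]]; first by rewrite /= add0r divff// subrr !lexx ler01.
have n0 : 0 <= n%:R :> R by [].
rewrite scal_iterS -[n.+1%:R]natr1; move: n0 y0 y1 y2.
move: (n%:R : R) (scal_iter n) => N y N0 y0 y1 y2.
have yd : (1 - y) * (N + 2) <= 2.
  by rewrite -ler_pdivlMr ?ltr_wpDl//; lra.
have y21 : y ^+ 2 <= 1 by exact: exprn_ile1.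
have y20 := sqr_ge0 y.
split; first lra.
apply/andP; split; last lra.
have -> : 1 - 2 / (N + 1 + 2) = (N + 1) / (N + 1 + 2).
  by field; rewrite gt_eqF//; lra.
rewrite ler_pdivrMr; last lra.
by nra.
Qed.

Lemma scal_iter_nd n : scal_iter n <= scal_iter n.+1.
Proof. by rewrite scal_iterS; have := sqr_ge0 (1 - scal_iter n); lra. Qed.

Lemma nsqD_bound (x y : V) (r s N : R) : 0 <= r -> 0 <= s -> 0 <= N ->
  nsq x <= r ^+ 2 * N -> nsq y <= s ^+ 2 * N -> nsq (x + y) <= (r + s) ^+ 2 * N.
Proof.
move=> r0 s0 N0 xr ys.
suff : rdot x y <= r * s * N by rewrite nsqD; lra.
have [//|h] := lerP (rdot x y) (r * s * N).
have p0 : 0 <= r * s * N by rewrite !mulr_ge0.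
have := ltr_pM p0 p0 h h; have := rdot_CS x y.
have := ler_pM (nsq_ge0 _) (nsq_ge0 _) xr ys; lra.
Qed.

Lemma sqrt_iter_comm Z (C : 'L(V)) n : (forall x, C (Z x) = Z (C x)) ->
  forall x, C (sqrt_iter Z n x) = sqrt_iter Z n (C x).
Proof.
move=> CZ; elim: n => [|n IHn] x; first by rewrite sqrt_iter0 !bop0E linear0.
by rewrite sqrt_iterS !bopE !linearZ/= !linearD/= CZ !IHn.
Qed.

Lemma sqrt_iter_bound Z n : contractive Z ->
  forall x, nsq (sqrt_iter Z n x) <= scal_iter n ^+ 2 * nsq x.
Proof.
move=> /contractiveE Zc; elim: n => [|n IHn] x.
  by rewrite sqrt_iter0 bop0E nsq0 mulr_ge0 ?nsq_ge0 ?exprn_ge0.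
have [y0 _] := scal_iter_bound n.
have c2 : (2^-1 : R[i]) = (2^-1)%:C%C by rewrite fmorphV rmorph_nat.
rewrite sqrt_iterS scal_iterS !bopE c2 nsqZR exprMn [leRHS]mulrAC [leRHS]mulrC.
rewrite ler_wpM2l ?exprn_ge0 ?invr_ge0//.
apply: nsqD_bound; rewrite ?nsq_ge0 ?exprn_ge0//; first by rewrite expr1n mul1r.
apply: le_trans (IHn _) _.
by rewrite [leRHS](_ : _ = scal_iter n ^+ 2 * (scal_iter n ^+ 2 * nsq x));
  [rewrite ler_wpM2l ?exprn_ge0|ring].
Qed.

(** Successive iterates [A], [B] commute, so the next increment is [(A - B)(A + B) / 2]. The scalar
    iteration obeys the same identity and therefore majorises it. *)
Lemma sqrt_iter_step Z n : contractive Z -> forall x,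
  nsq (sqrt_iter Z n.+1 x - sqrt_iter Z n x)
    <= (scal_iter n.+1 - scal_iter n) ^+ 2 * nsq x.
Proof.
have c2 : (2^-1 : R[i]) = (2^-1)%:C%C by rewrite fmorphV rmorph_nat.
move=> Zc; elim: n => [|n IHn] x.
  rewrite sqrt_iterS scal_iterS sqrt_iter0 !bopE [scal_iter 0]/= !subr0 addr0 expr0n addr0
    c2 nsqZR mul1r.
  by rewrite ler_wpM2l ?exprn_ge0//; move/contractiveE: Zc.
have [y0 _] := scal_iter_bound n; have [y1 _] := scal_iter_bound n.+1.
have yy := scal_iter_nd n.
set A := sqrt_iter Z n.+1; set B := sqrt_iter Z n in IHn *.
have AB y : A (B y) = B (A y).
  apply: sqrt_iter_comm => z; apply/esym/sqrt_iter_comm => //.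
have A2 : sqrt_iter Z n.+2 x = 2^-1 *: (Z x + A (A x)) by [].
have A1 : A x = 2^-1 *: (Z x + B (B x)) by [].
have bA := sqrt_iter_bound n.+1 Zc x; have bB := sqrt_iter_bound n Zc x.
rewrite -/A in bA IHn; rewrite -/B in bB.
have -> : sqrt_iter Z n.+2 x - A x = (2^-1)%:C%C *: (A (A x + B x) - B (A x + B x)).
  rewrite A2 {}[X in _ - X]A1 -c2 -scalerBr; congr (_ *: _).
  clearbody A B; rewrite [A (_ + _)]linearD [B (_ + _)]linearD/= AB.
  by rewrite !opprD [LHS]addrACA subrr add0r [RHS]addrA addrK.
rewrite nsqZR.
have h1 := IHn (A x + B x).
have h2 := nsqD_bound y1 y0 (nsq_ge0 x) bA bB.
have -> : scal_iter n.+2 - scal_iter n.+1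
    = 2^-1 * ((scal_iter n.+1 - scal_iter n) * (scal_iter n.+1 + scal_iter n)).
  by rewrite (scal_iterS n.+1) {2}(scal_iterS n); field.
rewrite exprMn -[leRHS]mulrA ler_wpM2l ?exprn_ge0 ?invr_ge0//; apply: le_trans h1 _.
by rewrite exprMn -[leRHS]mulrA ler_wpM2l ?exprn_ge0 ?subr_ge0.
Qed.

Lemma sqrt_iter_diff Z n k : contractive Z -> forall x,
  nsq (sqrt_iter Z (n + k) x - sqrt_iter Z n x)
    <= (scal_iter (n + k) - scal_iter n) ^+ 2 * nsq x.
Proof.
move=> Zc; elim: k => [|k IHk] x.
  by rewrite addn0 !subrr nsq0 expr0n mul0r.
have mono : scal_iter n <= scal_iter (n + k).
  elim: (k) => [|i IHi]; first by rewrite addn0.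
  by rewrite addnS; apply: le_trans IHi (scal_iter_nd _).
rewrite addnS -(subrKA (sqrt_iter Z (n + k) x)) -[leRHS](congr1 (fun r => r ^+ 2 * _)
  (subrKA (scal_iter (n + k)) _ _)).
apply: nsqD_bound; rewrite ?nsq_ge0 ?subr_ge0 ?scal_iter_nd//.
exact: sqrt_iter_step.
Qed.

Lemma contraction_sqrt Z : contractive Z -> selfadjoint Z ->
  exists Q, [/\ bpos Q, Q ∘ Q = bid - Z &
    forall C : 'L(V), (forall x, C (Z x) = Z (C x)) -> forall x, C (Q x) = Q (C x)].
Proof.
move=> Zc /selfadjointE Zs.
have Yc n x : nsq (sqrt_iter Z n x) <= 1 * nsq x.
  apply: le_trans (sqrt_iter_bound n Zc x) _; rewrite ler_wpM2r ?nsq_ge0//.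
  have [? /andP[_ ?]] := scal_iter_bound n; exact: exprn_ile1.
have [x e e0|Y [YY Yc']] := strong_limit Yc.
  have k0 : 0 < 4 * (nsq x + 1) by rewrite mulr_gt0// ltr_wpDl ?nsq_ge0.
  have [|N hN] := @invS_small _ (Num.min 1 (e / (4 * (nsq x + 1)))).
    by rewrite lt_min ltr01 divr_gt0.
  exists N => n /subnKC <-; apply: le_trans (sqrt_iter_diff _ _ Zc _) _.
  have := hN N (leqnn _); rewrite le_min ler_pdivlMr// => /andP[i1 h1].
  have [_ /andP[_ h2]] := scal_iter_bound (N + (n - N)).
  have [_ /andP[h3 _]] := scal_iter_bound N.
  have i0 : 0 <= N.+1%:R^-1 :> R by rewrite invr_ge0.
  have mono : scal_iter N <= scal_iter (N + (n - N)).
    elim: (n - N)%N => [|i IHi]; first by rewrite addn0.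
    by rewrite addnS; apply: le_trans IHi (scal_iter_nd _).
  move: h1 h2 h3 i0 i1 mono; set i := N.+1%:R^-1.
  set a := scal_iter N; set b := scal_iter (N + _).
  move=> h1 h2 h3 i0 i1 mono; have x0 := nsq_ge0 x.
  have : (b - a) ^+ 2 <= 4 * i.
    have : (b - a) ^+ 2 <= (2 * i) ^+ 2.
      by rewrite ler_pXn2r ?nnegrE ?subr_ge0 ?mulr_ge0//; lra.
    by nra.
  by move=> h4; have := ler_wpM2r x0 h4; nra.
have Ysa n x y : rdot (sqrt_iter Z n x) y = rdot x (sqrt_iter Z n y).
  have c2 : (2^-1 : R[i]) = (2^-1)%:C%C by rewrite fmorphV rmorph_nat.
  elim: n x y => [|n IHn] x y; first by rewrite sqrt_iter0 !bop0E rdot0l rdot0r.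
  by rewrite sqrt_iterS !bopE c2 rdotZlR rdotZrR !(rdotDl, rdotDr) Zs !IHn.
have Ys x y : rdot (Y x) y = rdot x (Y y).
  apply/le_anti/andP; split.
    rewrite [leRHS]rdotC; apply: cvgs_rdot_le (YY x) (YY y) _ => n.
    by rewrite Ysa rdotC.
  rewrite [leLHS]rdotC; apply: cvgs_rdot_le (YY y) (YY x) _ => n.
  by rewrite Ysa rdotC.
have YE x : Y x = 2^-1 *: (Z x + Y (Y x)).
  apply: (cvgs_uniq (u := fun n => sqrt_iter Z n.+1 x)).
    by move=> e /(YY x)[N hN]; exists N => n Nn; apply: hN; exact: leqW.
  apply: (cvgs_bop (2^-1 *: bid)).
  apply: cvgsD; first exact: cvgs_cst.
  (* The product converges because the iterates are uniformly bounded: [Y_n Y_n x = Y_n (Y_n x - Y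
     x) + Y_n (Y x)]. *)
  apply: (@cvgs_ext _ _ (fun n => sqrt_iter Z n (sqrt_iter Z n x - Y x)
     + sqrt_iter Z n (Y x))) => [n|].
    by rewrite -linearD subrK.
  rewrite -[Y (Y x)]add0r; apply: cvgsD (YY (Y x)) => e /(YY x)[N hN].
  exists N => n Nn; rewrite subr0; apply: le_trans (Yc _ _) _.
  by rewrite mul1r hN.
exists (bid - Y); split.
- apply/bposE; split.
    by apply/selfadjointE => x y; rewrite !bopE rdotDl rdotDr rdotNl rdotNr Ys.
  move=> x; rewrite !bopE rdotDl rdotNl -/(nsq x).
  by have := rdot_amgm (Y x) x; have := Yc' x; lra.
- apply: bopP => x; rewrite !bopE linearB/=.
  have YYx : Y x + Y x = Z x + Y (Y x).
    by rewrite -mulr2n -scaler_nat {1}(YE x) scalerA divff ?scale1r// pnatr_eq0.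
  by rewrite -[Z x](addrK (Y (Y x))) -YYx !opprB -addrA [- Y x + _]addrCA -opprD.
- move=> C CZ x; rewrite !bopE linearB/=; congr (_ - _).
  apply: (cvgs_uniq (cvgs_bop C (YY x))).
  apply: cvgs_ext (YY (C x)) => n; apply/esym.
  exact: sqrt_iter_comm.
Qed.
End SquareRoot.

Section SquareRootProperties.
Context {R : realType}.
Implicit Types U V W : hilbertType R.

Lemma bop_form_bound V (T : 'L(V)) :
  exists2 m : R, 0 < m & forall y, rdot (T y) y <= m * nsq y.
Proof.
have [c c0 Tc] := bop_bounded T; exists ((c + 1) / 2); first by rewrite divr_gt0// addr_gt0.
by move=> y; have := rdot_amgm (T y) y; have := Tc y; lra.
Qed.

Lemma bpos_ker V (T : 'L(V)) x : bpos T -> rdot (T x) x = 0 -> T x = 0.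
Proof.
move=> Tp Tx; have [m m0 Tm] := bop_form_bound T; apply: nsq_eq0; apply/le_anti.
by rewrite nsq_ge0 andbT; have := bpos_nsq_le Tp Tm x; rewrite Tx mulr0.
Qed.

Lemma bsqrt_ex V (T : 'L(V)) : bpos T -> exists Q : 'L(V), [/\ bpos Q, Q ∘ Q = T &
  forall C : 'L(V), (forall x, C (T x) = T (C x)) -> forall x, C (Q x) = Q (C x)].
Proof.
move=> Tp; have [m m0 Tm] := bop_form_bound T.
have TQ := bpos_nsq_le Tp Tm; have /bposE[/selfadjointE Ts Tp'] := Tp.
(* Normalisation: [|T x|^2 <= m <T x, x>] makes [I - T / m] a contraction. The root of [T / m] is
   then rescaled by [sqrt m]. *)
pose Z := bid - (m^-1)%:C%C *: T.
have Zc : contractive Z.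
  apply/contractiveE => x; rewrite !bopE nsqB nsqZR rdotZrR rdotC.
  have mi : 0 < m^-1 by rewrite invr_gt0.
  have : m^-1 ^+ 2 * nsq (T x) <= m^-1 * rdot (T x) x.
    by rewrite expr2 -mulrA ler_pM2l// ler_pdivrMl.
  have : 0 <= m^-1 * rdot (T x) x by rewrite mulr_ge0// ltW.
  lra.
have Zs : selfadjoint Z.
  apply/selfadjointE => x y; rewrite !bopE rdotDl rdotDr rdotNl rdotNr.
  by rewrite rdotZlR rdotZrR Ts.
have [Q [/bposE[/selfadjointE Qs Qp] QQ QC]] := contraction_sqrt Zc Zs.
exists ((Num.sqrt m)%:C%C *: Q); split.
- apply/bposE; split=> [|x]; last by rewrite bopE rdotZlR mulr_ge0 ?sqrtr_ge0.
  by apply/selfadjointE => x y; rewrite !bopE rdotZlR rdotZrR Qs.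
- apply: bopP => x; rewrite !bopE linearZ/= scalerA -rmorphM -expr2 sqr_sqrtr ?ltW//.
  rewrite -(bcompE Q) QQ !bopE opprB addrC subrK scalerA -rmorphM divff ?scale1r//.
  by rewrite gt_eqF.
- move=> C CT x; rewrite !bopE linearZ/= QC// => y.
  by rewrite !bopE linearB linearZ/= CT.
Qed.

(** With [y = (P - Q) x] commutation gives [(P + Q) y = 0]. Positivity forces [P y = Q y = 0], hence
    [|y|^2 = <x, (P - Q) y> = 0]. *)
Lemma bsqrt_uniq V (T P Q : 'L(V)) : bpos P -> P ∘ P = T -> bpos Q -> Q ∘ Q = T ->
  (forall x, P (Q x) = Q (P x)) -> P = Q.
Proof.
move=> Pp PP Qp QQ PQ; apply: bopP => x.
have [/bposE[/selfadjointE Ps Pp'] /bposE[/selfadjointE Qs Qp']] := (Pp, Qp).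
pose y := P x - Q x.
have PQy : P y + Q y = 0.
  rewrite /y !linearB/= PQ -(bcompE P) -(bcompE Q Q) PP QQ addrC addrA subrK.
  by rewrite subrr.
have PQy0 : rdot (P y) y + rdot (Q y) y = 0 by rewrite -rdotDl PQy rdot0l.
have Py : P y = 0 by apply: bpos_ker => //; have := Pp' y; have := Qp' y; lra.
have Qy : Q y = 0 by apply: bpos_ker => //; have := Pp' y; have := Qp' y; lra.
apply/eqP; rewrite -subr_eq0; apply/eqP/nsq_eq0.
by rewrite -/y {1}/nsq {1}/y rdotDl rdotNl Ps Qs Py Qy rdot0r subrr.
Qed.

Lemma bsqrtP V (T : 'L(V)) : bpos T -> [/\ bpos (bsqrt T), bsqrt T ∘ bsqrt T = T &
  forall C : 'L(V), (forall x, C (T x) = T (C x)) -> forall x, C (bsqrt T x) = bsqrt T (C x)].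
Proof.
move=> Tp; have [Q [Qp QQ QC]] := bsqrt_ex Tp.
rewrite /bsqrt; case: xgetP => [P _ [Pp PP]|/(_ Q)]; last by case.
suff -> : P = Q by [].
apply: (bsqrt_uniq Pp PP Qp QQ); apply: QC => x.
by rewrite -PP.
Qed.

Lemma bsqrtE V (Q : 'L(V)) : bpos Q -> bsqrt (Q ∘ Q) = Q.
Proof.
move=> Qp; have Tp : bpos (Q ∘ Q).
  have /bposE[/selfadjointE Qs _] := Qp; apply/bposE; split=> [|x].
    by apply/selfadjointE => x y; rewrite !bopE !Qs.
  by rewrite bopE Qs; exact: nsq_ge0.
have [Pp PP PC] := bsqrtP Tp; apply/esym.
apply: (bsqrt_uniq Qp _ Pp PP) => //.
exact: (PC Q).
Qed.
End SquareRootProperties.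

Section Linearity.
Context {R : realType} {U V : hilbertType R} (T : 'L(U, V)).

Lemma bop_r0 : T 0 = 0. Proof. exact: linear0. Qed.
Lemma bop_rD x y : T (x + y) = T x + T y. Proof. exact: linearD. Qed.
Lemma bop_rN x : T (- x) = - T x. Proof. exact: linearN. Qed.
Lemma bop_rB x y : T (x - y) = T x - T y. Proof. exact: linearB. Qed.
Lemma bop_rZ a x : T (a *: x) = a *: T x. Proof. exact: linearZ. Qed.
End Linearity.

(** * Defect operators *)

Section Defect.
Context {R : realType} {U V : hilbertType R} (T : 'L(U, V)).
Hypothesis Tc : contractive T.

Lemma defect_bpos : bpos (bid - adj T ∘ T).
Proof.
apply/bposE; split=> [|x].
  apply/selfadjointE => x y; rewrite !bopE rdotDl rdotDr rdotNl rdotNr.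
  by rewrite adjPr -adjP.
rewrite !bopE rdotDl rdotNl adjPr -!/(nsq _) subr_ge0.
by move/contractiveE: Tc.
Qed.

Lemma defect_sa x y : rdot (defect T x) y = rdot x (defect T y).
Proof.
have [/bposE[/selfadjointE h _] _ _] := bsqrtP defect_bpos; exact: h.
Qed.

Lemma defectK x : defect T (defect T x) = x - adj T (T x).
Proof. by have [_ h _] := bsqrtP defect_bpos; rewrite -bcompE h. Qed.

Lemma nsq_defect x : nsq (defect T x) = nsq x - nsq (T x).
Proof. by rewrite {1}/nsq defect_sa defectK rdotDr rdotNr -adjP. Qed.

Lemma defect_comm (C : 'L(U)) : (forall x, C (adj T (T x)) = adj T (T (C x))) ->
  forall x, C (defect T x) = defect T (C x).
Proof.
move=> h; have [_ _] := bsqrtP defect_bpos; apply=> x.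
by rewrite !bopE linearB/= h.
Qed.

Lemma incl_cdefect x : incl _ (cdefect T x) = defect T x.
Proof.
have [t tE] := clrange_lift (defect T) x.
by rewrite /cdefect bcompE -tE oproj_incl.
Qed.

Lemma nsq_cdefect x : nsq (cdefect T x) = nsq x - nsq (T x).
Proof. by rewrite -nsq_incl incl_cdefect nsq_defect. Qed.

Lemma defspace_approx (y : defspace T) (e : R) : 0 < e ->
  exists x, nsq (y - cdefect T x) <= e.
Proof.
move=> /(clrange_approx y)[x yx]; exists x.
by rewrite -nsq_incl bop_rB incl_cdefect.
Qed.
End Defect.

(** * Sectorial contractions and transfer functions *)

Section Sectorial.
Context {R : realType}.
Implicit Types (U V E : hilbertType R) (s c : R) (z : R[i]).

Definition rotop V s c (A : 'L(V)) : 'L(V) := s%:C%C *: A + ('i%C * c%:C%C) *: bid.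

(* For [s = sin alpha] and [c = cos alpha] with [alpha] in [[0, pi/2)] this is membership in
   the class [C(alpha)], including the case [alpha = 0]. *)
Definition sect V s c (A : 'L(V)) := contractive A /\
  forall x, 2 * c * `|rdot (A x) ('i%C *: x)| <= s * (nsq x - nsq (A x)).

Lemma nsq_rot V s c (A : 'L(V)) x : nsq (rotop s c A x)
  = s ^+ 2 * nsq (A x) + 2 * (s * c * rdot (A x) ('i%C *: x)) + c ^+ 2 * nsq x.
Proof.
rewrite !bopE mulrC -scalerA nsqD !nsqZR nsqi rdotZlR rdotZrR; ring.
Qed.

Lemma rot_contractive V s c (A : 'L(V)) : s ^+ 2 + c ^+ 2 = 1 ->
  contractive (rotop s c A) <->
  forall x, 2 * (s * c * rdot (A x) ('i%C *: x)) <= s ^+ 2 * (nsq x - nsq (A x)).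
Proof.
move=> sc; have E (x : V) : nsq x = s ^+ 2 * nsq x + c ^+ 2 * nsq x by rewrite -mulrDl sc mul1r.
by rewrite contractiveE; split=> h x; have := h x; rewrite nsq_rot; have := E x; lra.
Qed.

Lemma rot_adj V s c (A : 'L(V)) : adj (rotop s c A) = rotop s (- c) (adj A).
Proof.
apply: adj_uniq => x y; rewrite !bopE !(mulrC 'i%C) -!scalerA.
by rewrite rdotDl rdotDr !rdotZlR !rdotZrR adjP rdoti; ring.
Qed.

Lemma sect_rot V s c (A : 'L(V)) : s ^+ 2 + c ^+ 2 = 1 -> 0 <= s -> 0 <= c -> sect s c A ->
  contractive (rotop s c A) /\ contractive (rotop s (- c) A).
Proof.
move=> sc s0 c0 [_ h]; split; apply/rot_contractive; rewrite ?sqrrN// => x.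
  have := h x; have := ler_norm (rdot (A x) ('i%C *: x)).
  move=> h1 h2; have h3 : c * rdot (A x) ('i%C *: x) <= c * `|rdot (A x) ('i%C *: x)|.
    by rewrite ler_wpM2l.
  have h4 : 2 * c * rdot (A x) ('i%C *: x) <= s * (nsq x - nsq (A x)) by lra.
  by have := ler_wpM2l s0 h4; lra.
have := h x; have := ler_norm (- rdot (A x) ('i%C *: x)); rewrite normrN.
move=> h1 h2; have h3 : c * - rdot (A x) ('i%C *: x) <= c * `|rdot (A x) ('i%C *: x)|.
  by rewrite ler_wpM2l.
have h4 : 2 * c * - rdot (A x) ('i%C *: x) <= s * (nsq x - nsq (A x)) by lra.
by have := ler_wpM2l s0 h4; lra.
Qed.

(** Adding the two conditions gives contractivity; each one, divided by [s], bounds the imaginary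
    part from one side. *)
Lemma rot_sect V s c (A : 'L(V)) : s ^+ 2 + c ^+ 2 = 1 -> 0 < s ->
  contractive (rotop s c A) -> contractive (rotop s (- c) A) -> sect s c A.
Proof.
move=> sc s0 /(rot_contractive _ sc) h1 h2.
have {}h2 := (rot_contractive A (etrans (congr1 (+%R _) (sqrrN c)) sc)).1 h2.
split.
  apply/contractiveE => x; rewrite -subr_ge0 -(pmulr_rge0 _ (exprn_gt0 2 s0)).
  by have := h1 x; have := h2 x; lra.
move=> x; rewrite -(ler_pM2l s0).
have [r0|r0] := leP 0 (rdot (A x) ('i%C *: x)).
  by rewrite ger0_norm//; have := h1 x; lra.
by rewrite ltr0_norm//; have := h2 x; lra.
Qed.

Lemma contr_plusE V (a : R) (A : 'L(V)) :
  sinC a *: A + icos a *: bid = rotop (sin a) (cos a) A.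
Proof. by []. Qed.
Lemma contr_minusE V (a : R) (A : 'L(V)) :
  sinC a *: A - icos a *: bid = rotop (sin a) (- cos a) A.
Proof. by rewrite /rotop rmorphN mulrN scaleNr. Qed.

Lemma sincos (a : R) : 0 <= a -> a < pi / 2 ->
  [/\ sin a ^+ 2 + cos a ^+ 2 = 1, 0 <= sin a & 0 < cos a].
Proof.
move=> a0 a1; split; first by rewrite addrC cos2Dsin2.
  by rewrite sin_ge0_pi// a0; have := @pi_ge0 R; lra.
by rewrite cos_gt0_pihalf// a1 andbT; have := @pi_ge0 R; move: a1; lra.
Qed.

Lemma sect0 V (A : 'L(V)) : sect 0 1 A <-> selfadjoint A /\ contractive A.
Proof.
rewrite sa_rdot_i; split=> [[Ac h]|[h Ac]]; split=> // x; last first.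
  by rewrite h normr0 mulr0 mul0r.
have := h x; rewrite mul0r pmulr_rle0 ?mulr_gt0//.
by rewrite normr_le0 => /eqP.
Qed.

Lemma C_classP V (a : R) (A : 'L(V)) : 0 <= a -> a < pi / 2 ->
  C_class a A <-> sect (sin a) (cos a) A.
Proof.
move=> a0 a1; rewrite /C_class; have [->|an0] := eqVneq a 0.
  by rewrite sin0 cos0 sect0.
have [sc s0 c0] := sincos a0 a1.
have s1 : 0 < sin a by rewrite sin_gt0_pihalf// a1 andbT lt_def an0.
rewrite contr_plusE contr_minusE; split=> [[h1 h2]|]; first exact: rot_sect.
by apply: sect_rot => //; exact: ltW.
Qed.

Lemma sect_mono V (a b : R) (A : 'L(V)) : 0 <= a -> a <= b -> b < pi / 2 ->
  sect (sin a) (cos a) A -> sect (sin b) (cos b) A.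
Proof.
move=> a0 ab b1 [Ac h]; split=> // x.
have b0 := le_trans a0 ab; have a1 := le_lt_trans ab b1.
have [scb sb cb] := sincos b0 b1; have [sca sa ca] := sincos a0 a1.
have pi0 := @pi_ge0 R.
have cc : cos b <= cos a.
  by rewrite leNgt ltr_cos ?in_itv/= -?leNgt// ?a0 ?b0/=; move: a1 b1; lra.
have ss : sin a <= sin b.
  by rewrite -(@ler_pXn2r _ 2)// ?nnegrE//; have := ler_pM (ltW cb) (ltW cb) cc cc; lra.
have g0 : 0 <= nsq x - nsq (A x) by rewrite subr_ge0; move/contractiveE: Ac.
have := h x; have := ler_wpM2r g0 ss.
by have := ler_wpM2r (normr_ge0 (rdot (A x) ('i%C *: x))) cc; lra.
Qed.

Lemma sectN V s c (A : 'L(V)) : sect s c A -> sect s c (- A).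
Proof.
move=> [/contractiveE Ac h]; split; last by move=> x; rewrite bopE rdotNl normrN nsqN.
by apply/contractiveE => x; rewrite bopE nsqN.
Qed.

(* [s (I - z A) w = (s + i c z) w - z (s A + i c) w], where
   [|s + i c z|^2 - |z|^2 = 1 - |s z + i c|^2 > 0] *)
Lemma rot_bound_below V s c z (A : 'L(V)) : 0 < s -> s ^+ 2 + c ^+ 2 = 1 ->
  contractive (rotop s c A) -> csq (z * s%:C%C + 'i%C * c%:C%C) < 1 ->
  exists2 k : R, 0 < k & forall w, k * nsq w <= nsq ((bid - z *: A) w).
Proof.
move=> s0 sc /contractiveE Ac zsc.
pose al := csq (s%:C%C + 'i%C * c%:C%C * z); pose be := csq z.
have ab : be < al.
  move: zsc; rewrite /al /be /csq; case: (z) => a b /=.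
  by rewrite !(mul0r, mulr0, mul1r, mulr1, subr0, sub0r, addr0, add0r); nra.
have b0 : 0 <= be := csq_ge0 z.
(* Weight in Young's inequality: it spends at most half of the gap [al - be], and the added 1 covers
   [be = 0]. *)
pose t := (al - be) / (2 * (be + 1)).
have b1 : 0 < 2 * (be + 1) by lra.
have ab0 : 0 < al - be by rewrite subr_gt0.
have t0 : 0 < t by rewrite divr_gt0.
have tE : t * be <= (al - be) / 2.
  by rewrite /t mulrAC ler_pdivrMr//; lra.
pose k := (al - be) / 2 / ((1 + t^-1) * s ^+ 2).
have ti : 0 < t^-1 by rewrite invr_gt0.
have k0 : 0 < (1 + t^-1) * s ^+ 2 by rewrite mulr_gt0 ?exprn_gt0 ?addr_gt0.
exists k => [|w]; first by rewrite !divr_gt0.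
rewrite /k mulrAC ler_pdivrMr//; set r := (bid - z *: A) w.
have E : (s%:C%C + 'i%C * c%:C%C * z) *: w = z *: rotop s c A w + s%:C%C *: r.
  rewrite /r !bopE scalerBr scalerDr !scalerA scalerDl [RHS]addrC.
  by rewrite [z * s%:C%C]mulrC [z * ('i%C * _)]mulrC addrA subrK.
have h1 : nsq (z *: rotop s c A w) <= be * nsq w by rewrite nsqZ ler_wpM2l.
have := congr1 nsq E; rewrite nsqZ -/al => h2.
have := rdot_young (s%:C%C *: r) (z *: rotop s c A w) ti.
have h3 : nsq (s%:C%C *: r) = s ^+ 2 * nsq r by rewrite nsqZR.
rewrite nsqD h3 in h2; rewrite rdotC h3 => h4.
have h5 : 2 * rdot (z *: rotop s c A w) (s%:C%C *: r)
   <= t^-1 * (s ^+ 2 * nsq r) + t * nsq (z *: rotop s c A w).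
  rewrite -(ler_pM2l ti).
  apply: le_trans (_ : _ <= t^-1 ^+ 2 * (s ^+ 2 * nsq r)
    + nsq (z *: rotop s c A w)) _; first lra.
  by rewrite mulrDr (mulrA t^-1 t) mulVf ?gt_eqF// mul1r expr2 -mulrA lexx.
have h6 : t * nsq (z *: rotop s c A w) <= t * be * nsq w.
  by rewrite -mulrA ler_pM2l.
have := ler_wpM2r (nsq_ge0 w) tE; lra.
Qed.

(** The adjoint [I - conj z A^*] satisfies the same hypotheses with [c] replaced by [- c], so it is
    bounded below as well and has no kernel. *)
Lemma rot_invertible V s c z (A : 'L(V)) : 0 < s -> s ^+ 2 + c ^+ 2 = 1 ->
  contractive (rotop s c A) -> csq (z * s%:C%C + 'i%C * c%:C%C) < 1 ->
  invertible (bid - z *: A).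
Proof.
move=> s0 sc Ac zsc; have [k k0 hk] := rot_bound_below s0 sc Ac zsc.
apply: (bounded_below_invertible k0 hk) => y Ty.
have sc' : s ^+ 2 + (- c) ^+ 2 = 1 by rewrite sqrrN.
have Ac' : contractive (rotop s (- c) (adj A)) by rewrite -rot_adj; exact: adj_contractive.
have [|k' k'0 hk'] := @rot_bound_below _ s (- c) z^* (adj A) s0 sc' Ac'.
  move: zsc; rewrite /csq; case: (z) => a b /=.
  by rewrite !(mul0r, mulr0, mul1r, mulr1, subr0, sub0r, addr0, add0r, mulNr); lra.
have := hk' y; have -> : bid - z^* *: adj A = adj (bid - z *: A).
  apply/esym/adj_uniq => x x'; rewrite !bopE rdotDl rdotDr rdotNl rdotNr rdotZrJ conjCK.
  by rewrite -adjP bop_rZ.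
rewrite Ty nsq0 pmulr_rle0// => h; apply: nsq_eq0; apply/le_anti.
by rewrite h nsq_ge0.
Qed.

Lemma norm_lt1 z : (`|z| < 1) = (csq z < 1).
Proof. by rewrite -(@expr_lt1 _ 2)// csqE -[1 in LHS]/(1%:C%C : R[i]) ltcR. Qed.

Lemma disc_invertible V z (A : 'L(V)) : contractive A -> `|z| < 1 -> invertible (bid - z *: A).
Proof.
move=> Ac z1; apply: (@rot_invertible _ 1 0) => //; first by rewrite expr1n expr0n addr0.
  by rewrite /rotop mulr0 scale0r addr0 scale1r.
by rewrite mulr0 addr0 mulr1 -norm_lt1.
Qed.
End Sectorial.

(** * Linear-fractional realizations *)

Section Transfer.
Context {R : realType} {U E : hilbertType R}.
Implicit Types (A : 'L(dsum U E)) (F : 'L(U)) (z : R[i]) (s c : R).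

(* Linear-fractional relation characterising [F = A11 + z A12 (I - z A22)^-1 A21] *)
Definition realizes A z F :=
  forall x, exists h, A ((x, z *: h) : dsum U E) = ((F x, h) : dsum U E).

Definition transfer A z : 'L(U) :=
  entry11 A + z *: (entry12 A ∘ binv (bid - z *: entry22 A) ∘ entry21 A).

Lemma blockE A x y : A ((x, y) : dsum U E)
  = ((entry11 A x + entry12 A y, entry21 A x + entry22 A y) : dsum U E).
Proof.
have -> : ((x, y) : dsum U E) = dinl x + dinr y.
  by rewrite -[RHS]/((x + 0, 0 + y) : dsum U E) addr0 add0r.
by rewrite bop_rD.
Qed.

Lemma transfer_realizes A z :
  invertible (bid - z *: entry22 A) -> realizes A z (transfer A z).
Proof.
move=> Ai x; set h := binv (bid - z *: entry22 A) (entry21 A x).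
have hE : h = entry21 A x + z *: entry22 A h.
  have := binvKr (entry21 A x) Ai; rewrite -/h !bopE => /eqP.
  by rewrite subr_eq => /eqP.
exists h; rewrite blockE !bop_rZ -hE.
by rewrite /transfer !bopE -/h.
Qed.

Lemma realizes_contractive A z F :
  contractive A -> csq z <= 1 -> realizes A z F -> contractive F.
Proof.
move=> /contractiveE Ac z1 AF; apply/contractiveE => x; have [h hE] := AF x.
have := Ac ((x, z *: h) : dsum U E); rewrite hE !nsq_dsum/= nsqZ.
by have := nsq_ge0 h; nra.
Qed.

(** The second coordinates compare as [|z| <= |s + i c z|], which is equivalent to the disc
    condition on [z]. *)
Lemma realizes_rot A z F s c : s ^+ 2 + c ^+ 2 = 1 -> contractive (rotop s c A) ->
  csq (z * s%:C%C + 'i%C * c%:C%C) <= 1 -> realizes A z F -> contractive (rotop s c F).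
Proof.
move=> sc /contractiveE Ac zsc AF; apply/contractiveE => x; have [h hE] := AF x.
have := Ac ((x, z *: h) : dsum U E).
have -> : rotop s c A ((x, z *: h) : dsum U E)
    = ((rotop s c F x, (s%:C%C + 'i%C * c%:C%C * z) *: h) : dsum U E).
  by rewrite !bopE hE scalerDl -scalerA.
rewrite !nsq_dsum/= !nsqZ => h1; have h0 := nsq_ge0 h.
have : csq z <= csq (s%:C%C + 'i%C * c%:C%C * z).
  move: zsc; rewrite /csq; case: (z) => a b /=.
  by rewrite !(mul0r, mulr0, mul1r, mulr1, subr0, sub0r, addr0, add0r); nra.
by move=> h2; have := ler_wpM2r h0 h2; lra.
Qed.

(** For real [t] the pairing of [h] with [t h] has no imaginary part, so the forms of [A] and [F]
    have the same imaginary part. *)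
Lemma realizes_sect A (t : R) F s c : 0 <= s -> t ^+ 2 <= 1 -> sect s c A ->
  realizes A t%:C%C F -> sect s c F.
Proof.
move=> s0 t1 [Ac h] AF; split.
  by apply: realizes_contractive Ac _ AF; rewrite /csq/= expr0n addr0.
move=> x; have [y yE] := AF x.
have := h ((x, t%:C%C *: y) : dsum U E); rewrite yE rdot_dsum !nsq_dsum/= nsqZR.
have -> : rdot y ('i%C *: (t%:C%C *: y)) = 0.
  by rewrite scalerA mulrC -scalerA rdotZrR rdotxi mulr0.
rewrite addr0 => h1; apply: le_trans h1 _; rewrite ler_wpM2l//.
by have := nsq_ge0 y; nra.
Qed.

(** [z A - I] sends [(x, z h)] to [(z F x - x, 0)]. *)
Lemma realizes_resolvent A z F : invertible (z *: A - bid) -> invertible (z *: F - bid) ->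
  realizes A z F -> dfst ∘ binv (z *: A - bid) ∘ dinl = binv (z *: F - bid).
Proof.
move=> Ai Fi AF; apply: bopP => y; set x := binv (z *: F - bid) y.
have [h hE] := AF x.
have yE : z *: F x - x = y by rewrite -[RHS](binvKr y Fi) !bopE.
have E0 : dinl y = (z *: A - bid) ((x, z *: h) : dsum U E).
  rewrite !bopE hE -[RHS]/((z *: F x - x, z *: h - z *: h) : dsum U E).
  by rewrite yE subrr.
by rewrite !bcompE E0 binvK.
Qed.

Lemma transferN A z : transfer (- A) z = - transfer A (- z).
Proof.
have E22 : bid - z *: entry22 (- A) = bid - (- z) *: entry22 A.
  by apply: bopP => x; rewrite !bopE scalerN scaleNr.
have [E11 E12 E21] : [/\ entry11 (- A) = - entry11 A, entry12 (- A) = - entry12 A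
    & entry21 (- A) = - entry21 A] by split; apply: bopP.
apply: bopP => x; rewrite /transfer E22 E11 E12 E21 !bopE !bop_rN scaleNr.
by rewrite opprD !opprK scaleNr opprK.
Qed.

Lemma entry22_rot A s c : contractive (rotop s c A) -> contractive (rotop s c (entry22 A)).
Proof.
move=> /contractiveE Ac; apply/contractiveE => y.
have := Ac (dinr y); rewrite !nsq_dsum/= nsq0 add0r; apply: le_trans.
by rewrite lerDr nsq_ge0.
Qed.

Lemma entry22_contractive A : contractive A -> contractive (entry22 A).
Proof.
move=> /contractiveE Ac; apply/contractiveE => y.
have := Ac (dinr y); rewrite !nsq_dsum/= nsq0 add0r; apply: le_trans.
by rewrite lerDr nsq_ge0.
Qed.
End Transfer.

Section RegionInvertible.
Context {R : realType} {V : hilbertType R}.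

(* For [a = 0] the region is the union over all [s > 0], [s^2 + c^2 = 1], of the discs
   [|s z + i c| < 1]. *)
Lemma Pi_region_disc (a : R) (z : R[i]) : 0 <= a -> a < pi / 2 -> Pi_region a z ->
  exists s c : R, [/\ 0 < s, s ^+ 2 + c ^+ 2 = 1,
    csq (z * s%:C%C + 'i%C * c%:C%C) < 1 &
    forall A : 'L(V), sect (sin a) (cos a) A -> contractive (rotop s c A)].
Proof.
move=> a0 a1; rewrite /Pi_region; have [->|an0] := eqVneq a 0; last first.
  have [sc s0 c0] := sincos a0 a1.
  have s1 : 0 < sin a by rewrite sin_gt0_pihalf// a1 andbT lt_def an0.
  case=> h.
    exists (sin a), (cos a); split=> //; first by rewrite -norm_lt1.
    by move=> A hA; case: (sect_rot sc s0 (ltW c0) hA).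
  exists (sin a), (- cos a); split=> //; rewrite ?sqrrN//.
    by rewrite -norm_lt1 rmorphN mulrN.
  by move=> A hA; case: (sect_rot sc s0 (ltW c0) hA).
rewrite sin0 cos0; case: z => x y /=.
rewrite !lecE/= oppr0 => -[h1 h2].
have rotA s c (A : 'L(V)) : s ^+ 2 + c ^+ 2 = 1 -> sect 0 1 A -> contractive (rotop s c A).
  move=> sc [/contractiveE Ac h]; apply/rot_contractive => // w.
  have := h w; rewrite mul0r pmulr_rle0 ?mulr_gt0// normr_le0 => /eqP ->.
  by rewrite !mulr0 mulr_ge0 ?sqr_ge0// subr_ge0.
have csqE s c : csq ((x +i* y)%C * s%:C%C + 'i%C * c%:C%C)
    = (s * x) ^+ 2 + (s * y + c) ^+ 2.
  rewrite /csq/=; ring.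
have [y0|y0] := eqVneq y 0.
  exists 1, 0; split=> //; first by rewrite expr1n expr0n addr0.
    rewrite csqE y0 mulr0 addr0 expr0n addr0 mul1r.
    have {}h1 : -1 < x by rewrite ltNge; apply/negP => hx; apply: h1; rewrite y0 eqxx.
    have {}h2 : x < 1 by rewrite ltNge; apply/negP => hx; apply: h2; rewrite y0 eqxx.
    by nra.
  by move=> A; apply: rotA; rewrite expr1n expr0n addr0.
(* [s = t / r], [c = - Im z / r] with [r = |(t, Im z)|] for a small [t > 0] *)
pose t := y ^+ 2 / (x ^+ 2 + y ^+ 2 + 1).
have y2 : 0 < y ^+ 2 by rewrite exprn_even_gt0.
have d0 : 0 < x ^+ 2 + y ^+ 2 + 1 by have := sqr_ge0 x; lra.
have t0 : 0 < t by rewrite divr_gt0.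
have tE : t * (x ^+ 2 + y ^+ 2 + 1) = y ^+ 2 by rewrite /t divfK// gt_eqF.
clearbody t.
pose r := Num.sqrt (t ^+ 2 + y ^+ 2).
have r0 : 0 < r by rewrite sqrtr_gt0 addr_gt0// exprn_gt0.
have r2 : r ^+ 2 = t ^+ 2 + y ^+ 2 by rewrite sqr_sqrtr// ltW// addr_gt0// exprn_gt0.
clearbody r.
have sc : (t / r) ^+ 2 + (- y / r) ^+ 2 = 1.
  by rewrite !exprMn sqrrN -mulrDl -r2 -exprMn divff ?expr1n// gt_eqF.
exists (t / r), (- y / r); split=> //; first by rewrite divr_gt0.
  rewrite csqE.
  have -> : (t / r * x) ^+ 2 + (t / r * y + - y / r) ^+ 2
      = ((t * x) ^+ 2 + (t * y - y) ^+ 2) / r ^+ 2.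
    by field; rewrite gt_eqF.
  rewrite ltr_pdivrMr ?exprn_gt0// mul1r r2.
  (* By the choice of [t] the numerator equals [y^2 - t y^2 - t^2], which is below [t^2 + y^2]. *)
  have : t * (t * (x ^+ 2 + y ^+ 2 + 1)) = t * y ^+ 2 by rewrite tE.
  have : 0 < t * y ^+ 2 by rewrite mulr_gt0.
  have : 0 < t ^+ 2 by rewrite exprn_gt0.
  by lra.
by move=> A; apply: rotA.
Qed.

End RegionInvertible.

Lemma Pi_region_invertible (R : realType) (U E : hilbertType R) (a : R) (z : R[i])
    (A : 'L(dsum U E)) : 0 <= a -> a < pi / 2 -> Pi_region a z ->
  sect (sin a) (cos a) A -> invertible (bid - z *: entry22 A).
Proof.
move=> a0 a1 /(@Pi_region_disc _ (dsum U E) _ _ a0 a1)[s [c [s0 sc zsc h]]] /h Ac.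
exact: rot_invertible s0 sc (entry22_rot Ac) zsc.
Qed.

(** * Boundary limits *)

Section BoundaryLimit.
Context {R : realType}.

(* The form of a sectorial [I - A] is bounded and coercive in the seminorm [|Q x|],
   where [Q^2 = (I - A) + (I - A)^*]. *)
Lemma sectorial_factor (V : hilbertType R) (A : 'L(V)) (s c : R) : 0 <= s -> 0 < c ->
  sect s c A -> exists Q L : 'L(V), [/\ (forall x y, rdot (Q x) y = rdot x (Q y)),
    (forall x, nsq (Q x) = 2 * rdot ((bid - A) x) x) &
    (forall x y, rdot ((bid - A) x) y = rdot (L (Q x)) (Q y))].
Proof.
move=> s0 c0 [/contractiveE Ac h].
pose S := bid - A; rewrite -/S.
have SE x : S x = x - A x by [].
clearbody S.
have Tp : bpos (S + adj S).
  apply/bposE; split=> [|x].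
    by apply/selfadjointE => x y; rewrite !bopDE rdotDl rdotDr adjPr -adjP addrC.
  rewrite bopDE rdotDl adjPr (rdotC x) SE rdotDl rdotNl -/(nsq x).
  by have := rdot_amgm (A x) x; have := Ac x; lra.
have [/bposE[/selfadjointE Qs _] QQ _] := bsqrtP Tp; set Q := bsqrt _ in Qs QQ.
have nQ x : nsq (Q x) = 2 * rdot (S x) x.
  by rewrite {1}/nsq Qs -bcompE QQ rdotC bopDE rdotDl adjPr (rdotC x); ring.
pose m x := rdot (S x) ('i%C *: x).
(* For a contraction [|x|^2 - |A x|^2 <= 2 Re <(I - A) x, x> = |Q x|^2]. *)
have mq x : 2 * c * `|m x| <= s * nsq (Q x).
  rewrite /m nQ SE rdotDl rdotxi add0r rdotNl normrN; apply: le_trans (h x) _.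
  rewrite ler_wpM2l// rdotDl rdotNl -/(nsq x).
  by have := rdot_amgm (A x) x; lra.
(* The symmetric part of the form contributes [c]. Polarizing the imaginary part at [x + i y]
   contributes [3 s]: one from [x] and [y], two from [|Q (x + i y)|^2]. *)
have k0 : 0 <= (c + 3 * s) / (4 * c) by rewrite divr_ge0//; lra.
have [|L LE] := @form_factor _ _ _ S Q _ k0; last by exists Q, L.
  move=> x y; rewrite mulrAC ler_pdivlMr; last lra.
  have m1 := ler_wpM2l (ltW c0) (ler_norm (m x)).
  have m2 := ler_wpM2l (ltW c0) (ler_norm (m y)).
  have m3 := ler_wpM2l (ltW c0) (ler_norm (- m (x + 'i%C *: y))).
  have := mq x; have := mq y; have := mq (x + 'i%C *: y).
  have := nsqD_le (Q x) (Q ('i%C *: y)).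
  rewrite -bop_rD bop_rZ nsqi => n3; rewrite normrN in m3.
  have mE : m (x + 'i%C *: y) = m x - rdot (S x) y + rdot (S y) x + m y.
    rewrite /m bop_rD bop_rZ scalerDr scalerA -expr2 sqr_i scaleN1r.
    by rewrite rdotDl !rdotDr !rdotNr rdotii (rdoti (S y) y); ring.
  have n4 : 2 * rdot (S x) y + 2 * rdot (S y) x <= nsq (Q x) + nsq (Q y).
    have := nsq_ge0 (Q (x - y)); rewrite nQ bop_rB rdotDl !rdotDr !rdotNl !rdotNr.
    by rewrite !nQ; lra.
  have n5 := ler_wpM2l (ltW c0) n4; have n6 := ler_wpM2l s0 n3.
  by rewrite mE in m3 *; move: (`|m x|) (`|m y|) (`|_|) m1 m2 m3; move=> *; lra.
Qed.

Lemma rdotZ_self (V : hilbertType R) (a : R[i]) (x : V) :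
  rdot (a *: x) x = complex.Re a * nsq x.
Proof. by rewrite rdotZl rdotxi mulr0 subr0. Qed.

(* In a Stolz angle, [Re ((1 - z) conj z) >= |1 - z| / (4 M)] near [1]. *)
Lemma stolz_estimate (V : hilbertType R) (z : R[i]) (M : R) (h v : V) : 1 < M ->
  stolz 1 M z -> csq (1 - z) <= (2 * M) ^- 2 ->
  rdot ((z - 1) *: h) (z *: h - v) <= M * Num.sqrt (csq (1 - z)) * nsq v.
Proof.
move=> M1 [z1 zM] zs.
have M0 : 0 < M by lra.
pose tau := Num.sqrt (csq z); pose rho := Num.sqrt (csq (1 - z)).
have nE (a : R[i]) : `|a| = (Num.sqrt (csq a))%:C%C by rewrite normc_def.
have t1 : tau < 1 by rewrite -ltcR -nE.
have rM : rho < M * (1 - tau).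
  by move: zM; rewrite !nE -/tau -/rho -[1 in X in X -> _]/(1%:C%C) -rmorphB -rmorphM ltcR.
have t0 : 0 <= tau by exact: sqrtr_ge0.
have r0 : 0 <= rho by exact: sqrtr_ge0.
have t2 : tau ^+ 2 = csq z by rewrite sqr_sqrtr ?csq_ge0.
have r2 : rho ^+ 2 = csq (1 - z) by rewrite sqr_sqrtr ?csq_ge0.
rewrite -r2 -exprVn in zs.
have rs : rho <= (2 * M)^-1.
  by move: zs; rewrite ler_pXn2r// nnegrE invr_ge0; lra.
rewrite -/rho rdotDr rdotNr.
have -> : rdot ((z - 1) *: h) (z *: h) = (tau ^+ 2 + rho ^+ 2 - 1) / 2 * nsq h.
  rewrite rdotZrJ scalerA rdotZ_self t2 r2; congr (_ * _).
  by rewrite /csq; case: (z) => a b /=; field.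
have rpos : 0 < rho.
  rewrite lt_def r0 andbT; apply/eqP => rz; move: r2 t2; rewrite rz expr0n /csq.
  case: (z) => a b /= h1 h2; have h3 : a = 1 by nra.
  have h4 : b ^+ 2 = 0 by move: h1; rewrite h3; lra.
  by move: h2; rewrite h3; nra.
(* The weight is chosen so that the resulting [|h|^2] term exactly cancels the negative one provided
   by [c1]. *)
have yng := rdot_young ((z - 1) *: h) (- v) (r := (2 * M * rho)^-1).
have MM : M * (2 * M)^-1 = 2^-1 by rewrite invfM mulrCA divff ?mulr1// gt_eqF.
have Mr : rho <= M * rho by nra.
have c1 : (tau ^+ 2 + rho ^+ 2 - 1) / 2 <= - (rho / (4 * M)).
  rewrite -subr_ge0 -(pmulr_rge0 _ M0).
  have -> : M * (- (rho / (4 * M)) - (tau ^+ 2 + rho ^+ 2 - 1) / 2)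
     = (M * (1 - tau ^+ 2) - rho / 2 - M * rho * rho) / 2 by field; rewrite gt_eqF.
  have h1 : M * rho <= 2^-1 by rewrite -MM ler_pM2l.
  have h2 := ler_wpM2r r0 h1.
  have h3 : tau ^+ 2 <= tau by nra.
  have h4 := ler_wpM2l (ltW M0) h3.
  lra.
have c2 := ler_wpM2r (nsq_ge0 h) c1.
have nzh : nsq ((z - 1) *: h) = rho ^+ 2 * nsq h.
  by rewrite nsqZ r2 /csq; case: (z) => a b /=; ring.
rewrite nsqN nzh rdotNr in yng.
have k0 : 0 < 2 * M * rho by rewrite !mulr_gt0.
have /(_ _)/(ler_wpM2l (ltW k0)) := yng; rewrite invr_gt0 => /(_ k0).
have -> : 2 * M * rho * (2 * (2 * M * rho)^-1 * - rdot ((z - 1) *: h) v)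
   = - (2 * rdot ((z - 1) *: h) v) by field; rewrite !gt_eqF.
have -> : 2 * M * rho * ((2 * M * rho)^-1 ^+ 2 * (rho ^+ 2 * nsq h) + nsq v)
   = 2 * (rho / (4 * M) * nsq h) + 2 * (M * rho * nsq v) by field; rewrite !gt_eqF.
lra.
Qed.

Section At1.
Context {U E : hilbertType R} (A : 'L(dsum U E)) (s c : R).
Hypotheses (s0 : 0 <= s) (c0 : 0 < c) (As : sect s c A).

(* Write [I - A = Q L Q] and let [k u], in the closure [K] of [Q (0 (+) E)], solve the
   Lax-Milgram problem [L (Q (u, 0) + k u)] orthogonal to [K]. If [A (u, z h) = (F u, h)]
   with [F = transfer A z], then [e = Q (0, z h) - k u] satisfies
   [<L e, Q (0, v)> = <(z - 1) h, v>] for all [v], which forces [e -> 0] as [z -> 1] in a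
   Stolz angle, once [k u] is approximated by some [Q (0, v)]. *)
Lemma nt_limit_transfer1 : exists L : 'L(U), nt_limit (transfer A) 1 L.
Proof.
have [Q [L [Qs nQ LE]]] := sectorial_factor s0 c0 As.
pose T := Q ∘ dinr : 'L(E, dsum U E).
pose K := clrange T; pose LK := oproj K ∘ L ∘ incl K.
have Kco (k : K) : 2^-1 * nsq k <= rdot (L (incl K k)) (incl K k).
  have c2 : (2^-1 : R[i]) = (2^-1)%:C%C by rewrite fmorphV rmorph_nat.
  have := @nonneg_closed _ _ (L - (2^-1)%:C%C *: bid) (incl K k).
  rewrite !bopE rdotDl rdotNl rdotZlR -/(nsq _) subr_ge0; apply=> e e0.
  have [v kv] := clrange_approx k e0; exists (T v) => //.
  by rewrite !bopE rdotDl rdotNl rdotZlR -LE -/(nsq _) nQ mulrA mulVf// mul1r subrr.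
have LKi : invertible LK.
  by apply: (@coercive_invertible _ _ _ 2^-1) => [|k]; rewrite ?invr_gt0// oprojP.
pose k u : K := - binv LK (oproj K (L (Q (dinl u)))).
have kP u (t : K) : rdot (L (Q (dinl u) + incl K (k u))) (incl K t) = 0.
  rewrite -oprojP bop_rD bop_rD -[oproj K (L (incl K _))]/(LK (k u)) bop_rN binvKr//.
  by rewrite subrr rdot0l.
pose B := dfst ∘ Q ∘ L : 'L(dsum U E, U).
exists (bid - B ∘ (Q ∘ dinl - incl K ∘ binv LK ∘ oproj K ∘ L ∘ Q ∘ dinl)).
move=> u M e M1 e0.
have [eta eta0 etaP] := nsq_small B e0.
have [cL cL0 Lb] := bop_bounded L.
have M0 : 0 < M by lra.
(* Budget: half of [|er|^2] is at most [eta / 8] from the Stolz estimate, plus [|er|^2 / 4] and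
   [cL |rr|^2 <= eta / 8] from Young's inequality. *)
have d0 : 0 < eta / (8 * cL) by rewrite divr_gt0// mulr_gt0.
have [v kv] := clrange_approx (k u) d0.
pose d1 := (2 * M)^-1; have d10 : 0 < d1 by rewrite invr_gt0 mulr_gt0.
pose d2 := eta / (8 * M * (nsq v + 1)).
have nv := nsq_ge0 v.
have d20 : 0 < d2 by rewrite divr_gt0// !mulr_gt0// ltr_wpDl.
exists (Num.min (d1 ^+ 2) (d2 ^+ 2)); first by rewrite lt_min !exprn_gt0.
move=> z Sz; rewrite lt_min => /andP[zd1 zd2].
have z1 : `|z| < 1 by case: Sz.
have Ai : invertible (bid - z *: entry22 A).
  by apply: disc_invertible z1; apply: entry22_contractive; case: As.
have [h hE] := transfer_realizes Ai u; set F := transfer A z in hE *.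
set x := ((u, z *: h) : dsum U E) in hE.
have SE : (bid - A) x = ((u - F u, z *: h - h) : dsum U E) by rewrite !bopE hE.
(* First coordinate of [(I - A) x = Q L Q x]. Thus [F u] depends on [z] only through [Q x], and
   convergence of [Q x] suffices. *)
have FE : F u = u - B (Q x).
  apply: rdot_ext => w; rewrite rdotDl rdotNl.
  have -> : rdot (B (Q x)) w = rdot (u - F u) w.
    have -> : rdot (B (Q x)) w = rdot (Q (L (Q x))) (dinl w).
      by rewrite rdot_dsum/= rdot0r addr0.
    by rewrite Qs -LE SE rdot_dsum/= rdot0r addr0.
  by rewrite rdotDl rdotNl; ring.
pose er := T (z *: h) - incl K (k u).
have QxE : Q x = Q (dinl u) + T (z *: h).
  rewrite /T bcompE -bop_rD; congr (Q _).
  by rewrite -[RHS]/((u + 0, 0 + z *: h) : dsum U E) addr0 add0r.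
have LuE : (bid - B ∘ (Q ∘ dinl - incl K ∘ binv LK ∘ oproj K ∘ L ∘ Q ∘ dinl)) u
    = u - B (Q (dinl u) + incl K (k u)) by rewrite /k bop_rN.
have -> : F u - (bid - B ∘ (Q ∘ dinl - incl K ∘ binv LK ∘ oproj K ∘ L ∘ Q ∘ dinl)) u
    = B (- er).
  rewrite LuE FE QxE /er [- (u - _)]opprB addrC addrA subrK -bop_rB.
  by rewrite opprB opprD addrACA subrr add0r.
apply: etaP; rewrite nsqN.
have [t tE] := clrange_lift T (z *: h).
have eE : er = incl K (t - k u) by rewrite bop_rB tE.
have co : 2^-1 * nsq er <= rdot (L er) er by rewrite eE; exact: Kco.
pose rr := incl K (k u) - T v.
have TdE : T (z *: h - v) = er + rr by rewrite bop_rB /er /rr addrA subrK.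
have h1 : rdot (L er) (T (z *: h - v)) = rdot ((z - 1) *: h) (z *: h - v).
  have [t' t'E] := clrange_lift T (z *: h - v).
  have := kP u t'; rewrite t'E => k0.
  have -> : er = Q x - (Q (dinl u) + incl K (k u)).
    by rewrite QxE /er opprD addrACA subrr add0r.
  rewrite bop_rB rdotDl rdotNl k0 subr0 -LE SE rdot_dsum/= rdot0r add0r.
  by rewrite scalerBl scale1r.
have h2 := stolz_estimate h v M1 Sz.
have h3 := rdot_young (L er) (- rr) (r := (2 * cL)^-1).
have h4 := Lb er.
move: h1; rewrite TdE rdotDr => h1.
move: h3; rewrite invr_gt0 mulr_gt0// => /(_ isT); rewrite rdotNr nsqN => h3.
have k0 : 0 < 2 * cL by rewrite mulr_gt0.
have := ler_wpM2l (ltW k0) h3.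
have -> : 2 * cL * (2 * (2 * cL)^-1 * - rdot (L er) rr) = - 2 * rdot (L er) rr.
  by field; rewrite gt_eqF.
have -> : 2 * cL * ((2 * cL)^-1 ^+ 2 * nsq (L er) + nsq rr)
    = (2 * cL)^-1 * nsq (L er) + 2 * cL * nsq rr by field; rewrite gt_eqF.
have ki : 0 < (2 * cL)^-1 by rewrite invr_gt0.
have := ler_wpM2l (ltW ki) h4.
have -> : (2 * cL)^-1 * (cL * nsq er) = 2^-1 * nsq er by field; rewrite gt_eqF.
have rE : 8 * cL * nsq rr <= eta by rewrite mulrC -ler_pdivlMr ?mulr_gt0.
have zd1' : csq (1 - z) <= (2 * M) ^- 2 by rewrite -exprVn ltW.
move: h2 => /(_ zd1').
have rho2 : Num.sqrt (csq (1 - z)) <= d2.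
  by rewrite -[leRHS](ger0_norm (ltW d20)) -sqrtr_sqr ler_wsqrtr// ltW.
have h5 : M * Num.sqrt (csq (1 - z)) * nsq v <= eta / 8.
  have : M * (nsq v + 1) * 8 * d2 = eta.
    by rewrite /d2; field; rewrite !gt_eqF// ltr_wpDl.
  have : Num.sqrt (csq (1 - z)) * (M * nsq v) <= d2 * (M * nsq v).
    by rewrite ler_wpM2r// mulr_ge0// ltW.
  have : 0 <= M * d2 by rewrite mulr_ge0// ltW.
  lra.
lra.
Qed.
End At1.
End BoundaryLimit.

(** * Radial limits and the shorted operator *)

Section LimitProperties.
Context {R : realType}.
Implicit Types U V W E : hilbertType R.

Lemma cvgs_rdot_ub V (u : nat -> V) l y (k : R) :
  cvgs u l -> (forall n, rdot (u n) y <= k) -> rdot l y <= k.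
Proof.
move=> ul h; apply/ler_addgt0Pr => d d0.
have [e e0 he] := rdot_small y d0; have [N hN] := ul _ e0.
have := he _ (hN N (leqnn _)); rewrite ler_norml rdotDl rdotNl => /andP[h1 _].
by have := h N; lra.
Qed.

(** The shift by 2 keeps every point in [[1/2, 1)]; the lower bound [1/2] is used in Krein's
    formula. *)
Definition radial_pt n : R := 1 - n.+2%:R^-1.

Lemma radial_pt_bounds n : 2^-1 <= radial_pt n < 1.
Proof.
rewrite /radial_pt gtrBl invr_gt0 ltr0n andbT.
have : n.+2%:R^-1 <= 2^-1 :> R by rewrite lef_pV2 ?posrE// ler_nat.
by move: (n.+2%:R^-1 : R) => i; lra.
Qed.

Lemma radial_pt_small (d : R) : 0 < d ->
  exists N, forall n, (N <= n)%N -> (1 - radial_pt n) ^+ 2 < d.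
Proof.
move=> d0; have [|N hN] := @invS_small _ (Num.min 1 (d / 2)).
  by rewrite lt_min ltr01 divr_gt0.
exists N => n Nn; have := hN n.+1 (leqW Nn).
rewrite le_min /radial_pt; have : 0 < n.+2%:R^-1 :> R by rewrite invr_gt0.
move: (n.+2%:R^-1 : R) => i i0 /andP[h1 h2].
by nra.
Qed.

(** Radial points lie in the Stolz angle with [M = 2]. The sign [b] treats both endpoints at
    once. *)
Lemma nt_limit_radial U V (F : R[i] -> 'L(U, V)) (w : R[i]) L (b : bool) :
  w = ((-1) ^+ b)%:C%C -> nt_limit F w L ->
  forall u, cvgs (fun n => F ((-1) ^+ b * radial_pt n)%:C%C u) (L u).
Proof.
move=> -> FL u e e0.
have [d d0 hd] := FL u 2 e (ltr1n _ 2) e0.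
have [N hN] := radial_pt_small d0; exists N => n Nn; apply: hd; last first.
  rewrite -rmorphB /csq/= expr0n addr0 -[X in X - _]mulr1 -mulrBr exprMn.
  by rewrite -exprM mulnC exprM sqrrN expr1n expr1n mul1r hN.
have /andP[r0 r1] := radial_pt_bounds n.
have nC (t : R) : `|t%:C%C| = `|t|%:C%C :> R[i].
  by rewrite normc_def/= expr0n addr0 sqrtr_sqr.
have ns (t : R) : `|(-1) ^+ b * t| = `|t| by rewrite normrM normrX normrN1 expr1n mul1r.
split; rewrite nC.
  by rewrite ns -[1]/(1%:C%C : R[i]) ltcR ger0_norm//; lra.
rewrite ns [X in _ < _ * X](_ : _ = (1 - `|radial_pt n|)%:C%C); last by rewrite rmorphB.
rewrite -rmorphM -rmorphB nC -[X in X - _]mulr1 -mulrBr ns ltcR !ger0_norm; lra.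
Qed.

Lemma nt_limit_radial1 U V (F : R[i] -> 'L(U, V)) L : nt_limit F 1 L ->
  forall u, cvgs (fun n => F (radial_pt n)%:C%C u) (L u).
Proof.
move=> FL u; have w1 : (1 : R[i]) = ((-1) ^+ false)%:C%C by [].
by apply: cvgs_ext (nt_limit_radial w1 FL u) => n; rewrite expr0 mul1r.
Qed.

Lemma cvgs_sect V (T : nat -> 'L(V)) (L : 'L(V)) (s c : R) : 0 <= s -> 0 <= c ->
  (forall x, cvgs (fun n => T n x) (L x)) -> (forall n, sect s c (T n)) -> sect s c L.
Proof.
move=> s0 c0 TL Ts; split.
  apply/contractiveE => x; apply: cvgs_nsq_le (TL x) _ => n.
  by case: (Ts n) => /contractiveE.
move=> x; have key (b : R) : b ^+ 2 = 1 ->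
    2 * c * (b * rdot (L x) ('i%C *: x)) <= s * (nsq x - nsq (L x)).
  (* [|T_n x|^2] is bounded below by its tangent [2 Re <T_n x, L x> - |L x|^2], so the condition
     becomes linear in [T_n x] and passes to the limit without loss. *)
  move=> b2; set y := (2 * c * b)%:C%C *: ('i%C *: x) + (2 * s)%:C%C *: L x.
  have : rdot (L x) y <= s * (nsq x + nsq (L x)).
    apply: cvgs_rdot_ub (TL x) _ => n; have [_ /(_ x) h] := Ts n.
    rewrite rdotDr !rdotZrR.
    have h1 := nsq_ge0 (T n x - L x); rewrite nsqB in h1.
    have h2 : b * rdot (T n x) ('i%C *: x) <= `|rdot (T n x) ('i%C *: x)|.
      apply: le_trans (ler_norm _) _; rewrite normrM.
      by rewrite (_ : `|b| = 1) ?mul1r//; apply/eqP; rewrite -sqrp_eq1// real_normK ?num_real ?b2.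
    by have := ler_wpM2l c0 h2; have := ler_wpM2l s0 h1; lra.
  by rewrite rdotDr !rdotZrR -/(nsq (L x)); lra.
have [r0|r0] := leP 0 (rdot (L x) ('i%C *: x)).
  by rewrite ger0_norm//; have := key 1 (expr1n _ _); lra.
by rewrite ltr0_norm//; have := key (- 1) (sqrr_sign _ 1); lra.
Qed.

Lemma nt_limitN U V (F G : R[i] -> 'L(U, V)) w L :
  (forall z, G z = - F (- z)) -> nt_limit F w L -> nt_limit G (- w) (- L).
Proof.
move=> GF FL u M e M1 e0; have [d d0 hd] := FL u M e M1 e0.
exists d => // z [z1 zM] wz.
rewrite GF !bopNE -opprD nsqN; apply: hd; last first.
  by rewrite opprK; move: wz; rewrite -opprD /csq; case: (w + z) => a b /=; rewrite !sqrrN.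
by split; [rewrite normrN|rewrite opprK normrN -[`|w + z|]normrN opprD].
Qed.

Section Shorted.
Context {U E : hilbertType R} (A : 'L(dsum U E)) (L : 'L(U)).
Hypotheses (As : sect 0 1 A)
  (AL : forall u, cvgs (fun n => transfer A (radial_pt n)%:C%C u) (L u)).

(* With [(u, t h)] minimising [<(I - A) (u, v), (u, v)>] up to [O(1 - t)] over [v], Krein's
   formula identifies the limit [t -> 1] of [I - transfer A t] with the shorted operator. *)
Lemma shorted_limit :
  shorted (bid - A) (range (dinl : 'L(U, dsum U E))) = dinl ∘ (bid - L) ∘ dfst.
Proof.
have Ls : sect 0 1 L.
  apply: (@cvgs_sect _ (fun n => transfer A (radial_pt n)%:C%C)) => // n.
  have /andP[r0 r1] := radial_pt_bounds n.
  apply: (@realizes_sect _ _ _ _ (radial_pt n)) As _ => //; first by nra.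
  apply: transfer_realizes; apply: disc_invertible.
    by apply: entry22_contractive; case: As.
  rewrite norm_lt1 /csq/= expr0n addr0; nra.
have /sect0[/selfadjointE As' /contractiveE Ac] := As.
have /sect0[/selfadjointE Ls' /contractiveE Lc] := Ls.
set Z0 := dinl ∘ (bid - L) ∘ dfst.
have rZ p q : rdot (Z0 p) q = rdot p.1 q.1 - rdot (L p.1) q.1.
  have -> : Z0 p = ((p.1 - L p.1, 0) : dsum U E) by [].
  by rewrite rdot_dsum/= rdot0l addr0 rdotDl rdotNl.
have fact n u : exists h, A ((u, (radial_pt n)%:C%C *: h) : dsum U E) =
    ((transfer A (radial_pt n)%:C%C u, h) : dsum U E).
  apply: transfer_realizes; apply: disc_invertible.
    by apply: entry22_contractive; case: As.
  have /andP[r0 r1] := radial_pt_bounds n.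
  rewrite norm_lt1 /csq/= expr0n addr0; nra.
have Sp (p : dsum U E) : 0 <= nsq p - rdot (A p) p.
  by have := rdot_amgm (A p) p; have := Ac p; lra.
have Zpos : bpos Z0.
  apply/bposE; split=> [|p].
    by apply/selfadjointE => p q; rewrite rZ [RHS]rdotC rZ Ls' (rdotC p.1) (rdotC p.1).
  rewrite rZ -/(nsq _); have := rdot_amgm (L p.1) p.1; have := Lc p.1; lra.
have Zle : ble Z0 (bid - A).
  apply/bposE; split=> [|[u v]].
    apply/selfadjointE => p q; rewrite !(bopDE, bopNE, bidE) !(rdotDl, rdotDr, rdotNl, rdotNr).
    rewrite As'; congr (_ - _); rewrite rZ [RHS]rdotC rZ Ls'.
    by rewrite (rdotC p.1) (rdotC p.1).
  rewrite !(bopDE, bopNE, bidE) !(rdotDl, rdotNl) rZ /= -!/(nsq _).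
  set p := ((u, v) : dsum U E).
  (* The second coordinate, 0 in the limit, carries the error [2 (1 - r) |v|^2] committed at the
     radial point [r]. *)
  suff : rdot ((L u, 0) : dsum U E) ((- u, - (2%:C%C *: v)) : dsum U E)
      <= nsq p - rdot (A p) p - nsq u.
    by rewrite rdot_dsum/= rdot0l addr0 rdotNr; lra.
  have cv : cvgs (fun n =>
      ((transfer A (radial_pt n)%:C%C u, (1 - radial_pt n)%:C%C *: v) : dsum U E))
      ((L u, 0) : dsum U E).
    move=> e e0; have e2 : 0 < e / 2 by rewrite divr_gt0.
    have [N1 hN1] := AL u e2.
    have k0 : 0 < 2 * (nsq v + 1) by rewrite mulr_gt0// ltr_wpDl ?nsq_ge0.
    have [N2 hN2] := radial_pt_small (divr_gt0 e0 k0).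
    exists (N1 + N2)%N => n Nn; rewrite nsq_dsum/= subr0 nsqZR.
    have := hN1 n (leq_trans (leq_addr _ _) Nn).
    have := hN2 n (leq_trans (leq_addl _ _) Nn); rewrite ltr_pdivlMr//.
    by have := sqr_ge0 (1 - radial_pt n); have := nsq_ge0 v; nra.
  apply: cvgs_rdot_ub cv _ => n; have [h hE] := fact n u.
  have /andP[r0 r1] := radial_pt_bounds n.
  move: hE; set r := radial_pt n in r0 r1 *; set F := transfer A _ => hE.
  clearbody F r.
  pose d := v - r%:C%C *: h.
  have pE : p = ((u, r%:C%C *: h) : dsum U E) + dinr d.
    rewrite -[RHS]/((u + 0, r%:C%C *: h + d) : dsum U E) addr0 /d addrC subrK.
    by [].
  have e3 : rdot h d = rdot h v - r * nsq h by rewrite rdotDr rdotNr rdotZrR.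
  clearbody d; have Sd := Sp (dinr d).
  have e1 : rdot (A p) p = rdot (F u) u + r * nsq h + 2 * rdot h d
      + rdot (A (dinr d)) (dinr d).
    rewrite pE bop_rD rdotDl !rdotDr hE [rdot (A (dinr d)) (_, _)]As' hE !rdot_dsum/=.
    by rewrite !rdot0l !rdot0r rdotZrR (rdotC d h) -/(nsq h); ring.
  have e2 : nsq p = nsq u + r ^+ 2 * nsq h + 2 * (r * rdot h d) + nsq (dinr d : dsum U E).
    by rewrite pE nsqD rdot_dsum/= rdot0r add0r rdotZlR nsq_dsum/= nsqZR.
  have e4 := nsq_ge0 (h - 2%:C%C *: v); rewrite nsqB nsqZR rdotZrR in e4.
  rewrite rdot_dsum/= !rdotNr rdotZlR rdotZrR -/(nsq v) e1 e2.
  have := nsq_ge0 h; have := nsq_ge0 v => nv nh.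
  (* Since [r >= 1/2], the second factor is at least [|h - 2 v|^2 / 2]. *)
  have e5 : 0 <= (1 - r) * (r * nsq h - 2 * rdot h v + 2 * nsq v).
    by apply: mulr_ge0; nra.
  rewrite e3; nra.
have Zr : range Z0 `<=` range (dinl : 'L(U, dsum U E)).
  by move=> _ [p _ <-]; exists ((bid - L) p.1).
have Zmax (Z : 'L(dsum U E)) : [/\ bpos Z, ble Z (bid - A) &
    range Z `<=` range (dinl : 'L(U, dsum U E))] -> ble Z Z0.
  move=> [Zp /bposE[_ ZS] Zi]; have /bposE[/selfadjointE Zs _] := Zp.
  (* The range condition makes the positive form of [Z] vanish on [0 (+) E], so [Z] depends only on
     the first coordinate. *)
  have Z2 w : Z (dinr w) = 0.
    apply: bpos_ker => //; have [|u' _ <-] := Zi (Z (dinr w)); first by exists (dinr w).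
    by rewrite rdot_dsum/= rdot0l rdot0r addr0.
  apply/bposE; split=> [|[u v]].
    apply/selfadjointE => p q; rewrite !(bopDE, bopNE) !(rdotDl, rdotDr, rdotNl, rdotNr).
    rewrite Zs; congr (_ - _); rewrite rZ [RHS]rdotC rZ Ls'.
    by rewrite (rdotC p.1) (rdotC p.1).
  have split2 w : ((u, w) : dsum U E) = dinl u + dinr w.
    by rewrite -[RHS]/((u + 0, 0 + w) : dsum U E) addr0 add0r.
  have Zuw w : rdot (Z ((u, w) : dsum U E)) ((u, w) : dsum U E) = rdot (Z (dinl u)) (dinl u).
    rewrite split2 bop_rD Z2 addr0 rdotDr (Zs (dinl u) (dinr w)) Z2 rdot0r addr0.
    by [].
  rewrite !(bopDE, bopNE) !(rdotDl, rdotNl) rZ /= -!/(nsq _) Zuw.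
  suff : rdot (L u) u <= nsq u - rdot (Z (dinl u)) (dinl u) by lra.
  apply: cvgs_rdot_ub (AL u) _ => n; have [h hE] := fact n u.
  have /andP[r0 r1] := radial_pt_bounds n.
  move: hE; set r := radial_pt n in r0 r1 *; set F := transfer A _ => hE.
  clearbody F r.
  (* At this vector the form of [I - A] is [<(I - F) u, u> - r (1 - r) |h|^2]. *)
  have := ZS ((u, r%:C%C *: h) : dsum U E).
  rewrite !(bopDE, bopNE, bidE) !(rdotDl, rdotNl) Zuw hE !rdot_dsum/= !rdotZlR !rdotZrR.
  have : 0 <= r * (1 - r) * nsq h by rewrite !mulr_ge0 ?nsq_ge0//; lra.
  by rewrite /nsq; lra.
rewrite /shorted; case: xgetP => [Z _ [Zd hmax]|/(_ Z0)]; last by case; split.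
by apply: ble_anti; [exact: Zmax|exact: hmax].
Qed.

Lemma shorted_limit_entry :
  L = entry11 (bid - shorted (bid - A) (range (dinl : 'L(U, dsum U E)))).
Proof.
apply: bopP => u; rewrite shorted_limit.
by rewrite !bopE/= opprB addrC subrK.
Qed.
End Shorted.
End LimitProperties.

(** * Block operators *)

Section OrthogonalDecomposition.
Context {R : realType} {V : hilbertType R} (S : csubspace V).

Lemma rdot_incl_orthc (s : S) (n : orthc S) : rdot (incl S s) (incl (orthc S) n) = 0.
Proof.
rewrite rdotC /rdot; have /(_ s) : orthc_set S (val n).
  by have := csub_valP n; rewrite inE.
by move=> ->.
Qed.

Lemma orthc_decomp x : x = incl S (oproj S x) + incl (orthc S) (oproj (orthc S) x).
Proof.
pose y := x - incl S (oproj S x).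
have yS : y \in cmem (orthc S).
  rewrite inE => s; have h t : rdot y (incl S t) = 0 by exact: oproj_orth.
  by have := innerE y (incl S s); rewrite -bop_rZ !h => ->.
pose n : orthc S := CSub yS; have nE : incl (orthc S) n = y by [].
suff -> : oproj (orthc S) x = n by rewrite nE /y addrC subrK.
apply: rdot_ext => m; rewrite oprojP -rdot_incl nE /y rdotDl rdotNl.
by rewrite rdot_incl_orthc subr0.
Qed.

Lemma oproj_orthc (n : orthc S) : oproj S (incl (orthc S) n) = 0.
Proof. by apply: rdot_ext => s; rewrite oprojP rdotC rdot_incl_orthc rdot0l. Qed.

Lemma orthc_oproj (s : S) : oproj (orthc S) (incl S s) = 0.
Proof. by apply: rdot_ext => n; rewrite oprojP rdot_incl_orthc rdot0l. Qed.

Lemma rdot_decomp (s t : S) (n m : orthc S) :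
  rdot (incl S s + incl (orthc S) n) (incl S t + incl (orthc S) m)
    = rdot s t + rdot n m.
Proof.
rewrite !(rdotDl, rdotDr) !rdot_incl rdot_incl_orthc (rdotC (incl _ n)) rdot_incl_orthc.
by rewrite addr0 add0r.
Qed.

Lemma oproj_decomp (s : S) (n : orthc S) :
  oproj S (incl S s + incl (orthc S) n) = s /\
  oproj (orthc S) (incl S s + incl (orthc S) n) = n.
Proof.
by rewrite !bop_rD !oproj_incl oproj_orthc orthc_oproj addr0 add0r.
Qed.
(** [B_mu], [B_M] and [ext_block] differ only in the lower right corner; this isolates the
    difference. *)
Lemma block2_addE (A11 : 'L(S, S)) (A12 : 'L(orthc S, S)) (A21 : 'L(S, orthc S))
    (A22 C : 'L(orthc S, orthc S)) x :
  block2 A11 A12 A21 (A22 + C) x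
    = block2 A11 A12 A21 A22 x + incl (orthc S) (C (oproj (orthc S) x)).
Proof.
rewrite -[LHS]/(incl S (A11 (oproj S x) + A12 (oproj (orthc S) x))
  + incl (orthc S) (A21 (oproj S x) + (A22 (oproj (orthc S) x) + C (oproj (orthc S) x)))).
by rewrite [A21 _ + _]addrA (bop_rD (incl (orthc S))) addrA.
Qed.
End OrthogonalDecomposition.

(** * The extensions in block form *)

Section Blocks.
Context {R : realType} {H : hilbertType R} {H0 : csubspace H} {B : 'L(H0, H)}.
Context (K0 : 'L(defspace (B0 B), orthc H0)).
Hypotheses (Bh : hermitian_contraction B) (BK : is_K0 K0).

Local Notation N := (orthc H0).
Local Notation DK := (defspace (adj K0)).
Local Notation b0 := (B0 B).

Lemma B0_contractive : contractive b0.
Proof.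
case: Bh => /contractiveE Bc _; apply/contractiveE => f; apply: le_trans (Bc f).
rewrite [in leRHS](orthc_decomp H0 (B f)) /nsq rdot_decomp.
by rewrite lerDl nsq_ge0.
Qed.

Lemma B0_sa f g : rdot (b0 f) g = rdot f (b0 g).
Proof.
case: Bh => _ h; rewrite oprojP /rdot h -/(rdot _ _).
by rewrite -[RHS]rdotC oprojP rdotC.
Qed.

Lemma adj_B0 : adj b0 = b0.
Proof. by apply: adj_uniq; exact: B0_sa. Qed.

Lemma defect_B0 f : b0 (defect b0 f) = defect b0 (b0 f).
Proof. by apply: defect_comm => [|g]; rewrite ?adj_B0//; exact: B0_contractive. Qed.

(** [B0] commutes with [D_{B0}], hence preserves the closure of [ran D_{B0}]. *)
Lemma defspace_B0 (g : defspace b0) :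
  incl _ (oproj (defspace b0) (b0 (incl _ g))) = b0 (incl _ g).
Proof.
have [|t tE] := @clrange_in _ _ _ (defect b0) (b0 (incl _ g)).
  move=> e e0; have [f fg] := clrange_approx g e0; exists (b0 f).
  rewrite -defect_B0 -bop_rB; apply: le_trans fg.
  by move/contractiveE: B0_contractive; apply.
by rewrite -tE oproj_incl.
Qed.

Lemma adjK0_contractive : contractive (adj K0).
Proof. by case: BK => K0c _; exact: adj_contractive. Qed.

(** The centre [(B_mu + B_M) / 2] of the operator interval. *)
Definition fixed_block : 'L(H) := block2 b0 (DBK K0) (KDB K0) (- KBK K0).

Lemma ext_blockE (Y : 'L(DK)) x : ext_block Y x = fixed_block x +
  incl N (defect (adj K0) (incl DK (Y (cdefect (adj K0) (oproj N x))))).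
Proof.
by rewrite /ext_block block2_addE.
Qed.

Local Notation D2 := (incl N ∘ (defect (adj K0) ∘ defect (adj K0)) ∘ oproj N).

Lemma B_ME x : B_M K0 x = fixed_block x + D2 x.
Proof. by rewrite /B_M block2_addE. Qed.

Lemma B_muE x : B_mu K0 x = fixed_block x - D2 x.
Proof. by rewrite /B_mu block2_addE bopNE bop_rN. Qed.

(** The right-hand side is positive with the correct square, and positive roots are unique. The two
    factors [sqrt 2] absorb the [1/2] in [B_hat]. *)
Lemma sqrt_B_M_mu : bsqrt (B_M K0 - B_mu K0)
  = (Num.sqrt 2)%:C%C *: (incl N ∘ defect (adj K0) ∘ oproj N).
Proof.
set Q := (X in _ = X).
have dsa := defect_sa adjK0_contractive.
have Qp : bpos Q.
  have /bposE[_ dp] : bpos (defect (adj K0)).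
    by have [] := bsqrtP (defect_bpos adjK0_contractive).
  apply/bposE; split=> [|x].
    apply/selfadjointE => x y; rewrite !bopE rdotZlR rdotZrR; congr (_ * _).
    by rewrite rdotC -oprojP -dsa rdotC -[RHS]oprojP rdotC.
  rewrite !bopE rdotZlR mulr_ge0 ?sqrtr_ge0// rdotC -oprojP rdotC.
  exact: dp.
rewrite -(bsqrtE Qp); congr bsqrt; apply: bopP => x.
have QE y : Q y = (Num.sqrt 2)%:C%C *: incl N (defect (adj K0) (oproj N y)) by [].
have -> : (Q ∘ Q) x = 2%:C%C *: D2 x.
  rewrite bcompE QE QE !bop_rZ oproj_incl scalerA -rmorphM -expr2 sqr_sqrtr//.
rewrite bopDE bopNE B_ME B_muE opprB addrC addrA subrK.
by rewrite rmorph_nat scaler_nat mulr2n.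
Qed.

Lemma B_hat_block (Y : 'L(DK)) : let Q := bsqrt (B_M K0 - B_mu K0) in
  2^-1 *: (B_mu K0 + B_M K0) +
  2^-1 *: (Q ∘ (incl N ∘ incl DK) ∘ Y ∘ (oproj DK ∘ oproj N) ∘ Q) = ext_block Y.
Proof.
rewrite /= sqrt_B_M_mu; apply: bopP => x; rewrite ext_blockE bopDE; congr (_ + _).
  rewrite bopZE bopDE B_ME B_muE addrACA addNr addr0 -mulr2n.
  rewrite -[fixed_block x *+ 2]scaler_nat scalerA.
  by rewrite mulVf ?scale1r// pnatr_eq0.
set Q := (Num.sqrt 2)%:C%C *: _.
have QE y : Q y = (Num.sqrt 2)%:C%C *: incl N (defect (adj K0) (oproj N y)) by [].
rewrite bopZE !bcompE QE QE !bop_rZ !oproj_incl.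
rewrite [(Num.sqrt 2)%:C%C *: (_ *: _)]scalerA -rmorphM -expr2 sqr_sqrtr//.
rewrite rmorph_nat scalerA mulVf ?pnatr_eq0// scale1r.
by [].
Qed.

Lemma ext_block_extends (Y : 'L(DK)) f : ext_block Y (incl H0 f) = B f.
Proof.
rewrite ext_blockE orthc_oproj !bop_r0 addr0 /fixed_block.
rewrite -[LHS]/(incl H0 (b0 (oproj H0 (incl H0 f)) + DBK K0 (oproj N (incl H0 f)))
  + incl N (KDB K0 (oproj H0 (incl H0 f)) - KBK K0 (oproj N (incl H0 f)))).
rewrite oproj_incl orthc_oproj !bop_r0 subr0 addr0 [RHS](orthc_decomp H0).
case: BK => _ /(congr1 (fun T : 'L(H0, N) => T f)) KE.
by rewrite -[oproj N (B f)]KE.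
Qed.

Lemma fixed_blockE x : fixed_block x =
  incl H0 (b0 (oproj H0 x) + defect b0 (incl _ (adj K0 (oproj N x)))) +
  incl N (K0 (cdefect b0 (oproj H0 x)
     - oproj (defspace b0) (b0 (incl _ (adj K0 (oproj N x)))))).
Proof. by rewrite bop_rB. Qed.

Section Coupling.
Context {E : hilbertType R} (X : 'L(dsum DK E)).
Local Notation cD n := (cdefect (adj K0) n).

Lemma B_tildeE x e : B_tilde X ((x, e) : dsum H E) =
  ((fixed_block x + incl N (defect (adj K0) (incl DK (X ((cD (oproj N x), e) : dsum DK E)).1)),
    (X ((cD (oproj N x), e) : dsum DK E)).2) : dsum H E).
Proof.
set u := cD (oproj N x); rewrite (blockE X).
rewrite -[(_, _).1]/(entry11 X u + entry12 X e) -[(_, _).2]/(entry21 X u + entry22 X e).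
set p1 := incl H0 (b0 (oproj H0 x) + DBK K0 (oproj N x) + 0).
set p2 := incl N (KDB K0 (oproj H0 x)
  + (- KBK K0 (oproj N x) + defect (adj K0) (incl DK (entry11 X u)))
  + defect (adj K0) (incl DK (entry12 X e))).
rewrite -[LHS]/((p1 + p2 + 0, 0 + 0 + (0 + entry21 X u + entry22 X e)) : dsum H E).
rewrite !add0r addr0; congr (_, _); rewrite /p1 /p2 addr0.
rewrite -[fixed_block x]/(incl H0 (b0 (oproj H0 x) + DBK K0 (oproj N x))
  + incl N (KDB K0 (oproj H0 x) - KBK K0 (oproj N x))).
rewrite -[RHS]addrA -bop_rD; congr (_ + incl N _).
by rewrite (bop_rD (incl DK)) (bop_rD (defect (adj K0))) !addrA.
Qed.

(** [X] is reached from [H] only through [D_{K0^*} P_N], on both sides, so the vector [h] found for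
    [X] also serves [B_tilde X]. *)
Lemma B_tilde_realizes z (Y : 'L(DK)) :
  realizes X z Y -> realizes (B_tilde X) z (ext_block Y).
Proof.
move=> XY x; have [h hE] := XY (cD (oproj N x)); exists h.
by rewrite B_tildeE hE ext_blockE.
Qed.

Section ParameterClass.
Context (s c : R).
Hypotheses (s0 : 0 <= s) (c0 : 0 <= c) (Xc : contractive X) (Bs : sect s c (B_tilde X)).

(* [B_tilde X = V^* (J (+) X) V], where [J] is the Halmos unitary of [B0] and
   [V (f, n, e) = (f, K0^* n, D_{K0^*} n, e)] is isometric. Choosing [m] and [f] below makes
   [(J (+) X) V (f, n, e)] almost an element of the range of [V]. *)
Lemma sect_parameter_range n e (y : dsum DK E) : y = (cD n, e) ->
  2 * c * `|rdot (X y) ('i%C *: y)| <= s * (nsq y - nsq (X y)).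
Proof.
move=> yE; apply/ler_addgt0Pr => d d0.
have s10 : 0 < s + 1 by rewrite ltr_wpDl.
(* Two approximation errors occur, each weighted by [s]; adding 1 covers [s = 0]. *)
have eta0 : 0 < d / (2 * (s + 1)) by rewrite divr_gt0// mulr_gt0.
have Kc := adjK0_contractive; have bc := B0_contractive.
set x1 := (X y).1; set x2 := (X y).2.
have [m mE] := defspace_approx x1 eta0.
pose k : H0 := incl _ (adj K0 n).
have [f fE] := defspace_approx
  (oproj (defspace b0) (b0 k) + adj K0 m) eta0.
pose q := cdefect b0 f - oproj (defspace b0) (b0 k).
pose w := K0 q + defect (adj K0) (incl DK x1).
pose p := ((incl H0 f + incl N n, e) : dsum H E).
have [pf pn] := oproj_decomp f n.
have BE : B_tilde X p
    = ((incl H0 (b0 f + defect b0 k) + incl N w, x2) : dsum H E).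
  by rewrite B_tildeE fixed_blockE pf pn -yE -addrA -bop_rD.
have qE : incl _ q = defect b0 f - b0 k.
  by rewrite bop_rB incl_cdefect// defspace_B0.
have dsaK := defect_sa Kc; have dsa := defect_sa bc.
(* [w] is the adjoint of the isometry [m |-> (K0^* m, D m)] applied to [(q, x1)]; little norm is
   lost because [(q, x1)] is close to the image of [m]. *)
have nw : nsq q + nsq x1 - nsq (q - adj K0 m) - nsq (x1 - cD m) <= nsq w.
  rewrite (nsqB q) (nsqB x1) nsq_cdefect// -adjP.
  have -> : rdot x1 (cD m) = rdot (defect (adj K0) (incl DK x1)) m.
    by rewrite dsaK -incl_cdefect.
  have := nsq_ge0 (w - m); rewrite nsqB /w rdotDl; lra.
(* The Halmos matrix with rows [(B0, D)] and [(D, - B0)] is isometric at [(f, k)]. *)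
have hal : nsq (b0 f + defect b0 k) + nsq q = nsq f + nsq k.
  rewrite -[nsq q]nsq_incl qE nsqB nsqD !nsq_defect// -[rdot (defect b0 f) _]B0_sa.
  by rewrite defect_B0 dsa; ring.
have ny : nsq y = nsq n - nsq k + nsq e by rewrite yE nsq_dsum/= nsq_cdefect.
have nX : nsq (X y) = nsq x1 + nsq x2 by rewrite nsq_dsum.
have np : nsq p = nsq f + nsq n + nsq e by rewrite nsq_dsum /nsq rdot_decomp.
have nB : nsq (B_tilde X p) = nsq (b0 f + defect b0 k) + nsq w + nsq x2.
  by rewrite BE nsq_dsum /nsq rdot_decomp.
(* The Halmos matrix is also selfadjoint, so its contribution to the imaginary part cancels. *)
have im : rdot (B_tilde X p) ('i%C *: p) = rdot (X y) ('i%C *: y).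
  have -> : rdot (X y) ('i%C *: y) = rdot x1 ('i%C *: cD n) + rdot x2 ('i%C *: e).
    have [y1 y2] : y.1 = cD n /\ y.2 = e by rewrite yE.
    by rewrite rdot_dsum -y1 -y2.
  have -> : rdot (B_tilde X p) ('i%C *: p) = rdot (b0 f + defect b0 k) ('i%C *: f)
      + rdot w ('i%C *: n) + rdot x2 ('i%C *: e).
    rewrite BE rdot_dsum; congr (_ + _).
    by rewrite -rdot_decomp !bop_rZ -scalerDr.
  congr (_ + _); rewrite /w !rdotDl.
  have -> : rdot (defect (adj K0) (incl DK x1)) ('i%C *: n) = rdot x1 ('i%C *: cD n).
    by rewrite dsaK bop_rZ -incl_cdefect -bop_rZ.
  have -> : rdot (K0 q) ('i%C *: n) = - rdot (defect b0 k) ('i%C *: f).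
    rewrite adjP bop_rZ -rdot_incl qE bop_rZ -/k rdotDl rdotNl.
    have /sa_rdot_i/(_ k) -> : selfadjoint b0 by apply/selfadjointE; exact: B0_sa.
    by rewrite subr0 dsa bop_rZ rdotC rdoti.
  have /sa_rdot_i/(_ f) -> : selfadjoint b0 by apply/selfadjointE; exact: B0_sa.
  by rewrite add0r addrA subrr add0r.
have [_ /(_ p)] := Bs; rewrite im np nB => h.
have nq : nsq (q - adj K0 m) <= d / (2 * (s + 1)).
  by rewrite nsqBC /q opprB addrA [adj K0 m + _]addrC.
have dE : d / (2 * (s + 1)) * (2 * (s + 1)) = d by rewrite divfK// gt_eqF// mulr_gt0.
have h2 : nsq f + nsq n + nsq e - (nsq (b0 f + defect b0 k) + nsq w + nsq x2)
    <= nsq y - nsq (X y) + 2 * (d / (2 * (s + 1))) by lra.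
apply: le_trans h _; apply: le_trans (ler_wpM2l s0 h2) _.
by move: eta0 dE; move: (d / _) => eta eta0 dE; nra.
Qed.

(** The vectors [(cD n, e)] are dense. Fixing a sign [b] replaces the absolute value by a quadratic
    form, whose nonnegativity passes to the closure. *)
Lemma sect_parameter : sect s c X.
Proof.
split=> // y; have key (b : R) : `|b| = 1 ->
    2 * c * (b * rdot (X y) ('i%C *: y)) <= s * (nsq y - nsq (X y)).
  move=> b1; rewrite -subr_ge0.
  pose M := s%:C%C *: (bid - adj X ∘ X) + (2 * c * b)%:C%C *: ('i%C *: X).
  have ME v : rdot (M v) v
      = s * (nsq v - nsq (X v)) - 2 * c * (b * rdot (X v) ('i%C *: v)).
    rewrite !bopE rdotDl !rdotZlR rdoti rdotDl rdotNl adjPr -!/(nsq _); ring.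
  rewrite -ME; apply: nonneg_closed => eps eps0.
  have [n nE] := defspace_approx y.1 eps0.
  exists ((cD n, y.2) : dsum DK E).
    by rewrite nsq_dsum/= subrr nsq0 addr0.
  rewrite ME subr_ge0; apply: le_trans (sect_parameter_range (erefl _)).
  apply: ler_wpM2l; first by rewrite mulr_ge0.
  by apply: le_trans (ler_norm _) _; rewrite normrM b1 mul1r.
have [r0|r0] := leP 0 (rdot (X y) ('i%C *: y)).
  by rewrite ger0_norm//; have := key 1 (normr1 _); lra.
by rewrite ltr0_norm//; have := key (- 1) (normrN1 _); lra.
Qed.
End ParameterClass.
End Coupling.
End Blocks.

Section Compression.
Context {R : realType} {H E : hilbertType R} {H0 : csubspace H} {B : 'L(H0, H)}.
Context (K0 : 'L(defspace (B0 B), orthc H0)) (X : 'L(dsum (defspace (adj K0)) E)).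
Hypotheses (Bh : hermitian_contraction B) (BK : is_K0 K0).

Lemma B_hatE z : B_hat X z = ext_block (Phi X z).
Proof. exact: B_hat_block. Qed.

Lemma B_hat_realizes z : invertible (bid - z *: entry22 X) ->
  realizes (B_tilde X) z (B_hat X z).
Proof. by move=> Xi; rewrite B_hatE; exact/B_tilde_realizes/transfer_realizes. Qed.

Lemma nt_limit_B_hat w (L : 'L(defspace (adj K0))) :
  nt_limit (Phi X) w L -> nt_limit (B_hat X) w (ext_block L).
Proof.
move=> FL x M e M1 e0.
have [d d0 dP] := nsq_small (incl (orthc H0) ∘ defect (adj K0) ∘ incl (defspace (adj K0))) e0.
have [r r0 rP] := FL (cdefect (adj K0) (oproj (orthc H0) x)) M d M1 d0.
exists r; first exact: r0.
move=> z Sz wz; have := dP _ (rP z Sz wz); rewrite bop_rB !bcompE => h.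
rewrite B_hatE (ext_blockE (Phi X z)) (ext_blockE L) opprD addrACA subrr add0r.
exact: h.
Qed.

(** For the adjoint, pair [Bt (x, z h) = (F x, h)] with [(f, 0)]: both that vector and its image
    [(B f, 0)] under the adjoint of [Bt] ignore the second coordinate. *)
Lemma qsc_extension_realized (Bt : 'L(dsum H E)) z (F : 'L(H)) :
  qsc_extension B dinl Bt -> csq z <= 1 -> realizes Bt z F ->
  (forall f, F (incl H0 f) = B f) -> qsc_extension B bid F.
Proof.
move=> [Bc _ Ba] z1 BF FB; split.
- exact: realizes_contractive Bc z1 BF.
- by apply: bopP => f; rewrite !bcompE !bidE FB.
apply: bopP => f; rewrite !bcompE !bidE; apply: rdot_ext => x.
have [h hE] := BF x; rewrite adjPr.
have /(congr1 (fun T : 'L(H0, dsum H E) => T f)) := Ba; rewrite !bcompE => BaE.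
have -> : rdot (incl H0 f) (F x) = rdot (dinl (incl H0 f) : dsum H E) (Bt ((x, z *: h) : dsum H E)).
  by rewrite hE rdot_dsum/= rdot0l addr0.
by rewrite -adjPr BaE rdot_dsum/= rdot0l addr0.
Qed.
End Compression.

Lemma invertibleN (R : realType) (U V : hilbertType R) (T : 'L(U, V)) :
  invertible T -> invertible (- T).
Proof.
case=> S [h1 h2]; exists (- S); split; apply: bopP => x; rewrite !bopE bop_rN opprK.
  by rewrite -[RHS]/((bid : 'L(U)) x) -h1.
by rewrite -[RHS]/((bid : 'L(V)) x) -h2.
Qed.

(** On the real radius the class passes unchanged from [A] to [F], and it is closed under strong
    limits. *)
Lemma realizes_sect_radial (R : realType) (U E : hilbertType R) (A : 'L(dsum U E))
    (F : R[i] -> 'L(U)) (s c : R) (w : R[i]) (L : 'L(U)) (b : bool) :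
  0 <= s -> 0 <= c -> sect s c A ->
  (forall z, `|z| < 1 -> realizes A z (F z)) ->
  w = ((-1) ^+ b)%:C%C -> nt_limit F w L -> sect s c L.
Proof.
move=> s0 c0 As AF wE FL.
apply: (cvgs_sect s0 c0 (nt_limit_radial wE FL)) => n.
have /andP[r0 r1] := @radial_pt_bounds R n.
have t1 : ((-1) ^+ b * radial_pt n) ^+ 2 < 1 :> R.
  by rewrite exprMn sqrr_sign mul1r; nra.
apply: realizes_sect (ltW t1) As _ => //; apply: AF.
by rewrite norm_lt1 /csq/= expr0n addr0.
Qed.

Theorem theorem4p1 (R : realType) (H E : hilbertType R) (H0 : csubspace H)
  (B : 'L(H0, H)) (K0 : 'L(defspace (B0 B), orthc H0))
  (X : 'L(dsum (defspace (adj K0)) E)) (Bt : 'L(dsum H E)) :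
  separable H -> separable E ->
  hermitian_contraction B -> is_K0 K0 ->
  contractive X -> qsc_extension B dinl Bt -> Bt = B_tilde X ->
  (forall z : R[i], `|z| < 1 ->
    [/\ [/\ invertible (bid - z *: entry22 X),
            invertible (z *: Bt - bid) &
            invertible (z *: B_hat X z - bid)],
        dfst ∘ binv (z *: Bt - bid) ∘ dinl = binv (z *: B_hat X z - bid),
        B_hat X z = ext_block (Phi X z) &
        qsc_extension B bid (B_hat X z)]) /\
  (forall a : R, 0 <= a -> a < pi / 2 -> C_class a Bt ->
    [/\ (forall z, Pi_region a z ->
           invertible (bid - z *: entry22 X) /\
           B_hat X z = ext_block (Phi X z)),
        (forall (b : R) (z : R[i]), a <= b -> b < pi / 2 -> z != 1 -> z != -1 ->
           [/\ Pi_plus b z ->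
                 contractive (sinC b *: B_hat X z + icos b *: bid),
               Pi_minus b z ->
                 contractive (sinC b *: B_hat X z - icos b *: bid) &
               C_region b z -> C_class b (B_hat X z)]) &
        exists (Phim Phip : 'L(defspace (adj K0))) (Bm Bp : 'L(H)),
          [/\ [/\ strong_nt_limit (Phi X) (-1) Phim,
                  strong_nt_limit (Phi X) 1 Phip,
                  strong_nt_limit (B_hat X) (-1) Bm &
                  strong_nt_limit (B_hat X) 1 Bp],
              [/\ C_class a Phim, C_class a Phip, C_class a Bm & C_class a Bp] &
              a = 0 ->
                [/\ (forall Y, Y = Phim \/ Y = Phip ->
                       selfadjoint Y /\ contractive Y),
                    Phim = Z0 X /\ Phip = Z1 X,
                    sc_extension B Bm /\ sc_extension B Bp &
                    Bm = ext_block (Z0 X) /\ Bp = ext_block (Z1 X)]]]).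
Proof.
move=> _ _ Bh BK Xc Bq BtE; have [Btc _ _] := Bq.
have hatE := B_hatE X BK.
have hatR z : invertible (bid - z *: entry22 X) -> realizes Bt z (B_hat X z).
  by rewrite BtE; exact: B_hat_realizes.
split.
  move=> z z1; have z1' : csq z <= 1 by rewrite ltW// -norm_lt1.
  have Xi := disc_invertible (entry22_contractive Xc) z1.
  have Bti : invertible (z *: Bt - bid).
    by rewrite -opprB; apply/invertibleN/disc_invertible.
  have Bhi : invertible (z *: B_hat X z - bid).
    rewrite -opprB; apply/invertibleN/disc_invertible => //.
    exact: realizes_contractive Btc z1' (hatR z Xi).
  split=> //; first exact: realizes_resolvent (hatR z Xi).
  apply: qsc_extension_realized Bq z1' (hatR z Xi) _ => f.
  by rewrite hatE ext_block_extends.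
move=> a a0 a1 /(C_classP _ a0 a1) Bs.
have Xs : sect (sin a) (cos a) X.
  have [_ s0 c0] := sincos a0 a1.
  by apply: (sect_parameter Bh BK s0 (ltW c0) Xc); rewrite -BtE.
have [sca s0a c0a] := sincos a0 a1.
split.
- by move=> z za; split=> //; exact: Pi_region_invertible a0 a1 za Xs.
- move=> b z ab b1 z1 zm1; have b0 := le_trans a0 ab.
  have [sc s0 c0] := sincos b0 b1.
  have Bsb := sect_mono a0 ab b1 Bs; have Xsb := sect_mono a0 ab b1 Xs.
  have rotB (e : bool) : csq (z * (sin b)%:C%C + 'i%C * ((-1) ^+ e * cos b)%:C%C) < 1 ->
      contractive (rotop (sin b) ((-1) ^+ e * cos b) (B_hat X z)).
    move=> zsc; have sc' : sin b ^+ 2 + ((-1) ^+ e * cos b) ^+ 2 = 1.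
      by rewrite exprMn sqrr_sign mul1r.
    (* If [sin b = 0], the disc condition would read [(cos b)^2 < 1] while [(cos b)^2 = 1]. *)
    have s1 : 0 < sin b.
      rewrite lt_def s0 andbT; apply/eqP => sb0; move: zsc sc'.
      rewrite sb0 mulr0 add0r expr0n add0r /csq/=.
      rewrite !mul0r mulr0 !mul1r subr0 !add0r => h1 h2.
      by move: h1; rewrite h2 expr0n add0r ltxx.
    have rotS V (A : 'L(V)) : sect (sin b) (cos b) A ->
        contractive (rotop (sin b) ((-1) ^+ e * cos b) A).
      by move=> /(sect_rot sc s0 (ltW c0))[]; case: (e); rewrite ?expr1 ?expr0 ?mulN1r ?mul1r.
    apply: (realizes_rot sc' (rotS _ _ Bsb) (ltW zsc)); apply: hatR.
    exact: rot_invertible s1 sc' (entry22_rot (rotS _ _ Xsb)) zsc.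
  have plus : Pi_plus b z -> contractive (sinC b *: B_hat X z + icos b *: bid).
    rewrite contr_plusE /Pi_plus /= norm_lt1 => h; have := rotB false.
    by rewrite expr0 mul1r; apply.
  have minus : Pi_minus b z -> contractive (sinC b *: B_hat X z - icos b *: bid).
    rewrite contr_minusE /Pi_minus /= norm_lt1 => h; have := rotB true.
    by rewrite expr1 mulN1r rmorphN mulrN; apply.
  split=> //; rewrite /C_region /C_class; case: eqP => [bE|_] /=; last first.
    by case=> /plus h1 /minus h2.
  (* For [b = 0] the region is a real segment. Without its endpoints it lies in the open unit disc,
     where the real-parameter argument applies. *)
  move=> /andP[]; rewrite !lecE /= oppr0 => /andP[/eqP im0 h1] /andP[_ h2].
  have zE : z = (complex.Re z)%:C%C by case: (z) im0 => x y /= ->.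
  have t1 : complex.Re z ^+ 2 < 1.
    have n1 : complex.Re z != 1 by apply: contra_neq z1 => r1; rewrite zE r1.
    have nm1 : complex.Re z != -1.
      by apply: contra_neq zm1 => r1; rewrite zE r1 rmorphN.
    have : complex.Re z < 1 by rewrite lt_neqAle n1.
    have : -1 < complex.Re z by rewrite lt_neqAle eq_sym nm1.
    by nra.
  apply/sect0; move: Bsb; rewrite bE sin0 cos0 => Bsb.
  apply: (realizes_sect (lexx 0) (ltW t1) Bsb); rewrite -zE; apply: hatR.
  apply: disc_invertible; first exact: entry22_contractive.
  by rewrite norm_lt1 zE /csq/= expr0n addr0.
have [Phip hp] := nt_limit_transfer1 s0a c0a Xs.
have [L hL] := nt_limit_transfer1 s0a c0a (sectN Xs).
have hm : nt_limit (Phi X) (-1) (- L).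
  by apply: nt_limitN hL => z; rewrite transferN !opprK.
have hBp := nt_limit_B_hat BK hp; have hBm := nt_limit_B_hat BK hm.
have w1 : (1 : R[i]) = ((-1) ^+ false)%:C%C by [].
have wm1 : (-1 : R[i]) = ((-1) ^+ true)%:C%C by rewrite expr1 rmorphN.
have discX z : `|z| < 1 -> invertible (bid - z *: entry22 X).
  by move=> z1; exact: disc_invertible (entry22_contractive Xc) z1.
have FX z : `|z| < 1 -> realizes X z (Phi X z) by move=> /discX/transfer_realizes.
have FB z : `|z| < 1 -> realizes Bt z (B_hat X z) by move=> /discX/hatR.
have sPm := realizes_sect_radial s0a (ltW c0a) Xs FX wm1 hm.
have sPp := realizes_sect_radial s0a (ltW c0a) Xs FX w1 hp.
have sBm := realizes_sect_radial s0a (ltW c0a) Bs FB wm1 hBm.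
have sBp := realizes_sect_radial s0a (ltW c0a) Bs FB w1 hBp.
exists (- L), Phip, (ext_block (- L)), (ext_block Phip); split.
- by split; exact: nt_limit_strong.
- by split; apply/C_classP.
move=> aE; move: sPm sPp sBm sBp Xs; rewrite aE sin0 cos0.
move=> /sect0[mS mC] /sect0[pS pC] /sect0[BmS BmC] /sect0[BpS BpC] Xs.
have LE := shorted_limit_entry (sectN Xs) (nt_limit_radial1 hL).
have PpE : Phip = Z1 X := shorted_limit_entry Xs (nt_limit_radial1 hp).
(* [L] belongs to [- X], and [I - (- X) = I + X] is the operator shorted in [Z0]. *)
have PmE : - L = Z0 X.
  rewrite LE opprK; apply: bopP => u.
  by rewrite /Z0 -[RHS]opprK -bopNE; congr (- _); rewrite -opprB.
split.
- by move=> Y [->|->].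
- by split.
- by split; split=> //; apply: bopP => f; rewrite !bcompE !bidE ext_block_extends.
- by rewrite PmE PpE.
Qed.
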